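(* Let $X=X(\mathbb T)$ be a Banach lattice satisfying Assumption A, and let $r,s\in\mathbb N$ with $2r\ge s$. Then for all $f\in X$ and $n\in\mathbb N$ $$K_s(f,1/n)_{X_n}\asymp\|(I-\dot A_{\gamma/n})^sf\|_X+\|(I-A_{\gamma/n})^rf\|_{X_n},$$ where $\asymp$ denotes a two-sided inequality with positive constants independent of $f$ and $n$, and $$K_s(f,h)_{X_n}:=\inf_{g\in X^s}\left(\|f-g\|_X+\|f-g\|_{X_n}+h^s\|g^{(s)}\|_X\right),\quad h>0.$$
   Context: $\mathbb T$ is the unit circle identified with $[-\pi,\pi)$ (functions on $\mathbb T$ are $2\pi$-periodic), with normalized Lebesgue measure $\mu$. A Banach lattice $X=X(\mathbb T)$ is a Banach space of measurable functions on $\mathbb T$ such that: 1) if $f$ is measurable, $g\in X$ and $|f|\le|g|$, then $f\in X$ and $\|f\|_X\le\|g\|_X$; 2) if $f_n\in X$, $\sup_n\|f_n\|_X<\infty$ and $0\le f_n\uparrow f$, then $f\in X$ and $\|f_n\|_X\to\|f\|_X$; 3) for every measurable $E$ with $\mu(E)<\infty$, $\chi_E\in X$ and there is $c_E>0$ with $\int_E|f|\,d\mu\le c_E\|f\|_X$. Functions in $X$ are regarded as finite-valued and defined at every point, not as equivalence classes. Steklov averages: $A_hf(x)=\frac1h\int_{x-h/2}^{x+h/2}f(t)\,dt$ and $\dot A_hf(x)=A_hf(x+\tfrac h2)$ for $h>0$; $I$ is the identity. Assumption A: $A_hf\in X$ for all $f\in X$, $h>0$, and $\sup_{h>0,\,\|f\|_X\le1}\|A_hf\|_X<\infty$.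 $X^s$ is the set of $g$ such that $g^{(s-1)}$ is absolutely continuous on $\mathbb T$ and $g^{(s)}\in X$. For each $n\in\mathbb N$, $x_k=x_{k,n}\in\mathbb T$, $k=1,\dots,m_n$, are given nodes such that for some fixed $\gamma,\gamma'>0$ (independent of $n$), $\frac{\gamma}{n}\le x_{k+1,n}-x_{k,n}\le\frac{\gamma'}{n}$ for $k=1,\dots,m_n$, with $x_{m_n+1,n}=2\pi+x_{1,n}$. The constant $\gamma$ in the claim is this one. The discrete semi-norm is $\|f\|_{X_n}=\big\|\sum_{k=1}^{m_n}|f(x_k)|\chi_{[x_k,x_{k+1})}\big\|_X$. *)

(* Defs.v *)
From HB Require Import structures.
From mathcomp Require Import all_boot all_order all_algebra.
From mathcomp Require Import all_classical all_reals all_analysis.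

Set Implicit Arguments.
Unset Strict Implicit.
Unset Printing Implicit Defensive.
Import Order.TTheory GRing.Theory Num.Theory.
Import numFieldNormedType.Exports.

Local Open Scope classical_set_scope.
Local Open Scope ring_scope.

(* The real line with its Lebesgue (that is, Caratheodory) sigma-algebra. The
   library's default structure on R is the Borel one, too small here. *)
Definition lebesgueType (R : realType) :=
  caratheodory_type ((@wlength R idfun)^*)%mu.

Notation leb := completed_lebesgue_measure.

Definition lebesgue_measurable {R : realType} (E : set R) : Prop :=
  @measurable _ (lebesgueType R) E.

Definition lebesgue_measurable_fun {R : realType} (f : R -> R) : Prop :=
  @measurable_fun _ _ (lebesgueType R) (measurableTypeR R) setT f.

(* A function on the circle is a 2 pi-periodic function on the line. *)
Definition on_circle {R : realType} (f : R -> R) : Prop :=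
  periodic f (pi *+ 2).

(* The subset of the circle represented by E, as a 2 pi-periodic subset of the
   line; used for subsets of [-pi, pi[ and for arcs [a, b[ that may go past
   pi. *)
Definition periodize {R : realType} (E : set R) : set R :=
  [set t | exists j : int, E (t + (pi *+ 2) *~ j)].

(* Elements of X are genuine functions, so the norm only separates them up to
   equality almost everywhere, and order relations hold almost everywhere. For
   periodic functions "a.e. on the line" is "a.e. on the circle". In
   [lattice_Fatou] a finite-valued limit f loses nothing: by
   [lattice_integral] the limit is integrable, hence finite a.e. *)
Record banachLattice (R : realType) := BanachLattice {
  lattice_mem :> (R -> R) -> Prop ;
  lnorm : (R -> R) -> R ;
  lattice_on_circle : forall f, lattice_mem f -> on_circle f ;
  lattice_measurable : forall f, lattice_mem f -> lebesgue_measurable_fun f ;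
  lattice_add : forall f g, lattice_mem f -> lattice_mem g ->
    lattice_mem (f \+ g) ;
  lattice_scale : forall (a : R) f, lattice_mem f ->
    lattice_mem (fun t => a * f t) ;
  lnorm_triangle : forall f g, lattice_mem f -> lattice_mem g ->
    lnorm (f \+ g) <= lnorm f + lnorm g ;
  lnorm_scale : forall (a : R) f, lattice_mem f ->
    lnorm (fun t => a * f t) = `|a| * lnorm f ;
  lnorm_eq0 : forall f, lattice_mem f ->
    lnorm f = 0 <-> {ae @leb R, forall t, f t = 0} ;
  lattice_complete : forall F : nat -> R -> R,
    (forall n, lattice_mem (F n)) ->
    (forall e : R, 0 < e -> exists n0 : nat, forall n p : nat,
       (n0 <= n)%N -> (n0 <= p)%N -> lnorm (F n \- F p) < e) ->
    exists2 f, lattice_mem f & lnorm (F n \- f) @[n --> \oo] --> (0 : R) ;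
  lattice_ideal : forall f g, on_circle f -> lebesgue_measurable_fun f ->
    lattice_mem g -> {ae @leb R, forall t, `|f t| <= `|g t|} ->
    lattice_mem f /\ lnorm f <= lnorm g ;
  lattice_Fatou : forall (F : nat -> R -> R) (f : R -> R),
    (forall n, lattice_mem (F n)) ->
    (exists M : R, forall n, lnorm (F n) <= M) ->
    on_circle f -> lebesgue_measurable_fun f ->
    {ae @leb R, forall t, (forall n, 0 <= F n t) /\
       (forall n, F n t <= F n.+1 t) /\ (F n t @[n --> \oo] --> f t)} ->
    lattice_mem f /\ (lnorm (F n) @[n --> \oo] --> lnorm f) ;
  lattice_indic : forall E : set R, lebesgue_measurable E ->
    E `<=` [set` `[(- pi : R), pi[] ->
    lattice_mem (\1_(periodize E)) ;
  lattice_integral : forall E : set R, lebesgue_measurable E ->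
    E `<=` [set` `[(- pi : R), pi[] ->
    exists2 c : R, 0 < c & forall f, lattice_mem f ->
      (((pi *+ 2)^-1)%:E * \int[@leb R]_(t in E) `|f t|%:E
         <= (c * lnorm f)%:E)%E
}.

Section Steklov.
Context {R : realType}.
Implicit Types (h : R) (f : R -> R).

Definition steklov h f : R -> R :=
  fun x => h^-1 * \int[@leb R]_(t in `[x - h / 2, x + h / 2]) f t.

Definition steklov_dot h f : R -> R := fun x => steklov h f (x + h / 2).

(* The power (I - A)^k f of an operator A, applied to f *)
Definition id_minus_pow (A : (R -> R) -> R -> R) (k : nat) f : R -> R :=
  iter k (fun u => u \- A u) f.

End Steklov.

Definition assumptionA (R : realType) (X : banachLattice R) : Prop :=
  (forall (h : R) f, 0 < h -> X f -> X (steklov h f)) /\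
  (exists M : R, forall (h : R) f, 0 < h -> X f -> lnorm X f <= 1 ->
     lnorm X (steklov h f) <= M).

Definition abs_continuous {R : realType} (a b : R) (f : R -> R) : Prop :=
  forall e : R, 0 < e -> exists2 d : R, 0 < d &
    forall (n : nat) (u v : 'I_n -> R),
      (forall i, [/\ a <= u i, u i < v i & v i <= b]) ->
      (forall i j, i != j -> v i <= u j \/ v j <= u i) ->
      \sum_(i < n) (v i - u i) < d ->
      \sum_(i < n) `|f (v i) - f (u i)| < e.

(* The space X^s, for s >= 1. Where g^(s-1) is not differentiable (a null set),
   [derive1n s g] takes an arbitrary finite default value. *)
Definition smooth_class (R : realType) (X : banachLattice R) (s : nat) :
    set (R -> R) :=
  [set g | [/\ on_circle g,
     (forall k, (k < s.-1)%N -> forall x : R, derivable (derive1n k g) x 1),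
     abs_continuous (- pi) pi (derive1n s.-1 g) & X (derive1n s g)]].

(* [x n k] is meaningful for n >= 1 and 1 <= k <= (m n).+1 *)
Definition node_system {R : realType} (gamma gamma' : R)
    (m : nat -> nat) (x : nat -> nat -> R) : Prop :=
  forall n, (0 < n)%N ->
    [/\ (0 < m n)%N,
        (forall k, (1 <= k <= m n)%N -> x n k \in `[(- pi : R), pi[),
        x n (m n).+1 = pi *+ 2 + x n 1%N
      & (forall k, (1 <= k <= m n)%N ->
           gamma / n%:R <= x n k.+1 - x n k <= gamma' / n%:R)].

Definition discrete_norm (R : realType) (X : banachLattice R)
    (m : nat -> nat) (x : nat -> nat -> R) (n : nat) (f : R -> R) : R :=
  lnorm X (fun t => \sum_(1 <= k < (m n).+1)
    `|f (x n k)| * \1_(periodize [set` `[x n k, x n k.+1[]) t).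

Definition K_functional (R : realType) (X : banachLattice R)
    (m : nat -> nat) (x : nat -> nat -> R) (s n : nat) (f : R -> R) (h : R) :
    R :=
  inf [set lnorm X (f \- g) + discrete_norm X m x n (f \- g)
           + h ^+ s * lnorm X (derive1n s g) | g in smooth_class X s].

(* Main.v *)
(* Put h = gamma / n, A = steklov h, A' = steklov_dot h, and let P f (x) be the
   mean of f over [x, x + h] with the decreasing weight 2 (1 - t / h) / h and
   P' f (x) the one with the increasing weight 2 t / h^2, so that
   A' = (P + P') / 2.

   Symmetric versus one-sided differences. Since (P f)' = - (2 / h) (I - A') f,
   Taylor expansion bounds (I - A) P f pointwise by moving averages of
   |(I - A') f|, and (I - A) P^2 f by those of |(I - A')^2 f|. The function
   w = (I - P) f satisfies |w| <= psi + P' |w| / 2, where psi is made of moving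
   averages of |(I - A') f|. Iterating this K times produces the factor 2^-K,
   whereas P'^K |w| is dominated by an average of |w| over [x, x + K h] and its
   norm grows only linearly in K; hence ||(I - P) f|| <= C ||(I - A') f||.
   Together, ||(I - A)^r f|| <= C ||(I - A')^s f|| for s <= 2 r, and likewise
   ||B^s f|| <= C ||(I - A')^s f|| for B f (x) = A f (x + h/2) - A f (x - h/2).

   Upper bound for K. With T = I - A^(2s), take g = f - T^r f. Then T^r f is a
   bounded function of A applied to (I - A)^r f, which gives f - g, and
   g = A^(2s) F with g^(s) = h^-s B^s F, where F is a bounded function of A
   applied to f.

   Lower bound for K. On f - g the powers are bounded, in X and in X_n up to X;
   on g, Taylor expansion gives h^s ||g^(s)||, nodal values being dominated by
   moving averages of |g^(s)|. *)

(* Assumption A bounds centred averages only, and [X] need not be invariant under translations.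
   One-sided averages and differences are therefore dominated pointwise by the integral of [|v|]
   over a centred window, whose norm costs a single factor [M]. The linear growth in [K] rests on
   this: multiplying norms of [P'] would give a power of [M], which [2^-K] need not beat. Membership
   in [X] says nothing about values at prescribed points. Nodal values can be bounded by the norm of
   [X] only after an average or a Taylor remainder has turned them into an integral; the window is
   then widened by the length of an arc. The nodal values that occur in the claim itself must be
   carried along unchanged. Elements of [X] are Lebesgue measurable, while translations and
   Radon-Nikodym densities are handled on Borel sets, so integrals pass through Borel
   representatives. The top derivative of an element of [X^s] exists only almost everywhere and is
   tied to the function by absolute continuity in its epsilon-delta form; recovering the increments
   from it takes total variation, a Stieltjes measure and Lebesgue differentiation. *)
Require Import Defs.
From HB Require Import structures.
From mathcomp Require Import all_boot all_order all_algebra.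
From mathcomp Require Import all_classical all_reals all_analysis.
From mathcomp Require Import measurable_realfun.
From mathcomp Require Import ring lra zify.
Set Implicit Arguments.
Unset Strict Implicit.
Unset Printing Implicit Defensive.
Import Order.TTheory GRing.Theory Num.Theory.
Import numFieldNormedType.Exports.
Local Open Scope classical_set_scope.
Local Open Scope ring_scope.

(** * Borel representatives of Lebesgue measurable functions *)

Section Completed.
Context {R : realType}.
Local Notation mu := (@lebesgue_measure R).
Implicit Types (A D M : set R) (f g : R -> R).

Lemma borel_lebesgue A :
  @measurable _ (measurableTypeR R) A -> lebesgue_measurable A.
Proof. exact: sub_caratheodory. Qed.

Lemma itv_lebesgue (i : interval R) : lebesgue_measurable [set` i].
Proof. apply: borel_lebesgue; exact: measurable_itv. Qed.

Lemma measurable_fun_borel_lebesgue g :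
  measurable_fun [set: R] g ->
  lebesgue_measurable_fun g.
Proof.
move=> mg _ B mB; apply: borel_lebesgue; exact: mg.
Qed.

(** The Caratheodory sets form the completion of the Borel sets: [A] is a Borel set together with
    part of a Borel null set. Removing the whole null set from both sides leaves a purely Borel
    statement. *)
Lemma lebesgue_set_borel A : lebesgue_measurable A ->
  exists B M, [/\ @measurable _ (measurableTypeR R) B,
    @measurable _ (measurableTypeR R) M, mu M = 0 &
    A `\` M = B `\` M].
Proof.
rewrite /lebesgue_measurable => mA.
have : (measurable_realfun.completed_algebra_gen mu).-sigma.-measurable A.
  by rewrite completed_caratheodory_measurable.
rewrite g_sigma_completed_algebra_genE => -[B /= mB [N [M [mM M0 NM]]]] <-.
exists B, M; split => //.
by rewrite setDUl setUidl// => x [/NM].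
Qed.

(** Measurability is decided by the sets where [f] exceeds a rational, and these are countably many,
    so one null set serves for all of them. *)
Lemma lebesgue_fun_borel f : lebesgue_measurable_fun f ->
  exists M, [/\ @measurable _ (measurableTypeR R) M, mu M = 0 &
    measurable_fun [set: R] (f \_ (~` M))].
Proof.
move=> mf.
pose q n : rat := odflt 0%R (unpickle n).
have mS (r : rat) : lebesgue_measurable (f @^-1` `]ratr r, +oo[).
  have := mf (@measurableT _ (lebesgueType R)) _
    (@measurable_itv R `]ratr r, +oo[).
  by rewrite setTI.
have /choice[BM BMP] : forall r : rat, exists BM : set R * set R,
   [/\ @measurable _ (measurableTypeR R) BM.1,
    @measurable _ (measurableTypeR R) BM.2, mu BM.2 = 0 &
    (f @^-1` `]ratr r, +oo[) `\` BM.2 = BM.1 `\` BM.2].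
  by move=> r; have [B [M ?]] := lebesgue_set_borel (mS r); exists (B, M).
pose M := \bigcup_n (BM (q n)).2.
have mM : @measurable _ (measurableTypeR R) M.
  by apply: bigcupT_measurable => n; have [] := BMP (q n).
exists M; split => //.
  have [N [mN N0 MN]] : mu.-negligible M.
    apply: negligible_bigcup => n; exists (BM (q n)).2.
    by have [_ ? ? _] := BMP (q n); split.
  by apply/eqP; rewrite eq_le measure_ge0 andbT -N0 le_measure ?inE.
apply: (measurability _ (@measurable_realfun.RGenOInfty.measurableE R)) => _ [_ [y ->] <-].
rewrite setTI.
have qM (r : rat) : BM r = BM (q (pickle r)) by rewrite /q pickleK.
have mE (r : rat) : @measurable _ (measurableTypeR R)
    ((f \_ (~` M)) @^-1` `]ratr r, +oo[).
  (* The restricted function is 0 on [M], so [M] belongs to the superlevel set exactly when the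
     level is negative. *)
  have -> : (f \_ (~` M)) @^-1` `]ratr r, +oo[ =
     ((BM r).1 `\` M) `|` (if (ratr r < 0 :> R) then M else set0).
    have subM : (BM r).2 `<=` M by rewrite qM => x ?; exists (pickle r).
    have E : (f @^-1` `]ratr r, +oo[) `\` M = (BM r).1 `\` M.
      have [_ _ _ e] := BMP r.
      have aux X : X `\` M = (X `\` (BM r).2) `\` M by rewrite setDDl setUidr.
      by rewrite aux e -aux.
    rewrite -E; apply/seteqP; split=> x /=; rewrite patchE;
      have [Mx|nMx] := pselect (M x).
    - by rewrite memNset ?in_itv/= ?andbT => [->|]; [right|apply].
    - by rewrite mem_set// => fx; left.
    - by rewrite memNset ?in_itv/= ?andbT; [case=> [[]//|]; case: ifPn|apply].
    - by rewrite mem_set// => -[[]//|]; case: ifPn.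
  apply: measurableU; first by apply: measurableD => //; have [] := BMP r.
  by case: ifPn.
rewrite (_ : _ @^-1` _ =
  \bigcup_(r in [set r : rat | y < ratr r]) ((f \_ (~` M)) @^-1` `]ratr r, +oo[)).
  rewrite bigcup_mkcond; apply: bigcupT_measurable_rat => r; case: ifPn => _.
    exact: mE.
  exact: measurable0.
apply/seteqP; split=> [x|x [r yr]] /=; rewrite !in_itv/= !andbT.
  by move=> /rat_in_itvoo[r]; rewrite in_itv/= => /andP[? ?]; exists r => //=;
    rewrite in_itv/= andbT.
exact: lt_trans.
Qed.

End Completed.

Section Integrals.
Context {R : realType}.
Local Notation mu := (@lebesgue_measure R).
Local Notation lebR := (@leb R).
Implicit Types (A D M : set R) (f g : R -> R).

(** As a map from the Lebesgue to the Borel sigma-algebra, the identity pushes [leb] forward to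
    [mu]; Borel integrands move between the two measures by change of variables. *)
Let idb : lebesgueType R -> measurableTypeR R := fun x => x.

Let midb : measurable_fun setT idb.
Proof. by move=> _ B mB; rewrite setTI; exact: borel_lebesgue. Qed.

Lemma integrable_leb_borel D g : @measurable _ (measurableTypeR R) D ->
  measurable_fun [set: R] g ->
  lebR.-integrable D (EFin \o g) <-> mu.-integrable D (EFin \o g).
Proof.
move=> mD mg.
have E : (\int[mu]_(x in D) `|(g x)%:E| = \int[lebR]_(x in D) `|(g x)%:E|)%E.
  transitivity (\int[pushforward lebR idb]_(x in D) `|(g x)%:E|)%E.
    exact: eq_measure_integral.
  rewrite ge0_integral_pushforward//.
  have mge : measurable_fun D (EFin \o g).
    exact/measurable_EFinP/measurable_funTS.
  exact: measurableT_comp mge.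
split=> /integrableP[_ fin]; apply/integrableP; split.
- exact/measurable_EFinP/measurable_funTS.
- by rewrite E.
- apply/measurable_EFinP/measurable_funTS; exact: measurable_fun_borel_lebesgue.
- by rewrite -E.
Qed.

Lemma Rintegral_leb_borel D g : @measurable _ (measurableTypeR R) D ->
  measurable_fun [set: R] g ->
  mu.-integrable D (EFin \o g) ->
  \int[lebR]_(x in D) g x = \int[mu]_(x in D) g x.
Proof.
move=> mD mg ig; rewrite /Rintegral; congr fine.
transitivity (\int[pushforward lebR idb]_(x in D) (g x)%:E)%E; last first.
  exact: eq_measure_integral.
rewrite integral_pushforward//; first exact/measurable_EFinP.
exact/integrable_leb_borel.
Qed.

Definition locint f := lebesgue_measurable_fun f /\
  forall a b, lebR.-integrable `[a, b] (EFin \o f).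

Lemma locint_borel f : locint f ->
  exists g, [/\ measurable_fun [set: R] g,
   exists M, [/\ @measurable _ (measurableTypeR R) M, mu M = 0 &
     forall x, ~ M x -> f x = g x] & locint g].
Proof.
move=> [mf fi]; have [M [mM M0 mg]] := lebesgue_fun_borel mf.
exists (f \_ (~` M)); split => //.
  exists M; split => // x nMx; rewrite patchE mem_set//.
split; first exact: measurable_fun_borel_lebesgue.
move=> a b; have mI := @measurable_itv R `[a, b].
have mT : measurable_fun setT (f \_ (~`M) : lebesgueType R -> R).
  exact: measurable_fun_borel_lebesgue.
apply: le_integrable (fi a b); first exact: itv_lebesgue.
  exact/measurable_EFinP/measurable_funTS.
move=> x _ /=; rewrite lee_fin patchE; case: ifP => // _.
by rewrite normr0.
Qed.

Lemma ae_eq_Rintegral (D : set (lebesgueType R)) f g :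
  measurable D -> lebesgue_measurable_fun f -> lebesgue_measurable_fun g ->
  {ae lebR, forall x, f x = g x} ->
  \int[lebR]_(x in D) f x = \int[lebR]_(x in D) g x.
Proof.
move=> mD mf mg fg; rewrite /Rintegral; congr fine; apply: ae_eq_integral; first exact: mD.
- exact/measurable_EFinP/measurable_funTS.
- exact/measurable_EFinP/measurable_funTS.
- case: fg => N [mN N0 fgN]; exists N; split => // x nP.
  by apply: fgN => fgx; apply: nP => _ /=; rewrite fgx.
Qed.

Lemma borel_null_ae M (P : R -> Prop) :
  @measurable _ (measurableTypeR R) M -> mu M = 0 ->
  (forall x, ~ M x -> P x) -> {ae lebR, forall x, P x}.
Proof.
move=> mM M0 MP; exists M; split => //; first exact: borel_lebesgue.
by move=> x /= nP; apply: contrapT => /MP.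
Qed.

End Integrals.

(** * Locally integrable functions and oriented integrals *)

Section Translation.
Context {R : realType}.
Local Notation mu := (@lebesgue_measure R).
Local Notation lebR := (@leb R).
Implicit Types (f g : R -> R) (a b c : R).

Let shift_fun c : measurableTypeR R -> measurableTypeR R := fun x => x + c.

Let measurable_shift c : measurable_fun setT (shift_fun c).
Proof. exact: measurable_funD. Qed.

Lemma preimage_shift_itv c (b1 b2 : bool) a b :
  (fun x : R => x + c) @^-1` [set` Interval (BSide b1 (a + c)) (BSide b2 (b + c))]
  = [set` Interval (BSide b1 a) (BSide b2 b)].
Proof.
apply/seteqP; split=> x /=; rewrite !in_itv/=;
  by case: b1; case: b2; rewrite /= ?lerD2r ?ltrD2r.
Qed.

(** A translate of Lebesgue measure has the same values on half-open intervals, and these determine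
    the measure. *)
Lemma lebesgue_measure_shift c (A : set R) :
  @measurable _ (measurableTypeR R) A ->
  mu A = mu ((fun x => x + c) @^-1` A).
Proof.
apply: (@lebesgue_measure_unique R (pushforward mu (shift_fun c))).
move=> X /ocitvP[->|[[a b] /= ab ->]]; first by rewrite !measure0.
rewrite /pushforward /shift_fun -[a](subrK c) -[b](subrK c) preimage_shift_itv.
rewrite !lebesgue_measure_itv/= !lte_fin !subrK ltrD2r.
by case: ifP => // _; rewrite -!EFinD; congr (_%:E); ring.
Qed.

Lemma Rintegral_shift c a b g : measurable_fun [set: R] g ->
  (forall a b, mu.-integrable `[a, b] (EFin \o g)) ->
  mu.-integrable `[a, b] (EFin \o (fun t => g (t + c))) /\
  \int[mu]_(t in `[a, b]) g (t + c) = \int[mu]_(t in `[a + c, b + c]) g t.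
Proof.
move=> mg ig.
have E : (\int[mu]_(t in `[(a + c)%R, (b + c)%R]) `|(g t)%:E| =
    \int[mu]_(t in `[a, b]) `|(g (t + c)%R)%:E|)%E.
  transitivity (\int[pushforward mu (shift_fun c)]_(t in `[(a + c)%R, (b + c)%R])
     `|(g t)%:E|)%E.
    by apply: eq_measure_integral => A mA _; exact: lebesgue_measure_shift.
  rewrite ge0_integral_pushforward//; last first.
    have mge : measurable_fun `[a + c, b + c] (EFin \o g).
      exact/measurable_EFinP/measurable_funTS.
    exact: measurableT_comp mge.
  by rewrite preimage_shift_itv.
have mgc : measurable_fun [set: R] (fun t => g (t + c)).
  exact: (measurableT_comp mg (measurable_shift c)).
have igc : mu.-integrable `[a, b] (EFin \o (fun t => g (t + c))).
  apply/integrableP; split; first exact/measurable_EFinP/measurable_funTS.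
  by rewrite -E; have /integrableP[] := ig (a + c) (b + c).
split => //; rewrite /Rintegral; congr fine; symmetry.
transitivity (\int[pushforward mu (shift_fun c)]_(t in `[(a + c)%R, (b + c)%R])
     (g t)%:E)%E.
  by apply: eq_measure_integral => A mA _; exact: lebesgue_measure_shift.
have P : shift_fun c @^-1` `[a + c, b + c]%classic = `[a, b]%classic.
  exact: preimage_shift_itv.
by rewrite integral_pushforward ?P//; exact/measurable_EFinP.
Qed.

End Translation.

Section LocInt.
Context {R : realType}.
Local Notation mu := (@lebesgue_measure R).
Local Notation lebR := (@leb R).
Implicit Types (f g : R -> R) (a b c : R).

Lemma locint_repr f : locint f -> exists g,
  [/\ measurable_fun [set: R] g,
   (forall a b, mu.-integrable `[a, b] (EFin \o g)),
   (exists M, [/\ @measurable _ (measurableTypeR R) M, mu M = 0 &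
     forall x, ~ M x -> f x = g x]) &
   forall a b, \int[lebR]_(t in `[a, b]) f t = \int[mu]_(t in `[a, b]) g t].
Proof.
move=> lf; have [g [mg [M [mM M0 fg]] lg]] := locint_borel lf.
have ig a b : mu.-integrable `[a, b] (EFin \o g).
  by apply/(integrable_leb_borel (@measurable_itv R `[a, b]) mg); exact: lg.2.
exists g; split => //; first by exists M.
move=> a b; rewrite -(Rintegral_leb_borel (@measurable_itv R `[a, b]) mg (ig a b)).
apply: ae_eq_Rintegral; [exact: itv_lebesgue|exact: lf.1|exact: lg.1|].
exact: borel_null_ae mM M0 fg.
Qed.

Lemma locint_continuous f : continuous f -> locint f.
Proof.
move=> cf; have mf : measurable_fun [set: R] f by exact: continuous_measurable_fun.
split; first exact: measurable_fun_borel_lebesgue.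
move=> a b; apply/(integrable_leb_borel (@measurable_itv R `[a, b]) mf).
apply: continuous_compact_integrable; first exact: segment_compact.
exact: continuous_subspaceT.
Qed.

Lemma locint_cst c : locint (fun _ : R => c).
Proof. by apply: locint_continuous => x; exact: cvg_cst. Qed.

Lemma locintD f g : locint f -> locint g -> locint (f \+ g).
Proof.
move=> [mf fi] [mg gi]; split; first exact: measurable_funD.
by move=> a b; exact: (integrableD (itv_lebesgue `[a, b]) (fi a b) (gi a b)).
Qed.

Lemma locintZ c f : locint f -> locint (fun t => c * f t).
Proof.
move=> [mf fi]; split; first exact: measurable_funM.
by move=> a b; exact: (integrableZl (itv_lebesgue `[a, b]) c (fi a b)).
Qed.

Lemma locintB f g : locint f -> locint g -> locint (f \- g).
Proof.
move=> lf lg; have := locintD lf (locintZ (- 1) lg).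
by congr locint; apply/funext => t /=; rewrite mulN1r.
Qed.

Lemma locint_norm f : locint f -> locint (fun t => `|f t|).
Proof.
move=> [mf fi]; split; first exact: measurableT_comp.
by move=> a b; exact: integrable_norm.
Qed.

(** Completeness at work: inside [M] the preimage under [f] is an arbitrary subset of a null set,
    hence measurable. *)
Lemma ae_eq_lebesgue_measurable f g (M : set R) :
  @measurable _ (measurableTypeR R) M -> mu M = 0 ->
  (forall x, ~ M x -> f x = g x) ->
  lebesgue_measurable_fun g -> lebesgue_measurable_fun f.
Proof.
move=> mM M0 fg mg _ B mB; rewrite setTI.
have -> : f @^-1` B = ((g @^-1` B) `\` M) `|` (f @^-1` B `&` M).
  apply/seteqP; split=> x /=.
    have [Mx|nMx] := pselect (M x); first by right.
    by rewrite fg// => ?; left.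
  by case=> [[? ?]|[]//]; rewrite fg.
have mgB := mg measurableT _ mB; rewrite setTI in mgB.
apply: measurableU.
  by apply: measurableD => //; exact: borel_lebesgue.
apply: negligible_sub_caratheodory; exists M; split => //.
exact: borel_lebesgue.
Qed.

(** Translation is used as a Borel map, so both properties are read off from the translate of a
    Borel representative, whose exceptional set is a translated null set. *)
Lemma locint_shift c f : locint f -> locint (fun t => f (t + c)).
Proof.
move=> lf; have [g [mg ig [M [mM M0 fg]] _]] := locint_repr lf.
have mgc : measurable_fun [set: R] (fun t => g (t + c)).
  by apply: measurableT_comp mg _; exact: measurable_funD.
have mMc : @measurable _ (measurableTypeR R) ((fun x => x + c) @^-1` M).
  rewrite -[X in measurable X]setTI.
  exact: (@measurable_funD _ _ _ setT id (cst c)).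
have Mc0 : mu ((fun x => x + c) @^-1` M) = 0.
  by rewrite -lebesgue_measure_shift.
have fgc x : ~ ((fun x => x + c) @^-1` M) x -> f (x + c) = g (x + c).
  by move=> nM; apply: fg.
have mfc : lebesgue_measurable_fun (fun t => f (t + c)).
  apply: (ae_eq_lebesgue_measurable mMc Mc0 fgc).
  exact: measurable_fun_borel_lebesgue.
split => // a b.
have [igc _] := Rintegral_shift c a b mg ig.
have : lebR.-integrable `[a, b] (EFin \o (fun t => g (t + c))).
  exact/(integrable_leb_borel (@measurable_itv R `[a, b]) mgc).
move=> /integrableP[_ gfin]; apply/integrableP; split.
  exact/measurable_EFinP/measurable_funTS.
apply: le_lt_trans gfin; rewrite le_eqVlt; apply/orP; left; apply/eqP.
apply: ae_eq_integral; first exact: itv_lebesgue.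
- by apply/measurable_EFinP/measurableT_comp => //; exact/measurable_funTS.
- apply/measurable_EFinP/measurableT_comp => //; apply/measurable_funTS.
  exact: measurable_fun_borel_lebesgue.
- have := borel_null_ae mMc Mc0 fgc; case=> N [mN N0 NP]; exists N; split => //.
  by move=> x nP; apply: NP => /= E; apply: nP => _ /=; rewrite E.
Qed.

Lemma leb_Rintegral_shift c a b f : locint f ->
  \int[lebR]_(t in `[a, b]) f (t + c) = \int[lebR]_(t in `[a + c, b + c]) f t.
Proof.
move=> lf; have [g [mg ig [M [mM M0 fg]] fgE]] := locint_repr lf.
have [igc E] := Rintegral_shift c a b mg ig.
rewrite fgE -E.
have mgc : measurable_fun [set: R] (fun t => g (t + c)).
  by apply: measurableT_comp mg _; exact: measurable_funD.
rewrite -(Rintegral_leb_borel (@measurable_itv R `[a, b]) mgc igc).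
apply: ae_eq_Rintegral; [exact: itv_lebesgue|exact: (locint_shift c lf).1| |].
  exact: measurable_fun_borel_lebesgue.
have mMc : @measurable _ (measurableTypeR R) ((fun x => x + c) @^-1` M).
  rewrite -[X in measurable X]setTI.
  exact: (@measurable_funD _ _ _ setT id (cst c)).
apply: (borel_null_ae mMc); first by rewrite -lebesgue_measure_shift.
by move=> x nM; apply: fg.
Qed.

End LocInt.

Section OrientedIntegral.
Context {R : realType}.
Local Notation mu := (@lebesgue_measure R).
Local Notation lebR := (@leb R).
Implicit Types (f g : R -> R) (a b c x y : R).

(** The sign convention is put into a primitive based at 0, so that the relation of Chasles for
    [oint] is mere algebra, without order or integrability hypotheses. *)
Definition prim f x : R :=
  if 0 <= x then \int[lebR]_(t in `[0, x]) f t
  else - \int[lebR]_(t in `[x, 0]) f t.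

Definition oint f a b : R := prim f b - prim f a.

Let Rintegral_chasles f a c b : locint f -> a <= c -> c <= b ->
  \int[lebR]_(t in `[a, b]) f t =
  \int[lebR]_(t in `[a, c]) f t + \int[lebR]_(t in `[c, b]) f t.
Proof.
move=> /locint_repr[g [mg ig _ fgE]] ac cb; rewrite !fgE.
have := @Rintegral_itvB R g (BLeft a) (BRight b) c (ig a b).
rewrite !bnd_simp => /(_ ac cb) E.
rewrite -[X in _ + X]Rintegral_itv_obnd_cbnd; first by rewrite -E; ring.
apply: integrableS (ig a b) => //; exact: subset_itvr.
Qed.

Lemma ointE f a b : locint f -> a <= b ->
  \int[lebR]_(t in `[a, b]) f t = oint f a b.
Proof.
move=> lf ab; rewrite /oint /prim.
case: (leP 0 a) => a0; case: (leP 0 b) => b0.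
- by rewrite (Rintegral_chasles lf a0 ab); ring.
- by have := lt_le_trans b0 (le_trans a0 ab); rewrite ltxx.
- by rewrite (Rintegral_chasles lf (ltW a0) b0); ring.
- by rewrite (Rintegral_chasles lf ab (ltW b0)); ring.
Qed.

Lemma oint_chasles f a b c : oint f a b + oint f b c = oint f a c.
Proof. by rewrite /oint; ring. Qed.

Lemma ointNN f a b : oint f a b = - oint f b a.
Proof. by rewrite /oint; ring. Qed.

(** Reduces identities between oriented integrals to ordered endpoints; the symmetry premise is met
    by changing both signs. *)
Lemma oint_ind (P : R -> R -> Prop) : (forall a b, a <= b -> P a b) ->
  (forall a b, P a b -> P b a) -> forall a b, P a b.
Proof. by move=> H S a b; case: (leP a b) => [/H//|/ltW/H/S]. Qed.

Lemma ointD f g a b : locint f -> locint g ->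
  oint (f \+ g) a b = oint f a b + oint g a b.
Proof.
move=> lf lg; move: a b; apply: oint_ind => a b; last first.
  by rewrite ![oint _ b a]ointNN => ->; ring.
move=> ab; rewrite -!ointE//; last exact: locintD.
by apply: RintegralD; [exact: itv_lebesgue|exact: lf.2|exact: lg.2].
Qed.

Lemma ointZ f c a b : locint f -> oint (fun t => c * f t) a b = c * oint f a b.
Proof.
move=> lf; move: a b; apply: oint_ind => a b; last first.
  by rewrite ![oint _ b a]ointNN => ->; ring.
move=> ab; rewrite -!ointE//; last exact: locintZ.
by apply: RintegralZl; [exact: itv_lebesgue|exact: lf.2].
Qed.

Lemma ointB f g a b : locint f -> locint g ->
  oint (f \- g) a b = oint f a b - oint g a b.
Proof.
move=> lf lg; rewrite -mulN1r -ointZ// -ointD//; last exact: locintZ.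
by congr oint; apply/funext => t /=; rewrite mulN1r.
Qed.

Lemma oint_cst c a b : oint (fun=> c) a b = c * (b - a).
Proof.
move: a b; apply: oint_ind => a b; last first.
  by rewrite ![oint _ b a]ointNN => ->; ring.
move=> ab; rewrite -ointE//; last exact: locint_cst.
have cE : lebR `[a, b]%classic = (b - a)%:E.
  transitivity (mu `[a, b]%classic); first by [].
  rewrite lebesgue_measure_itv/= lte_fin; case: ltP => // ba.
  by rewrite (le_anti (introT andP (conj ab ba))) subrr.
rewrite Rintegral_cst; last exact: itv_lebesgue.
by rewrite -[b - a]/(fine (b - a)%:E) -cE.
Qed.

Lemma le_oint f g a b : locint f -> locint g -> a <= b ->
  (forall t, a <= t <= b -> f t <= g t) -> oint f a b <= oint g a b.
Proof.
move=> lf lg ab fg; rewrite -!ointE//; apply: le_Rintegral.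
- exact: itv_lebesgue.
- exact: lf.2.
- exact: lg.2.
- by move=> t /=; rewrite in_itv/=; exact: fg.
Qed.

Lemma oint_ge0 f a b : locint f -> a <= b ->
  (forall t, a <= t <= b -> 0 <= f t) -> 0 <= oint f a b.
Proof.
move=> lf ab f0; rewrite -[leLHS](_ : oint (fun=> 0) a b = 0).
  by apply: le_oint => //; exact: locint_cst.
by rewrite oint_cst mul0r.
Qed.

Lemma le_norm_oint f a b : locint f -> a <= b ->
  `|oint f a b| <= oint (fun t => `|f t|) a b.
Proof.
move=> lf ab; rewrite -!ointE//; last exact: locint_norm.
by apply: le_normr_Rintegral; [exact: itv_lebesgue|exact: lf.2].
Qed.

Lemma le_oint_itv f a b c d : locint f -> (forall t, 0 <= f t) ->
  c <= a -> a <= b -> b <= d -> oint f a b <= oint f c d.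
Proof.
move=> lf f0 ca ab bd.
have := oint_ge0 lf ca (fun t _ => f0 t); have := oint_ge0 lf bd (fun t _ => f0 t).
by rewrite /oint; lra.
Qed.

Lemma oint_shift c f a b : locint f ->
  oint (fun t => f (t + c)) a b = oint f (a + c) (b + c).
Proof.
move=> lf; move: a b; apply: oint_ind => a b; last first.
  by rewrite ![oint _ b a]ointNN ![oint _ (b + c) _]ointNN => ->.
move=> ab; rewrite -!ointE//; [|by rewrite lerD2r|exact: locint_shift].
exact: leb_Rintegral_shift.
Qed.

Lemma prim_continuous f : locint f -> continuous (prim f).
Proof.
move=> lf x; have [g [mg ig _ fgE]] := locint_repr lf.
have xx : x - 1 < x + 1 by lra.
have := @parameterized_integral_continuous R _ _ g (ltW xx) (ig _ _).
move=> /(continuous_within_itvP _ xx)[/(_ x) + _ _].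
rewrite in_itv/= => /(_ ltac:(lra)) cx.
rewrite (_ : prim f = (fun y => prim f (x - 1) + oint f (x - 1) y)); last first.
  by apply/funext => y; rewrite /oint; ring.
apply: cvgD; first exact: cvg_cst.
rewrite -ointE//; last by lra.
rewrite fgE; move: cx; rewrite /parameterized_integral.
apply: cvg_trans; apply: near_eq_cvg; near=> y.
rewrite -fgE ointE//.
by apply/ltW; near: y; apply: lt_nbhsr; lra.
Unshelve. all: by end_near. Qed.

Lemma locint_prim f : locint f -> locint (prim f).
Proof. by move=> lf; exact/locint_continuous/prim_continuous. Qed.

Lemma is_derive_prim f x : continuous f -> is_derive x 1 (prim f) (f x).
Proof.
move=> cf; have lf := locint_continuous cf.
have mf : measurable_fun [set: R] f by exact: continuous_measurable_fun.
have ig a b : mu.-integrable `[a, b] (EFin \o f).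
  apply: continuous_compact_integrable; first exact: segment_compact.
  exact: continuous_subspaceT.
have := @continuous_FTC1_closed R f (x - 1) x (x + 1).
move=> /(_ ltac:(lra) (ig _ _) ltac:(lra) (cf x)) [dF F'].
set F := (fun _ => _) in dF F'.
have nE : {near x, (fun y => F y + prim f (x - 1)) =1 prim f}.
  near=> y; rewrite /F -(Rintegral_leb_borel (@measurable_itv R `[x - 1, y]) mf (ig _ _)).
  rewrite ointE//; first by rewrite /oint; ring.
  by apply/ltW; near: y; apply: lt_nbhsr; lra.
have dF1 : is_derive x 1 (fun y => F y + prim f (x - 1)) (f x + 0).
  have dF0 : is_derive x 1 F (f x).
    exact: (DeriveDef dF (etrans (esym (derive1E F x)) F')).
  exact: (is_deriveD dF0 (is_derive_cst (prim f (x - 1)) x 1)).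
rewrite addr0 in dF1.
apply: DeriveDef; first by apply: near_eq_derivable nE _.
by rewrite -(near_eq_derive _ nE); exact: derive_val.
Unshelve. all: by end_near. Qed.

Lemma oint_derive f g : continuous g -> (forall x, is_derive x 1 f (g x)) ->
  forall a b, f b - f a = oint g a b.
Proof.
move=> cg fg a b; rewrite /oint.
suff : f b - prim g b = f a - prim g a by lra.
apply: (@is_derive_0_is_cst R (f \- prim g)) => x.
rewrite -[X in is_derive _ _ _ X](subrr (g x)).
by apply: is_deriveB; exact: is_derive_prim.
Qed.

End OrientedIntegral.

(** * Absolutely continuous functions *)

Section AbsContTV.
Context {R : realType}.
Implicit Types (f : R -> R) (a b u v : R) (p q : R * R) (L : seq (R * R)).

(* A pair (u, v) stands for the interval [u, v]. *)
Definition within a b p := [&& a <= p.1, p.1 < p.2 & p.2 <= b].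

Definition apart p q := (p.2 <= q.1) || (q.2 <= p.1).

Lemma apart_sym p q : apart p q = apart q p.
Proof. by rewrite /apart orbC. Qed.

(** Sequences replace indexed families so that an interval can be exchanged for the pieces of a
    partition by concatenation. *)
Lemma abs_continuous_seq a b f : abs_continuous a b f ->
  forall e, 0 < e -> exists2 d, 0 < d & forall L, all (within a b) L ->
    pairwise apart L -> \sum_(p <- L) (p.2 - p.1) < d ->
    \sum_(p <- L) `|f p.2 - f p.1| < e.
Proof.
move=> acf e /acf[d d0 H]; exists d => // L Lab Ldisj.
rewrite !(big_nth (0, 0)) !big_mkord; apply: H.
- move=> i; have /and3P[] := all_nthP (0, 0) Lab i (ltn_ord i); split => //.
- move=> i j ij.
  have D := pairwiseP (0, 0) Ldisj.
  have [ltij|ltji|/val_inj eij] := ltngtP i j; last by rewrite eij eqxx in ij.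
  + by have /orP := D i j (ltn_ord i) (ltn_ord j) ltij.
  + by have /orP[] := D j i (ltn_ord j) (ltn_ord i) ltji; [right|left].
Qed.

Let pieces u (s : seq R) := pairmap pair u s.

Lemma pieces_within u v s : itv_partition u v s -> all (within u v) (pieces u s).
Proof.
elim: s u => [//|x s IH] u [/= /andP[ux xs] lx].
have xv : itv_partition x v s by split.
have xlev : x <= v by exact: itv_partition_le xv.
rewrite /within /= lexx ux xlev /=.
apply: sub_all (IH _ xv) => p /and3P[xp pp pv].
by rewrite (le_trans (ltW ux) xp) pp.
Qed.

Lemma pieces_apart u v s : itv_partition u v s -> pairwise apart (pieces u s).
Proof.
elim: s u => [//|x s IH] u [/= /andP[ux xs] lx].
have xv : itv_partition x v s by split.
rewrite (IH _ xv) andbT.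
by apply: sub_all (pieces_within xv) => p /and3P[xp _ _]; rewrite /apart /= xp.
Qed.

Lemma sum_pieces u v s : itv_partition u v s ->
  \sum_(p <- pieces u s) (p.2 - p.1) = v - u.
Proof.
elim: s u => [u /itv_partition_nil ->|x s IH u [/= /andP[ux xs] lx]].
  by rewrite big_nil subrr.
have xv : itv_partition x v s by split.
by rewrite big_cons (IH _ xv) /=; ring.
Qed.

Lemma variation_pieces u v f s : itv_partition u v s ->
  variation u v f s = \sum_(p <- pieces u s) `|f p.2 - f p.1|.
Proof.
move=> us; rewrite variation_zip//.
elim: s u us => [u _|x s IH u [/= /andP[ux xs] lx]]; first by rewrite !big_nil.
have xv : itv_partition x v s by split.
by rewrite !big_cons (IH _ xv).
Qed.

(** Induction on the intervals whose variation is still to be bounded: [L'] collects those already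
    cut into pieces. Cutting changes neither the total length nor disjointness, so [H] applies at
    the end, and the supremum over partitions is taken one interval at a time. *)
Lemma total_variation_seq a b f e d :
  (forall L, all (within a b) L -> pairwise apart L ->
    \sum_(p <- L) (p.2 - p.1) < d -> \sum_(p <- L) `|f p.2 - f p.1| < e) ->
  forall L L', all (within a b) (L' ++ L) -> pairwise apart (L' ++ L) ->
    \sum_(p <- L' ++ L) (p.2 - p.1) < d ->
  ((\sum_(p <- L') `|f p.2 - f p.1|)%:E +
   \sum_(p <- L) total_variation p.1 p.2 f <= e%:E)%E.
Proof.
move=> H; elim=> [L'|[u v] L IH L'].
  rewrite cats0 => /H /[apply] /[apply] L'e.
  by rewrite big_nil adde0 lee_fin ltW.
move=> allL; have uvin : within a b (u, v).
  by move: allL; rewrite all_cat /= => /and3P[].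
rewrite pairwise_cat /= => /and3P[L'uvL pL' /andP[uvL pL]].
rewrite big_cat big_cons /= => sumd.
have uv : u < v by case/and3P: uvin.
have key s : itv_partition u v s ->
   ((\sum_(p <- L') `|f p.2 - f p.1|)%:E + (variation u v f s)%:E +
   \sum_(p <- L) total_variation p.1 p.2 f <= e%:E)%E.
  move=> us; rewrite (variation_pieces _ us) -EFinD -big_cat; apply: IH.
  - move: allL; rewrite !all_cat /= => /and3P[-> _ ->]; rewrite andbT /=.
    apply: sub_all (pieces_within us) => p /and3P[up pp pv].
    have /and3P[/= au _ vb] := uvin.
    by apply/and3P; split => //; [exact: le_trans up|exact: le_trans vb].
  - have apuv q : apart (u, v) q -> all (apart q) (pieces u s).
      move=> uvq; apply: sub_all (pieces_within us) => p /and3P[up pp pv].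
      case/orP: uvq => /= h; apply/orP; [right|left].
        exact: le_trans h.
      exact: le_trans up.
    rewrite -catA !pairwise_cat pL' pL (pieces_apart us) /= !andbT.
    move: L'uvL; rewrite allrel_consr allrel_catr => /andP[L'uv ->]; rewrite andbT.
    apply/andP; split.
      apply/allrelP => q p qL' pp; rewrite -/(apart _ _).
      apply: (allP (apuv q _)) pp.
      by rewrite apart_sym; exact: (allP L'uv).
    apply/allrelP => p q pp qL; rewrite -/(apart _ _) apart_sym.
    apply: (allP (apuv q _)) pp.
    exact: (allP uvL).
  - by rewrite !big_cat /= (sum_pieces us); move: sumd; lra.
have sL0 : (0 <= \sum_(p <- L) total_variation p.1 p.2 f)%E.
  rewrite big_seq sume_ge0// => p pinL; apply: total_variation_ge0.
  have /and3P[_ /ltW//] : within a b p.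
  by apply: (allP allL); rewrite mem_cat inE pinL !orbT.
move: sL0 key; rewrite big_cons /=.
set S := (\sum_(p <- L) total_variation _ _ _)%E.
(* An infinite remaining sum is excluded by [key] for the trivial partition. *)
case: S => [r||] // r0 key; last first.
  have := key _ (itv_partition1 uv).
  by rewrite leye_eq.
rewrite addeCA -leeBrDr//.
apply: ge_ereal_sup => _ [_ [s us <-] <-].
by rewrite leeBrDr// addeC addeA addeAC -addeA addeCA addeA; exact: key.
Qed.

End AbsContTV.

(** * Densities of monotone absolutely continuous functions *)

Section MonotoneDensity.
Context {R : realType}.
Local Notation mu := (@lebesgue_measure R).
Variables (N : R -> R) (B : R).
Hypothesis N_nd : {homo N : x y / x <= y}.
Hypothesis N_bnd : forall x y, N y - N x <= B.
Hypothesis N_ac : forall e : R, 0 < e -> exists2 d : R, 0 < d & forall L : seq (R * R),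
  all (fun p => p.1 < p.2) L -> pairwise apart L ->
  \sum_(p <- L) (p.2 - p.1) < d -> \sum_(p <- L) (N p.2 - N p.1) <= e.

Let N_continuous : continuous N.
Proof.
move=> x; apply/cvgrPdist_le => /= e e0; have [d d0 H] := N_ac e0.
near=> y.
have H1 u v : u < v -> v - u < d -> N v - N u <= e.
  move=> uv vud; have := H [:: (u, v)]; rewrite !big_seq1 /= uv => /(_ isT isT).
  exact.
have xyd : `|x - y| < d by near: y; apply: cvgr_dist_lt.
have [xy|yx|->] := ltgtP x y; last by rewrite subrr normr0 ltW.
- rewrite ler0_norm ?subr_le0 ?N_nd ?(ltW xy)// opprB H1//.
  by move: xyd; rewrite ltr0_norm ?subr_lt0// opprB.
- rewrite ger0_norm ?subr_ge0 ?N_nd ?(ltW yx)// H1//.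
  by move: xyd; rewrite gtr0_norm ?subr_gt0.
Unshelve. all: by end_near. Qed.

Let N_rc : right_continuous N.
Proof. exact: right_continuousW. Qed.

Let C : cumulative R R := HB.pack N (isCumulative.Build R _ R N N_nd N_rc).

Let nu := lebesgue_stieltjes_measure C.

Let nuE u v : u <= v -> nu `]u, v]%classic = (N v - N u)%:E.
Proof.
move=> uv; rewrite /nu /lebesgue_stieltjes_measure /measure_extension.
by rewrite measurable_mu_extE/=; [rewrite wlength_itv_bnd|exact: is_ocitv].
Qed.

(** The Stieltjes measure is given on half-open intervals. Moving the left end slightly outwards
    adds less than [e], as [N] is continuous: the left end carries no mass. *)
Let nu_cc u v : u <= v -> (nu `[u, v]%classic <= (N v - N u)%:E)%E.
Proof.
move=> uv; apply/lee_addgt0Pr => e e0.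
have /cvgrPdist_lt/(_ e e0)[d /= d0 H] := @N_continuous u.
have ud : u - d / 2 < u by rewrite gtrBl divr_gt0.
have Nud : N u - N (u - d / 2) < e.
  have := H (u - d / 2); rewrite /= opprB addrC subrK ger0_norm ?divr_ge0 ?ltW//.
  rewrite ltr_pdivrMr// ltr_pMr// ltr1n => /(_ isT).
  by rewrite ger0_norm// subr_ge0 N_nd// ltW.
apply: (@le_trans _ _ (nu `]u - d / 2, v]%classic)).
  apply: le_measure; rewrite ?inE; try exact: measurable_itv.
  by apply: subset_itvr; rewrite bnd_simp.
rewrite nuE; last by rewrite (le_trans (ltW ud)).
by rewrite -EFinD lee_fin; move: Nud; lra.
Qed.

Let nuT : (nu setT <= B%:E)%E.
Proof.
pose I n : set R := `]- (n%:R), n%:R]%classic.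
have : (nu \o I) n @[n --> \oo] --> nu (\bigcup_n I n).
  apply: nondecreasing_cvg_mu; rewrite /I//.
  - by apply: bigcup_measurable => n _; exact: (@measurable_itv R `]- (n%:R), n%:R]).
  - by move=> *; apply/subsetPset/subset_itv; rewrite leBSide/= ?lerN2 ler_nat.
rewrite (bigcup_itvT false false) => cv.
rewrite -(cvg_lim _ cv)//; apply: lime_le; first by apply/cvg_ex; eexists; exact: cv.
by apply: nearW => n /=; rewrite nuE ?lee_fin// (@le_trans _ _ 0) ?oppr_le0.
Qed.

Let nu_finite : fin_num_fun nu.
Proof.
move=> A mA; rewrite ge0_fin_numE ?measure_ge0//.
apply: (@le_lt_trans _ _ (nu setT)); first by apply: le_measure; rewrite ?inE.
by apply: le_lt_trans nuT _; rewrite ltry.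
Qed.

Let nuF : {finite_measure set (measurableTypeR R) -> \bar R} :=
  HB.pack (lebesgue_stieltjes_measure C)
    (Measure_isFinite.Build _ _ _ (lebesgue_stieltjes_measure C) nu_finite).

(** Finite measure excludes rays, so the endpoints of [i] serve as [p]; the pair [(0, 0)] is the
    choice for the empty interval. *)
Let finite_itv (i : interval R) : (mu [set` i] < +oo)%E ->
  exists p : R * R, [/\ p.1 <= p.2, `]p.1, p.2[ `<=` [set` i] &
    [set` i] `<=` `[p.1, p.2] ].
Proof.
have [i0 _|] := eqVneq [set` i] set0.
  exists (0, 0) => /=; rewrite i0; split => // x /=.
  by rewrite in_itv/= => /andP[]; lra.
move=> /neitv_lt_bnd; rewrite lebesgue_measure_itv/=.
case: i => [[b1 u|[]] [b2 v|[]]] //= uv; rewrite ?ltry ?ltNyr//= => _.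
have {}uv : u <= v by move: uv; rewrite /Order.lt/=; case: b1 b2 => [] [] //= /ltW.
exists (u, v) => /=; split => //.
  by apply: subset_itv; rewrite bnd_simp; case: b1 b2 => [] [].
by apply: subset_itv; rewrite bnd_simp; case: b1 b2 => [] [].
Qed.

(** An open set is a disjoint union of countably many intervals. For finitely many of them the
    premise bounds the increments of [N], which dominate the Stieltjes measure; countable additivity
    passes to the limit. *)
Let open_small e d (U : set R) : open U -> (mu U < d%:E)%E ->
  (forall L : seq (R * R), all (fun p => p.1 < p.2) L -> pairwise apart L ->
    \sum_(p <- L) (p.2 - p.1) < d -> \sum_(p <- L) (N p.2 - N p.1) <= e) ->
  (nu U <= e%:E)%E.
Proof.
move=> oU Ud H; pose I := open_disjoint_itv oU.
have mI i : @measurable _ (measurableTypeR R) (I i).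
  by apply: open_measurable; exact: open_disjoint_itv_open.
have UI : U = \bigcup_i I i by exact: open_disjoint_itv_bigcup.
have tI : trivIset setT I by exact: open_disjoint_itv_trivIset.
have /choice[p pP] : forall i, exists p : R * R,
    [/\ p.1 <= p.2, `]p.1, p.2[ `<=` I i & I i `<=` `[p.1, p.2] ].
  move=> i; have IE : [set` Rhull (I i)] = I i.
    by apply: RhullK; rewrite inE; exact: open_disjoint_itv_is_interval.
  rewrite -IE; apply: finite_itv; rewrite IE.
  apply: le_lt_trans (lt_trans Ud (ltry d)).
  apply: le_measure; rewrite ?inE//; first exact: open_measurable.
  by rewrite UI; exact: bigcup_sup.
have cv : (fun n => \sum_(0 <= i < n) nu (I i))%E @ \oo --> nu U.
  rewrite UI; apply: measure_semi_sigma_additive => //.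
  by rewrite -UI; exact: open_measurable.
apply: cvge_le cv; apply: nearW => n.
(* Degenerate components are dropped because the premise speaks of proper intervals only; they
   contribute 0 to both sums. *)
pose L := [seq p i | i <- iota 0 n & (p i).1 < (p i).2].
apply: (@le_trans _ _ (\sum_(0 <= i < n) (N (p i).2 - N (p i).1)%:E)%E).
  apply: lee_sum => i _; have [pi _ Ip] := pP i.
  by apply: le_trans (nu_cc pi); apply: le_measure; rewrite ?inE.
rewrite sumEFin lee_fin.
have sumL (F : R * R -> R) : (forall i, (p i).1 = (p i).2 -> F (p i) = 0) ->
    \sum_(q <- L) F q = \sum_(0 <= i < n) F (p i).
  move=> F0; rewrite big_map big_filter /index_iota subn0.
  rewrite [RHS](bigID (fun i => (p i).1 < (p i).2)) /=.
  rewrite [X in _ = _ + X]big1 ?addr0// => i; rewrite -leNgt => pi; apply: F0.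
  by apply/le_anti; rewrite pi andbT; have [] := pP i.
rewrite -(sumL (fun q => N q.2 - N q.1)); last by move=> i ->; rewrite subrr.
apply: H.
- by apply/allP => _ /mapP[i + ->]; rewrite mem_filter => /andP[].
- rewrite pairwise_map.
  apply: (@sub_in_pairwise _ (fun i => (p i).1 < (p i).2) (fun i j => i != j)).
  + move=> i j; rewrite /in_mem/= => pi pj ij; apply: contrapT => /negP.
    rewrite negb_or -!ltNge => /andP[ij2 ji2].
    have [_ Ii _] := pP i; have [_ Ij _] := pP j.
    have /trivIsetP/(_ i j Logic.I Logic.I ij) := tI.
    rewrite -subset0.
    (* If two components were not apart, the midpoint of their overlap would lie in both. *)
    pose l := Num.max (p i).1 (p j).1; pose u := Num.min (p i).2 (p j).2.
    have lu : l < u by rewrite gt_max !lt_min pi pj ij2 ji2.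
    move=> /(_ ((l + u) / 2)); apply; split.
      apply: Ii; rewrite /= in_itv/=; apply/andP; split.
        by apply: le_lt_trans (midf_lt lu).1; rewrite le_max lexx.
      by apply: lt_le_trans (midf_lt lu).2 _; rewrite ge_min lexx.
    apply: Ij; rewrite /= in_itv/=; apply/andP; split.
      by apply: le_lt_trans (midf_lt lu).1; rewrite le_max lexx orbT.
    by apply: lt_le_trans (midf_lt lu).2 _; rewrite ge_min lexx orbT.
  + exact: filter_all.
  + by rewrite -uniq_pairwise filter_uniq// iota_uniq.
- rewrite sumL; last by move=> i ->; rewrite subrr.
  rewrite -lte_fin; apply: le_lt_trans Ud.
  apply: (@le_trans _ _ (mu (\big[setU/set0]_(i < n) I i))).
    rewrite measure_bigsetU// -sumEFin big_mkord; apply: lee_sum => i _.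
    have [pi pI _] := pP i.
    apply: (@le_trans _ _ (mu `](p i).1, (p i).2[%classic)).
      rewrite lebesgue_measure_itv/= lte_fin; case: ltP => // ip.
      by rewrite lee_fin subr_le0.
    by apply: le_measure; rewrite ?inE.
  apply: le_measure; rewrite ?inE//; [exact: bigsetU_measurable|exact: open_measurable|].
  by rewrite UI -bigcup_mkord; move=> t [i _ Iit]; exists i.
Qed.

(** By outer regularity a null set lies in an open set of measure below [d], whose [nu] measure is
    at most [e] by [open_small]. *)
Let nu_mu : nuF `<< mu.
Proof.
apply/null_content_dominatesP => A mA A0.
apply/eqP; rewrite eq_le measure_ge0 andbT; apply/lee_addgt0Pr => e e0.
rewrite add0e; have [d d0 H] := N_ac e0.
have [U [oU AU Ue]] := outer_measure_open_le A (divr_gt0 d0 (ltr0Sn R 1)).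
apply: (@le_trans _ _ (nu U)).
  by apply: le_measure; rewrite ?inE//; exact: open_measurable.
have {}Ue : (mu U <= (d / 2)%:E)%E by rewrite -[leRHS]add0e -A0.
apply: open_small oU _ H; apply: le_lt_trans Ue _.
by rewrite lte_fin ltr_pdivrMr// ltr_pMr// ltr1n.
Qed.

(* The density is the Radon-Nikodym derivative of the Stieltjes measure of N. *)
Lemma monotone_density : exists rho : R -> R,
  [/\ measurable_fun [set: R] rho, mu.-integrable setT (EFin \o rho) &
   forall x y, x <= y -> N y - N x = \int[mu]_(t in `[x, y]) rho t].
Proof.
have [f [f0 ffin fi fE]] := radon_nikodym_sigma_finite nu_mu.
have fK : EFin \o (fine \o f) = f by apply/funext => x /=; rewrite fineK.
exists (fine \o f); split.
- by apply: measurableT_comp => //; exact: measurable_int fi.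
- by rewrite fK.
- move=> x y xy; rewrite -Rintegral_itv_obnd_cbnd; last first.
    by rewrite fK; exact: integrableS fi.
  have := fE `]x, y]%classic (@measurable_itv R _).
  rewrite [LHS]nuE// => E.
  rewrite -[LHS]/(fine (N y - N x)%:E) E /Rintegral; congr fine.
  by apply: eq_integral => t _ /=; rewrite fineK.
Qed.

End MonotoneDensity.

Section AbsContDensity.
Context {R : realType}.
Local Notation mu := (@lebesgue_measure R).
Local Notation TV := total_variation.
Variables (G : R -> R) (a b : R).
Hypotheses (ab : a < b) (acG : abs_continuous a b G).

Let TV_seq e : 0 < e -> exists2 d : R, 0 < d & forall L, all (within a b) L ->
  pairwise apart L -> \sum_(p <- L) (p.2 - p.1) < d ->
  (\sum_(p <- L) TV p.1 p.2 G <= e%:E)%E.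
Proof.
move=> /(abs_continuous_seq acG)[d d0 H]; exists d => // L *.
by have := @total_variation_seq R a b G e d H L [::]; rewrite big_nil add0e; apply.
Qed.

(** Intervals shorter than [d] have variation at most 1, and finitely many steps of length [d / 2]
    exhaust [[a, b]]. *)
Let TV_ab_lty : (TV a b G < +oo)%E.
Proof.
have [d d0 H] := TV_seq ltr01.
have short u v : a <= u -> u < v -> v <= b -> v - u < d -> (TV u v G < +oo)%E.
  move=> au uv vb vud; have := H [:: (u, v)].
  rewrite !big_seq1 /= /within /= au uv vb => /(_ isT isT vud)/le_lt_trans; apply.
  exact: ltry.
suff K (k : nat) u v : a <= u -> u <= v -> v <= b -> v - u < k%:R * (d / 2) ->
    (TV u v G < +oo)%E.
  have d20 : 0 < d / 2 by rewrite divr_gt0.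
  apply: (K (Num.bound ((b - a) / (d / 2)))); rewrite ?lexx ?ltW//.
  rewrite -ltr_pdivrMr//; apply: archi_boundP.
  by rewrite divr_ge0 ?ltW// subr_gt0.
elim: k u v => [|k IH] u v au uv vb.
  by rewrite mul0r subr_lt0 ltNge uv.
rewrite -natr1 mulrDl mul1r => vud.
have [ud|ud] := leP v (u + d / 2).
  move: uv; rewrite le_eqVlt => /predU1P[->|uv].
    by rewrite total_variationxx ltry.
  by apply: short => //; lra.
have uc : u < u + d / 2 by rewrite ltrDl divr_gt0.
rewrite (@total_variationD _ _ _ (u + d / 2)) ?ltW//; apply: lte_add_pinfty.
  by apply: short => //; lra.
by apply: IH => //; lra.
Qed.

(** [monotone_density] is about the whole line; composition with this projection onto [[a, b]]
    extends functions by constants. Being monotone and 1-Lipschitz, it preserves disjointness and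
    does not increase lengths. *)
Let cl x := Num.max a (Num.min x b).

Let cl_nd x y : x <= y -> cl x <= cl y.
Proof.
move=> xy; rewrite /cl ge_max !le_max lexx /=; apply/orP.
by case: (leP y b) => yb; case: (leP x b) => xb; lra.
Qed.

Let cl_ge x : a <= cl x. Proof. by rewrite le_max lexx. Qed.

Let cl_le x : cl x <= b.
Proof. by rewrite ge_max ltW//= ge_min lexx orbT. Qed.

Let cl_lip x y : x <= y -> cl y - cl x <= y - x.
Proof.
move=> xy; have mab : Num.max a b = b by apply/max_idPr/ltW.
rewrite /cl; case: (leP x b) => xb; case: (leP y b) => yb; rewrite ?mab;
  by case: (leP a x) => ax; case: (leP a y) => ay; lra.
Qed.

Let cl_id x : a <= x -> x <= b -> cl x = x.
Proof. by move=> ax xb; rewrite /cl (min_idPl xb); apply/max_idPr. Qed.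

Let TV_fin u v : a <= u -> u <= v -> v <= b -> TV u v G \is a fin_num.
Proof.
move=> au uv vb; rewrite ge0_fin_numE ?total_variation_ge0//.
apply: le_lt_trans TV_ab_lty.
rewrite (@total_variationD _ a b u)// ?(le_trans uv)//.
rewrite (@total_variationD _ u b v)// addeCA leeDl// adde_ge0//.
  by rewrite total_variation_ge0.
by rewrite total_variation_ge0.
Qed.

Let T x := fine (TV a (cl x) G).

Let TE u v : u <= v -> T v - T u = fine (TV (cl u) (cl v) G).
Proof.
move=> uv; rewrite /T (@total_variationD _ a (cl v) (cl u)) ?cl_nd//.
by rewrite fineD ?TV_fin ?cl_nd//; ring.
Qed.

Let T_G u v : u <= v -> `|G (cl v) - G (cl u)| <= T v - T u.
Proof.
move=> uv; rewrite TE// -lee_fin fineK ?TV_fin ?cl_nd//.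
by apply: total_variation_ge; exact: cl_nd.
Qed.

Let T_ac e : 0 < e -> exists2 d : R, 0 < d & forall L : seq (R * R),
  all (fun p => p.1 < p.2) L -> pairwise apart L ->
  \sum_(p <- L) (p.2 - p.1) < d -> \sum_(p <- L) (T p.2 - T p.1) <= e.
Proof.
move=> /TV_seq[d d0 H]; exists d => // L pL aL sL.
pose c p := (cl p.1, cl p.2).
pose L' := [seq c p | p <- L & cl p.1 < cl p.2].
have := H L'; rewrite /L' all_map !big_map !big_filter => H'.
have {}H' : (\sum_(p <- L | (cl p.1 < cl p.2)%R) TV (cl p.1) (cl p.2) G <= e%:E)%E.
  apply: H'.
  - apply/allP => p; rewrite mem_filter => /andP[pp _].
    by rewrite /within /= cl_ge pp cl_le.
  - rewrite pairwise_map; apply: pairwise_filter; apply: sub_pairwise aL.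
    by move=> p q /orP[] h; apply/orP; [left|right]; exact: cl_nd.
  - apply: le_lt_trans sL; rewrite big_mkcond /= big_seq [leRHS]big_seq.
    apply: ler_sum => p pin; have /ltW pp := allP pL p pin.
    by case: ifP => _; [exact: cl_lip|rewrite subr_ge0].
rewrite -lee_fin; apply: le_trans H'.
rewrite -sumEFin [leRHS]big_mkcond /= big_seq [leRHS]big_seq.
apply: lee_sum => p pin; have /ltW pp := allP pL p pin.
rewrite TE// fineK ?TV_fin ?cl_nd//; case: ifPn => //; rewrite -leNgt => cp.
have /eqP -> : cl p.1 == cl p.2 by rewrite eq_le cp cl_nd.
by rewrite total_variationxx.
Qed.

(* With T the total variation, T and T - G are monotone and inherit the absolute
   continuity of G. *)
Lemma abs_continuous_density : exists rho : R -> R,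
  [/\ measurable_fun [set: R] rho, mu.-integrable setT (EFin \o rho) &
   forall x y, a <= x -> x <= y -> y <= b ->
     G y - G x = \int[mu]_(t in `[x, y]) rho t].
Proof.
have T_nd : {homo T : x y / x <= y}.
  by move=> x y xy; rewrite -subr_ge0; apply: le_trans (T_G xy).
pose S x := T x - G (cl x).
have S_nd : {homo S : x y / x <= y}.
  move=> x y xy; have := T_G xy; rewrite /S => /(le_trans (ler_norm _)); lra.
have T_ge0 x : 0 <= T x by rewrite fine_ge0// total_variation_ge0.
have T_b x : T x <= T b.
  have cb : cl b = b by apply: cl_id => //; exact: ltW.
  have cM : cl (Num.max x b) = b.
    by apply/le_anti; rewrite cl_le -[X in X <= _]cb cl_nd// le_max lexx orbT.
  have /T_nd : x <= Num.max x b by rewrite le_max lexx.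
  by rewrite [X in _ <= X -> _]/T cM -[X in TV a X]cb.
have [rho1 [m1 i1 E1]] := @monotone_density R T (T b) T_nd
  (fun x y => ltac:(have := T_ge0 x; have := T_b y; lra)) T_ac.
have S_bnd x y : S y - S x <= 2 * T b.
  have [yx|xy] := leP y x.
    by have := S_nd _ _ yx; have := T_ge0 b; lra.
  have := T_G (ltW xy); have := T_ge0 x; have := T_b y.
  rewrite /S -normrN => ? ? /(le_trans (ler_norm _)); lra.
have S_ac e : 0 < e -> exists2 d : R, 0 < d & forall L : seq (R * R),
    all (fun p => p.1 < p.2) L -> pairwise apart L ->
    \sum_(p <- L) (p.2 - p.1) < d -> \sum_(p <- L) (S p.2 - S p.1) <= e.
  move=> e0; have [d d0 H] := T_ac (divr_gt0 e0 (ltr0Sn R 1)).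
  exists d => // L pL aL sL.
  apply: (@le_trans _ _ (2 * (\sum_(p <- L) (T p.2 - T p.1)))); last first.
    by have := H L pL aL sL; lra.
  rewrite mulr_sumr big_seq [leRHS]big_seq; apply: ler_sum => p pin.
  have /ltW/T_G := allP pL p pin.
  by rewrite /S -normrN => /(le_trans (ler_norm _)); lra.
have [rho2 [m2 i2 E2]] := @monotone_density R S (2 * T b) S_nd S_bnd S_ac.
exists (rho1 \- rho2); split.
- exact: measurable_funB.
- by have := integrableB measurableT i1 i2; apply: eq_integrable.
- move=> x y ax xy yb; rewrite RintegralB//.
  + rewrite -E1// -E2// /S !cl_id ?(le_trans ax)// ?(le_trans xy)//; ring.
  + exact: integrableS i1.
  + exact: integrableS i2.
Qed.

End AbsContDensity.

(** * The fundamental theorem of calculus on the circle *)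

Section FTC.
Context {R : realType}.
Local Notation mu := (@lebesgue_measure R).
Local Notation lebR := (@leb R).
Implicit Types (f g G : R -> R) (x y : R).

(** Near an interior point [G] differs by a constant from the indefinite integral of its density
    [rho], whose derivative is [rho] almost everywhere by Lebesgue differentiation. The default
    values of the derivative on the exceptional set do not affect the integral. *)
Lemma abs_continuous_FTC G a b : a < b -> abs_continuous a b G ->
  locint (G^`())%classic -> forall x y, a <= x -> x <= y -> y <= b ->
  G y - G x = oint (G^`())%classic x y.
Proof.
move=> ab acG lG x y ax xy yb.
have [rho [mrho irho rhoE]] := abs_continuous_density ab acG.
have irho_itv (i : interval R) : mu.-integrable [set` i] (EFin \o rho).
  exact: integrableS irho.
have lrho : locint rho.
  split; first exact: measurable_fun_borel_lebesgue.
  by move=> u v; exact/(integrable_leb_borel (@measurable_itv R `[u, v]) mrho).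
have lirho : locally_integrable [set: R] rho.
  have := integrable_locally measurableT irho.
  by rewrite patch_setT.
have := FTC1Ny (fun z => irho_itv `]-oo, z]) lirho.
set F := (fun z => _); move=> [M [mM M0 MP]].
have dE z : a < z -> z < b -> ~ M z -> (G^`())%classic z = rho z.
  move=> az zb nMz.
  have [dF <-] : derivable F z 1 /\ (F^`())%classic z = rho z.
    by apply: contrapT => nz; apply: nMz; exact: MP.
  have nE : {near z, (fun t => F t + (G a - F a)) =1 G}.
    near=> t.
    have at_ : a <= t by apply/ltW; near: t; exact: lt_nbhsr.
    have tb : t <= b by apply/ltW; near: t; exact: lt_nbhsl.
    have := rhoE a t (lexx a) at_ tb.
    rewrite -Rintegral_itv_obnd_cbnd// -(@Rintegral_itvB _ _ -oo%O (BRight t))//.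
    by rewrite -/(F t) -/(F a); lra.
  have dF1 : is_derive z 1 (fun t => F t + (G a - F a)) ((F^`())%classic z + 0).
    have dF0 : is_derive z 1 F ((F^`())%classic z).
      exact: (DeriveDef dF (esym (derive1E F z))).
    exact: (is_deriveD dF0 (is_derive_cst (G a - F a) z 1)).
  by rewrite !derive1E -(near_eq_derive _ nE) derive_val addr0 derive1E.
rewrite rhoE// -(Rintegral_leb_borel (@measurable_itv R `[x, y]) mrho (irho_itv _)).
rewrite -(ointE lG xy) /Rintegral; congr fine; apply: ae_eq_integral.
- exact: itv_lebesgue.
- apply/measurable_EFinP/measurable_funTS; exact: measurable_fun_borel_lebesgue.
- by apply/measurable_EFinP/measurable_funTS; exact: lG.1.
(* The endpoints join the exceptional set, since [dE] uses a two-sided neighbourhood inside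
   [[a, b]]. *)
- have mM2 : @measurable _ (measurableTypeR R) (M `|` [set a] `|` [set b]).
    by apply: measurableU => //; apply: measurableU.
  exists (M `|` [set a] `|` [set b]); split.
  + exact: borel_lebesgue.
  + apply/eqP; rewrite eq_le measure_ge0 andbT.
    have : (mu (M `|` [set a] `|` [set b]) <= mu M + mu [set a] + mu [set b])%E.
      apply: (le_trans (measureU2 _ _ _)) => //; first exact: measurableU.
      by rewrite leeD2r// measureU2.
    by rewrite M0 !lebesgue_measure_set1 !adde0.
  + move=> z nz; apply: contrapT => nM; apply: nz => /=; rewrite in_itv/= => /andP[xz zy].
    congr (_%:E); rewrite dE//.
    * rewrite lt_neqAle (le_trans ax xz) andbT; apply/eqP => az.
      by apply: nM; left; right.
    * rewrite lt_neqAle (le_trans zy yb) andbT; apply/eqP => zb.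
      by apply: nM; right.
    * by move=> Mz; apply: nM; left; left.
Unshelve. all: by end_near. Qed.

Lemma periodicz (U V : zmodType) (f : U -> V) (T : U) : periodic f T ->
  forall (j : int) u, f (u + T *~ j) = f u.
Proof.
move=> fT [n|n] u; first by rewrite -pmulrn periodicn.
by rewrite NegzE -nmulrn -(periodicn fT n.+1) subrK.
Qed.

Lemma circle_rep x : exists j : int, (- pi : R) <= x + (pi *+ 2) *~ j < pi.
Proof.
have pi2 : (0 : R) < pi *+ 2 by rewrite mulrn_wgt0 ?pi_gt0.
exists (- Num.floor ((x + pi) / (pi *+ 2))).
have /andP[] := floor_itv ((x + pi) / (pi *+ 2)).
rewrite ler_pdivlMr// ltr_pdivrMr//; set k := Num.floor _.
rewrite intrD mulr1z mulrNz -mulrzr mulr2n; set K := k%:~R => h1 h2.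
by apply/andP; split; lra.
Qed.

Lemma oint_period f : on_circle f -> locint f -> forall x,
  oint f x (x + pi *+ 2) = oint f (- pi) pi.
Proof.
move=> cf lf x.
have := oint_shift (pi *+ 2) (- pi) x lf.
have -> : (fun t => f (t + pi *+ 2)) = f by apply/funext => t; exact: cf.
rewrite (_ : - pi + pi *+ 2 = pi); last by rewrite mulr2n; ring.
by rewrite /oint; lra.
Qed.

(** Only one period is covered by [abs_continuous_FTC]. By periodicity of [G] the derivative has
    integral 0 over a period, so [G] minus a primitive of it is periodic; it is constant on one
    period, hence everywhere. *)
Lemma circle_FTC G : on_circle G -> abs_continuous (- pi) pi G ->
  on_circle (G^`())%classic -> locint (G^`())%classic ->
  forall x y, G y - G x = oint (G^`())%classic x y.
Proof.
move=> cG acG cG' lG'; have pi0 := @pi_gt0 R.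
have pipi : (- pi : R) < pi by lra.
have F := abs_continuous_FTC pipi acG lG'.
pose D x := G x - prim (G^`())%classic x.
have cD : periodic D (pi *+ 2).
  move=> x; rewrite /D cG.
  have := oint_period cG' lG' x; rewrite -(F (- pi) pi)// ?ltW//.
  rewrite -(cG (- pi)) (_ : - pi + pi *+ 2 = pi) ?subrr; last by rewrite mulr2n; ring.
  by rewrite /oint; lra.
have Dpi x : D x = D (- pi).
  have [j /andP[jx xj]] := circle_rep x; rewrite -(periodicz cD j x).
  by have := F (- pi) _ (lexx _) jx (ltW xj); rewrite /D /oint; lra.
by move=> x y; have := Dpi x; have := Dpi y; rewrite /D /oint; lra.
Qed.

End FTC.

(** * One-sided averages *)

#[local] Opaque prim.

Section Operators.
Context {R : realType}.
Variable h : R.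
Hypothesis h0 : 0 < h.
Implicit Types (f g phi psi : R -> R) (x y c K : R).

Lemma steklovE f x : locint f ->
  steklov h f x = h^-1 * oint f (x - h / 2) (x + h / 2).
Proof. by move=> lf; rewrite /steklov ointE//; have := h0; lra. Qed.

Lemma steklov_dotE f x : locint f ->
  steklov_dot h f x = h^-1 * oint f x (x + h).
Proof.
by move=> lf; rewrite /steklov_dot steklovE// addrK -addrA -splitr.
Qed.

Lemma prim_shift_continuous f c : locint f -> continuous (fun x => prim f (x + c)).
Proof.
move=> lf x; apply: (@continuous_comp _ _ _ (fun x => x + c) (prim f)); last exact: prim_continuous.
by apply: cvgD; [exact: cvg_id|exact: cvg_cst].
Qed.

Lemma steklov_continuous f : locint f -> continuous (steklov h f).
Proof.
move=> lf; rewrite (_ : steklov h f =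
  (fun x => h^-1 * (prim f (x + h / 2) - prim f (x + - (h / 2))))).
  move=> x; apply: cvgM; first exact: cvg_cst.
  by apply: cvgB; exact: prim_shift_continuous.
by apply/funext => x; rewrite steklovE.
Qed.

Lemma steklov_dot_continuous f : locint f -> continuous (steklov_dot h f).
Proof.
move=> lf x; apply: (@continuous_comp _ _ _ (fun x => x + h / 2) (steklov h f)).
  by apply: cvgD; [exact: cvg_id|exact: cvg_cst].
exact: steklov_continuous.
Qed.

Lemma locint_steklov f : locint f -> locint (steklov h f).
Proof. by move=> lf; exact/locint_continuous/steklov_continuous. Qed.

Lemma locint_steklov_dot f : locint f -> locint (steklov_dot h f).
Proof. by move=> lf; exact/locint_continuous/steklov_dot_continuous. Qed.

Lemma steklovB f g : locint f -> locint g ->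
  steklov h (f \- g) = steklov h f \- steklov h g.
Proof.
move=> lf lg; apply/funext => x /=; rewrite !steklovE//; last exact: locintB.
by rewrite ointB// mulrBr.
Qed.

Lemma steklovD f g : locint f -> locint g ->
  steklov h (f \+ g) = steklov h f \+ steklov h g.
Proof.
move=> lf lg; apply/funext => x /=; rewrite !steklovE//; last exact: locintD.
by rewrite ointD// mulrDr.
Qed.

Lemma steklov_shift f c : locint f ->
  steklov h (fun t => f (t + c)) = (fun x => steklov h f (x + c)).
Proof.
move=> lf; apply/funext => x; rewrite !steklovE//; last exact: locint_shift.
by rewrite oint_shift//; congr (_ * oint _ _ _); ring.
Qed.

Lemma steklov_dotB f g : locint f -> locint g ->
  steklov_dot h (f \- g) = steklov_dot h f \- steklov_dot h g.
Proof. by move=> lf lg; apply/funext => x; rewrite /steklov_dot steklovB. Qed.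

Lemma on_circle_shift f c : on_circle f -> on_circle (fun x => f (x + c)).
Proof. by move=> cf x; rewrite -[RHS]cf; congr f; ring. Qed.

Lemma on_circle_steklov f : locint f -> on_circle f -> on_circle (steklov h f).
Proof.
move=> lf cf x; have := steklov_shift (pi *+ 2) lf.
rewrite (_ : (fun t => f (t + pi *+ 2)) = f).
  by move=> /(congr1 (@^~ x))/= ->.
by apply/funext => t; exact: cf.
Qed.

(* The average of f over [x, x + h] with weight 2 (1 - t / h) / h. *)
Definition wavg f x : R :=
  2 / h ^+ 2 * oint (fun t => prim f t - prim f x) x (x + h).

(* The average of f over [x, x + h] with weight 2 t / h^2; thus
   steklov_dot h is the mean of wavg and wavg'. *)
Definition wavg' f x : R :=
  2 / h ^+ 2 * oint (fun t => prim f (x + h) - prim f t) x (x + h).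

Lemma wavgE f x : locint f ->
  wavg f x = 2 / h ^+ 2 * (oint (prim f) x (x + h) - h * prim f x).
Proof.
move=> lf; rewrite /wavg (@ointB _ (prim f) (fun=> prim f x)).
- by rewrite oint_cst; congr (_ * (_ - _)); ring.
- exact: locint_prim.
- exact: locint_cst.
Qed.

Lemma wavg'E f x : locint f ->
  wavg' f x = 2 * steklov_dot h f x - wavg f x.
Proof.
move=> lf; rewrite wavgE// steklov_dotE// /wavg'.
rewrite (@ointB _ (fun=> prim f (x + h)) (prim f)).
- by rewrite oint_cst /oint; field; rewrite gt_eqF.
- exact: locint_cst.
- exact: locint_prim.
Qed.

Lemma wavg_continuous f : locint f -> continuous (wavg f).
Proof.
move=> lf; rewrite (_ : wavg f = (fun x => 2 / h ^+ 2 *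
  (prim (prim f) (x + h) - prim (prim f) x - h * prim f x))).
  have lF := locint_prim lf.
  move=> x; apply: cvgM; first exact: cvg_cst.
  apply: cvgB; last first.
    by apply: cvgM; [exact: cvg_cst|exact: prim_continuous].
  by apply: cvgB; [exact: prim_shift_continuous|exact: prim_continuous].
by apply/funext => x; rewrite wavgE.
Qed.

Lemma wavg'_continuous f : locint f -> continuous (wavg' f).
Proof.
move=> lf; rewrite (_ : wavg' f = (fun x => 2 * steklov_dot h f x - wavg f x)).
  move=> x; apply: cvgB; last exact: wavg_continuous.
  by apply: cvgM; [exact: cvg_cst|exact: steklov_dot_continuous].
by apply/funext => x; rewrite wavg'E.
Qed.

Lemma locint_wavg f : locint f -> locint (wavg f).
Proof. by move=> lf; exact/locint_continuous/wavg_continuous. Qed.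

Lemma locint_wavg' f : locint f -> locint (wavg' f).
Proof. by move=> lf; exact/locint_continuous/wavg'_continuous. Qed.

Lemma wavgB f g : locint f -> locint g -> wavg (f \- g) = wavg f \- wavg g.
Proof.
move=> lf lg; apply/funext => x /=.
rewrite /wavg -mulrBr; congr (_ * _); rewrite -ointB.
- by congr oint; apply/funext => t /=; have := ointB x t lf lg; rewrite /oint; lra.
- by apply: (@locintB _ (prim f) (fun=> _)); [exact: locint_prim|exact: locint_cst].
- by apply: (@locintB _ (prim g) (fun=> _)); [exact: locint_prim|exact: locint_cst].
Qed.

Lemma wavg'B f g : locint f -> locint g -> wavg' (f \- g) = wavg' f \- wavg' g.
Proof.
move=> lf lg; apply/funext => x.
rewrite [LHS](wavg'E x (locintB lf lg)) (steklov_dotB lf lg) (wavgB lf lg).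
rewrite [RHS]/= (wavg'E x lf) (wavg'E x lg) /=.
move: (steklov_dot h f x) (steklov_dot h g x) (wavg f x) (wavg g x) => a b c d.
by ring.
Qed.

Lemma oint_linear c x y : oint (fun t => c * (t - x)) x y = c * (y - x) ^+ 2 / 2.
Proof.
have D (z : R) : is_derive z 1 (fun t => c * ((t - x) ^+ 2 / 2)) (c * (z - x)).
  by apply: is_derive_eq; rewrite /GRing.scale/=; field.
rewrite -(oint_derive _ D) ?subrr; first by rewrite expr0n /= mul0r mulr0 subr0 mulrA.
move=> z; apply: cvgM; first exact: cvg_cst.
by apply: cvgB; [exact: cvg_id|exact: cvg_cst].
Qed.

Lemma wavg_cst c : wavg (fun=> c) = (fun=> c).
Proof.
apply/funext => x; rewrite /wavg.
have -> : (fun t => prim (fun=> c) t - prim (fun=> c) x) = (fun t => c * (t - x)).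
  by apply/funext => t; exact: (@oint_cst _ c x t).
by rewrite oint_linear addrC addKr; field; rewrite gt_eqF.
Qed.

Lemma steklov_dot_cst c : steklov_dot h (fun=> c) = (fun=> c).
Proof.
apply/funext => x; rewrite steklov_dotE; last exact: locint_cst.
by rewrite oint_cst; field; rewrite gt_eqF.
Qed.

Lemma wavg'_cst c : wavg' (fun=> c) = (fun=> c).
Proof.
apply/funext => x; rewrite wavg'E; last exact: locint_cst.
by rewrite wavg_cst steklov_dot_cst; ring.
Qed.

(** These three properties, shared by the averages over [[x, x + h]], yield monotonicity, the
    triangle inequality and closeness to a constant. Positivity looks only at values on
    [[x, x + h]], which keeps the later estimates local. *)
Definition forward_mean (op : (R -> R) -> R -> R) :=
  [/\ forall f g, locint f -> locint g -> op (f \- g) = op f \- op g,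
      forall c, op (fun=> c) = (fun=> c) &
      forall f x, locint f -> (forall t, x <= t <= x + h -> 0 <= f t) ->
        0 <= op f x].

Lemma forward_mean_steklov_dot : forward_mean (steklov_dot h).
Proof.
split; [exact: steklov_dotB|exact: steklov_dot_cst|move=> f x lf fx].
rewrite steklov_dotE// mulr_ge0 ?invr_ge0 ?(ltW h0)//.
by apply: oint_ge0 => //; rewrite lerDl ltW.
Qed.

Lemma forward_mean_wavg : forward_mean wavg.
Proof.
split; [exact: wavgB|exact: wavg_cst|move=> f x lf fx].
rewrite /wavg mulr_ge0 ?divr_ge0 ?exprn_ge0 ?(ltW h0)//.
apply: oint_ge0; [|by rewrite lerDl ltW|].
  by apply: (@locintB _ (prim f) (fun=> _)); [exact: locint_prim|exact: locint_cst].
move=> t /andP[xt th]; apply: (oint_ge0 lf xt) => u /andP[xu ut].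
by apply: fx; rewrite xu (le_trans ut).
Qed.

Lemma forward_mean_wavg' : forward_mean wavg'.
Proof.
split; [exact: wavg'B|exact: wavg'_cst|move=> f x lf fx].
rewrite /wavg' mulr_ge0 ?divr_ge0 ?exprn_ge0 ?(ltW h0)//.
apply: oint_ge0; [|by rewrite lerDl ltW|].
  by apply: (@locintB _ (fun=> _) (prim f)); [exact: locint_cst|exact: locint_prim].
move=> t /andP[xt th]; apply: (oint_ge0 lf th) => u /andP[tu uh].
by apply: fx; rewrite uh (le_trans xt).
Qed.

Section Mean.
Variable op : (R -> R) -> R -> R.
Hypothesis mop : forward_mean op.

Lemma le_mean f g x : locint f -> locint g ->
  (forall t, x <= t <= x + h -> f t <= g t) -> op f x <= op g x.
Proof.
move=> lf lg fg; have [opB _ op0] := mop.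
rewrite -subr_ge0; have /(congr1 (@^~ x))/= <- := opB _ _ lg lf.
by apply: op0; [exact: locintB|move=> t xt; rewrite subr_ge0 fg].
Qed.

Lemma mean_near f x c K : locint f ->
  (forall t, x <= t <= x + h -> `|f t - c| <= K) -> `|op f x - c| <= K.
Proof.
move=> lf fc; have [_ opc _] := mop.
have := @le_mean f (fun=> c + K) x lf (locint_cst _).
have := @le_mean (fun=> c - K) f x (locint_cst _) lf.
rewrite !opc => h1 h2; rewrite ler_norml; apply/andP; split.
  have {h2}: c - K <= op f x by apply: h1 => t /fc; rewrite ler_norml; lra.
  lra.
have {h1} : op f x <= c + K by apply: h2 => t /fc; rewrite ler_norml; lra.
lra.
Qed.

Lemma le_norm_mean f x : locint f -> `|op f x| <= op (fun t => `|f t|) x.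
Proof.
move=> lf; have [opB opc _] := mop; have ln := locint_norm lf.
have h1 := @le_mean f (fun t => `|f t|) x lf ln (fun t _ => ler_norm (f t)).
have l0 := @locint_cst R 0.
have h2 := @le_mean ((fun=> 0) \- f) (fun t => `|f t|) x (locintB l0 lf) ln.
rewrite (opB _ _ l0 lf) opc /= in h2.
have {}h2 : 0 - op f x <= op (fun t => `|f t|) x.
  by apply: h2 => t _; rewrite sub0r -normrN ler_norm.
by rewrite ler_norml; apply/andP; split; lra.
Qed.

End Mean.

Lemma wavg_def f x :
  wavg f x = 2 / h ^+ 2 * oint (fun t => prim f t - prim f x) x (x + h).
Proof. by []. Qed.

Local Opaque wavg wavg' steklov steklov_dot.

(* Differentiating the weight of wavg turns f - steklov_dot h f into a
   derivative. *)
Lemma wavg_prim f x y : locint f ->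
  wavg f y - wavg f x = - (2 / h) * oint (f \- steklov_dot h f) x y.
Proof.
move=> lf; rewrite !wavgE// ointB//; last exact: locint_steklov_dot.
have -> : steklov_dot h f = (fun t => h^-1 * ((fun t => prim f (t + h)) \- prim f) t).
  by apply/funext => t; rewrite steklov_dotE.
have lF := locint_prim lf; have lFh := locint_shift h lF.
rewrite ointZ; last exact: locintB.
rewrite ointB// oint_shift// /oint; field; rewrite gt_eqF//.
Qed.

Lemma wavg_near f a b s t : locint f -> a <= b ->
  a <= s <= b -> a <= t <= b ->
  `|wavg f s - wavg f t| <= 2 / h * oint (fun t => `|(f \- steklov_dot h f) t|) a b.
Proof.
move=> lf ab; have lu := locintB lf (locint_steklov_dot lf).
wlog st : s t / t <= s.
  move=> H; have [/H//|/ltW ts sab tab] := leP t s.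
  by rewrite distrC; exact: H.
have hh : 0 <= 2 / h by rewrite divr_ge0// ltW.
move=> /andP[as_ sb] /andP[at_ tb].
rewrite (wavg_prim t s lf) normrM normrN (ger0_norm hh); apply: ler_wpM2l => //.
apply: (le_trans (le_norm_oint lu st)).
by apply: le_oint_itv => //; exact: locint_norm.
Qed.

Lemma oint_steklov_dot f x y : locint f ->
  oint (steklov_dot h f) x y =
  h^-1 * (oint (prim f) y (y + h) - oint (prim f) x (x + h)).
Proof.
move=> lf; have lF := locint_prim lf; have lFh := locint_shift h lF.
have -> : steklov_dot h f = (fun t => h^-1 * ((fun t => prim f (t + h)) \- prim f) t).
  by apply/funext => t; rewrite steklov_dotE.
rewrite (ointZ _ _ _ (locintB lFh lF)) (ointB _ _ lFh lF) (oint_shift _ _ _ lF).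
by rewrite /oint; ring.
Qed.

(** Both sides are written through [D], the increment over a step [h] of the second primitive of
    [f]; they agree because [D x] is also the integral of [prim f] over [[x, x + h]]. *)
Lemma wavg_steklov_dot f : locint f -> wavg (steklov_dot h f) = steklov_dot h (wavg f).
Proof.
move=> lf; have lF := locint_prim lf; have lFF := locint_prim lF.
have lFFh := locint_shift h lFF; have lD := locintB lFFh lFF.
apply/funext => x; rewrite wavg_def (steklov_dotE _ (locint_wavg lf)).
pose D := (fun t => prim (prim f) (t + h)) \- prim (prim f).
have -> : (fun t => prim (steklov_dot h f) t - prim (steklov_dot h f) x) =
    (fun t => h^-1 * (D \- (fun=> D x)) t).
  by apply/funext => t; exact: oint_steklov_dot.
have -> : wavg f = (fun t => 2 / h ^+ 2 * (D \- (fun t => h * prim f t)) t).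
  by apply/funext => t; exact: wavgE.
rewrite (ointZ _ _ _ (locintB lD (locint_cst _))) (ointZ _ _ _ (locintB lD (locintZ h lF))).
rewrite (ointB _ _ lD (locint_cst _)) (ointB _ _ lD (locintZ h lF)) (ointZ _ _ _ lF) oint_cst.
rewrite (_ : oint (prim f) x (x + h) = D x)//.
by move: (oint D _ _) (D x) => a b; field; rewrite gt_eqF.
Qed.

Lemma sub_steklov_dot_wavg f : locint f ->
  wavg f \- steklov_dot h (wavg f) = wavg (f \- steklov_dot h f).
Proof.
move=> lf; rewrite -wavg_steklov_dot// wavgB//; exact: locint_steklov_dot.
Qed.

(** With [u = f - A' f] and [w = f - P f], the identity [A' = (P + P') / 2] gives
    [w = u + (P' f - P f) / 2]. Writing [f = w + P f] under [P'] turns this into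
    [w = u + P' w / 2 + (P' P f - P f) / 2], where the last term is an oscillation of [P f],
    controlled by [wavg_near]. *)
Lemma norm_sub_wavg f x : locint f ->
  `|(f \- wavg f) x| <= `|(f \- steklov_dot h f) x| +
    h^-1 * oint (fun t => `|(f \- steklov_dot h f) t|) x (x + 2 * h) +
    2^-1 * wavg' (fun t => `|(f \- wavg f) t|) x.
Proof.
have fin (a b c d e : R) : b <= 2 * d -> c <= e ->
    a + 2^-1 * c + 2^-1 * b <= a + d + 2^-1 * e by lra.
move=> lf; set u := f \- steklov_dot h f; set w := f \- wavg f.
have lP := locint_wavg lf; have lw : locint w by exact: locintB.
have wE : w x = u x + 2^-1 * wavg' w x + 2^-1 * (wavg' (wavg f) x - wavg f x).
  have /(congr1 (@^~ x))/= -> := wavg'B lf lP.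
  rewrite /w /u /= [wavg' f x]wavg'E//.
  move: (f x) (wavg f x) (steklov_dot h f x) (wavg' (wavg f) x) => a b c d.
  by lra.
have n1 : `|wavg' (wavg f) x - wavg f x| <=
    2 * (h^-1 * oint (fun t => `|u t|) x (x + 2 * h)).
  rewrite mulrA; apply: (mean_near forward_mean_wavg') => // t /andP[xt th].
  clear - h0 lf xt th; have hh := h0.
  by apply: (wavg_near lf); lra.
have n2 := le_norm_mean forward_mean_wavg' x lw.
have n3 (a b c : R) : `|a + 2^-1 * b + 2^-1 * c| <= `|a| + 2^-1 * `|b| + 2^-1 * `|c|.
  apply: (le_trans (ler_normD _ _)); rewrite normrM ger0_norm ?invr_ge0// lerD2r.
  by apply: (le_trans (ler_normD _ _)); rewrite normrM ger0_norm ?invr_ge0.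
have {}n3 := n3 (u x) (wavg' w x) (wavg' (wavg f) x - wavg f x).
rewrite {1}wE; apply: (le_trans n3).
exact: fin n1 n2.
Qed.

End Operators.

#[local] Opaque prim wavg wavg' steklov steklov_dot.

(** * Iterated one-sided averages *)

Section MeanIteration.
Context {R : realType}.
Variable h : R.
Hypothesis h0 : 0 < h.
Implicit Types (f g : R -> R) (x : R).

Lemma meanD op f g : forward_mean h op -> locint f -> locint g ->
  op (f \+ g) = op f \+ op g.
Proof.
move=> [opB opc _] lf lg; have l0 := @locint_cst R 0.
have -> : f \+ g = f \- ((fun=> 0) \- g) by apply/funext => t /=; ring.
rewrite (opB _ _ lf (locintB l0 lg)) (opB _ _ l0 lg) opc.
by apply/funext => t /=; move: (op f t) (op g t) => a b; ring.
Qed.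

(** [forward_mean] contains additivity but no homogeneity; the factor one half comes from
    doubling. *)
Lemma mean_half op f x : forward_mean h op -> locint f ->
  op (fun t => 2^-1 * f t) x = 2^-1 * op f x.
Proof.
move=> mop lf; have lf2 := locintZ 2^-1 lf.
have := meanD mop lf2 lf2.
have -> : (fun t => 2^-1 * f t) \+ (fun t => 2^-1 * f t) = f.
  by apply/funext => t /=; field.
by move=> /(congr1 (@^~ x)) /= ->; move: (op _ x) => a; field.
Qed.

Lemma locint_iter_wavg' N f : locint f -> locint (iter N (wavg' h) f).
Proof. by move=> lf; elim: N => [//|N IH] /=; exact: locint_wavg'. Qed.

Lemma wavg'_ge0 f x : locint f -> (forall t, 0 <= f t) -> 0 <= wavg' h f x.
Proof. by move=> lf f0; have [_ _] := forward_mean_wavg' h0; apply. Qed.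

Lemma wavg_ge0 f x : locint f -> (forall t, 0 <= f t) -> 0 <= wavg h f x.
Proof. by move=> lf f0; have [_ _] := forward_mean_wavg h0; apply. Qed.

Let sum_bound (a b c d : R) : b = 2 * c - a -> 0 <= a -> 2 * c = d -> b <= d.
Proof. by lra. Qed.

(** The two weighted averages of [f] are nonnegative with sum [2 * steklov_dot h f], so neither
    exceeds it. *)
Lemma wavg'_le f x : locint f -> (forall t, 0 <= f t) ->
  wavg' h f x <= 2 / h * oint f x (x + h).
Proof.
move=> lf f0; apply: sum_bound (wavg'E h0 x lf) (wavg_ge0 x lf f0) _.
by rewrite (steklov_dotE h0 x lf) mulrA.
Qed.

Lemma wavg_le f x : locint f -> (forall t, 0 <= f t) ->
  wavg h f x <= 2 / h * oint f x (x + h).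
Proof.
move=> lf f0; have := wavg'_ge0 x lf f0; rewrite (wavg'E h0 x lf) subr_ge0.
by rewrite (steklov_dotE h0 x lf) mulrA.
Qed.

Lemma iter_wavg'_ge0 N f x : locint f -> (forall t, 0 <= f t) ->
  0 <= iter N (wavg' h) f x.
Proof.
move=> lf f0; elim: N x => [//|N IH] x /=.
by apply: wavg'_ge0 => //; exact: locint_iter_wavg'.
Qed.

(** Only the innermost average contributes the factor [2 / h]. Each further one averages a function
    bounded on [[x, x + h]] by a constant, and merely lengthens the interval of integration by
    [h]. *)
Lemma iter_wavg'_le N f x : locint f -> (forall t, 0 <= f t) ->
  iter N.+1 (wavg' h) f x <= 2 / h * oint f x (x + N.+1%:R * h).
Proof.
move=> lf f0; elim: N x => [|N IH] x; first by rewrite mul1r; exact: wavg'_le.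
have lI := locint_iter_wavg' N.+1 lf.
have [_ opc _] := forward_mean_wavg' h0.
set K := 2 / h * oint f x (x + N.+2%:R * h).
have := @le_mean _ _ _ (forward_mean_wavg' h0) _ (fun=> K) x lI (locint_cst _).
rewrite opc; apply => t /andP[xt th]; apply: (le_trans (IH t)).
rewrite /K; apply: ler_wpM2l; first by rewrite divr_ge0// ltW.
apply: le_oint_itv => //.
  by rewrite lerDl mulr_ge0// ltW.
by rewrite -[N.+2]addn1 natrD mulrDl mul1r addrA addrAC lerD2r.
Qed.

Lemma iter_wavg'_step N f g : locint f -> locint g ->
  (forall t, f t <= g t + 2^-1 * wavg' h f t) -> forall x,
  iter N (wavg' h) f x <= iter N (wavg' h) g x + 2^-1 * iter N.+1 (wavg' h) f x.
Proof.
move=> lf lg fg; have mw := forward_mean_wavg' h0.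
elim: N => [//|N IH] x.
have lfN := locint_iter_wavg' N lf; have lfN1 := locint_iter_wavg' N.+1 lf.
have lgN := locint_iter_wavg' N lg; have l2 := locintZ 2^-1 lfN1.
have := le_mean mw lfN (locintD lgN l2) (fun t _ => IH t) (x := x).
rewrite (meanD mw lgN l2) => /le_trans; apply.
by rewrite /= (mean_half x mw lfN1).
Qed.

End MeanIteration.

(** * Taylor estimates for averages *)

Section Taylor.
Context {R : realType}.
Variable h : R.
Hypothesis h0 : 0 < h.
Implicit Types (f g phi psi : R -> R) (x y c K : R).

(** The derivative in integrated form: it is insensitive to null sets in [psi], asks no
    differentiability of [phi], and passes to averages. *)
Definition primitive_of phi psi := forall x y : R, phi y - phi x = oint psi x y.

Lemma primitive_of_continuous phi psi : locint psi -> primitive_of phi psi ->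
  continuous phi.
Proof.
move=> lpsi P.
have -> : phi = (fun x => (phi 0 - prim psi 0) + prim psi x).
  by apply/funext => x; have := P 0 x; rewrite /oint; lra.
by move=> x; apply: cvgD; [exact: cvg_cst|exact: prim_continuous].
Qed.

Lemma locint_primitive phi psi : locint psi -> primitive_of phi psi -> locint phi.
Proof.
by move=> lpsi P; apply: locint_continuous; exact: primitive_of_continuous P.
Qed.

Lemma primitive_ofB phi psi phi' psi' : locint psi -> locint psi' ->
  primitive_of phi psi -> primitive_of phi' psi' ->
  primitive_of (phi \- phi') (psi \- psi').
Proof. by move=> l l' P P' x y; rewrite (ointB _ _ l l') -P -P' /=; ring. Qed.

Lemma primitive_of_steklov phi psi : locint psi -> primitive_of phi psi ->
  primitive_of (steklov h phi) (steklov h psi).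
Proof.
move=> lpsi P x y; have lphi := locint_primitive lpsi P.
have -> : steklov h psi = (fun t => h^-1 *
    ((fun t => phi (t + h / 2)) \- (fun t => phi (t + - (h / 2)))) t).
  by apply/funext => t; rewrite (steklovE h0 t lpsi) -P.
have l1 := locint_shift (h / 2) lphi; have l2 := locint_shift (- (h / 2)) lphi.
rewrite (ointZ _ _ _ (locintB l1 l2)) (ointB _ _ l1 l2) !(oint_shift _ _ _ lphi).
by rewrite !(steklovE h0 _ lphi) /oint; ring.
Qed.

Lemma primitive_of_steklov_dot phi psi : locint psi -> primitive_of phi psi ->
  primitive_of (steklov_dot h phi) (steklov_dot h psi).
Proof.
move=> lpsi P x y.
have -> : steklov_dot h phi y - steklov_dot h phi x =
    steklov h phi (y + h / 2) - steklov h phi (x + h / 2) by [].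
rewrite (primitive_of_steklov lpsi P).
by rewrite -(oint_shift _ _ _ (locint_steklov h0 lpsi)).
Qed.

Lemma primitive_of_near phi psi a b s t : locint psi -> primitive_of phi psi ->
  a <= s <= b -> a <= t <= b -> `|phi s - phi t| <= oint (fun t => `|psi t|) a b.
Proof.
move=> lpsi P; have ln := locint_norm lpsi.
wlog st : s t / t <= s.
  move=> H; have [/H//|/ltW ts sab tab] := leP t s.
  by rewrite distrC; exact: H.
move=> /andP[as_ sb] /andP[at_ tb]; rewrite P.
by apply: (le_trans (le_norm_oint lpsi st)); exact: le_oint_itv.
Qed.

Lemma steklov_near f x c K : locint f ->
  (forall t, x - h / 2 <= t <= x + h / 2 -> `|f t - c| <= K) ->
  `|steklov h f x - c| <= K.
Proof.
move=> lf fc.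
have -> : steklov h f x = steklov_dot h f (x - h / 2).
  by rewrite -[in LHS](subrK (h / 2) x).
apply: (mean_near (forward_mean_steklov_dot h0) lf) => t xt; apply: fc.
by move: xt; have := h0; lra.
Qed.

Lemma steklov_first_order phi psi x : locint psi -> primitive_of phi psi ->
  `|(phi \- steklov h phi) x| <= oint (fun t => `|psi t|) (x - h) (x + h).
Proof.
move=> lpsi P; rewrite -[(phi \- _) x]/(phi x - steklov h phi x) distrC.
have hh := h0.
apply: steklov_near; first exact: locint_primitive P.
by move=> t xt; apply: (primitive_of_near lpsi P); clear - hh xt; lra.
Qed.

Lemma steklov_dot_first_order phi psi x : locint psi -> primitive_of phi psi ->
  `|(phi \- steklov_dot h phi) x| <= oint (fun t => `|psi t|) (x - h) (x + h).
Proof.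
move=> lpsi P; rewrite -[(phi \- _) x]/(phi x - steklov_dot h phi x) distrC.
have hh := h0.
apply: (mean_near (forward_mean_steklov_dot h0) (locint_primitive lpsi P)).
by move=> t xt; apply: (primitive_of_near lpsi P); clear - hh xt; lra.
Qed.

(** For locally integrable [f] this is [h] times the derivative of the double average
    [steklov h (steklov h f)]. *)
Definition steklov_diff f x : R :=
  steklov h f (x + h / 2) - steklov h f (x - h / 2).

Lemma steklov_diff_first_order phi psi x : locint psi -> primitive_of phi psi ->
  `|steklov_diff phi x| <= 2 * oint (fun t => `|psi t|) (x - h) (x + h).
Proof.
have tri (a b c K : R) : `|a - c| <= K -> `|b - c| <= K -> `|a - b| <= 2 * K.
  move=> ac bc; have -> : a - b = (a - c) - (b - c) by ring.
  by apply: (le_trans (ler_normB _ _)); lra.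
move=> lpsi P; have lphi := locint_primitive lpsi P; have hh := h0.
have H y : x - h / 2 <= y <= x + h / 2 ->
    `|steklov h phi y - phi x| <= oint (fun t => `|psi t|) (x - h) (x + h).
  move=> xy; apply: steklov_near => // t yt.
  by apply: (primitive_of_near lpsi P); clear - hh xy yt; lra.
by apply: (tri _ _ (phi x)); apply: H; clear - hh; lra.
Qed.

(** A centred average annihilates the linear term [psi x * (t - x)], so it may be subtracted first.
    What is left differs from [phi x] by an integral of [psi - psi x] over a length at most [h], and
    that integrand is bounded by the integral of [|eta|]. *)
Lemma steklov_second_order phi psi eta x :
  locint eta -> primitive_of psi eta -> primitive_of phi psi ->
  `|(phi \- steklov h phi) x| <= h * oint (fun t => `|eta t|) (x - h) (x + h).
Proof.
move=> leta P2 P1; have lpsi := locint_primitive leta P2.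
have lphi := locint_primitive lpsi P1; have hh := h0.
pose l t := psi x * (t - x).
have ll : locint l.
  apply: locint_continuous => z; apply: cvgM; first exact: cvg_cst.
  by apply: cvgB; [exact: cvg_id|exact: cvg_cst].
have Al : steklov h l x = 0.
  rewrite (steklovE h0 x ll) -(oint_chasles l _ x) ointNN /l !oint_linear.
  by clear - h0; field; rewrite gt_eqF.
have AE : steklov h phi x = steklov h (phi \- l) x.
  by rewrite (steklovB h0 lphi ll) /= Al subr0.
rewrite -[(phi \- _) x]/(phi x - steklov h phi x) AE distrC.
apply: steklov_near; first exact: locintB.
move=> t xt.
pose E := oint (fun t => `|eta t|) (x - h) (x + h).
have E0 : 0 <= E.
  by apply: oint_ge0 => //; [exact: locint_norm|clear - hh; lra].
have lx := @locint_cst R (psi x).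
have dE : (phi \- l) t - phi x = oint (psi \- (fun=> psi x)) x t.
  by rewrite (ointB _ _ lpsi lx) -P1 oint_cst /l /=; clear; ring.
have lD := locintB lpsi lx.
have ptE s : x - h <= s <= x + h -> `|(psi \- (fun=> psi x)) s| <= E.
  move=> xs; apply: (primitive_of_near leta P2) => //.
  by clear - hh; lra.
have bound u v : x - h / 2 <= u -> u <= v -> v <= x + h / 2 -> v - u <= h ->
   `|oint (psi \- (fun=> psi x)) u v| <= h * E.
  move=> xu uv vx vuh; apply: (le_trans (le_norm_oint lD uv)).
  apply: (@le_trans _ _ (oint (fun=> E) u v)).
    apply: le_oint => //; [exact: locint_norm|exact: locint_cst|].
    by move=> s us; apply: ptE; clear - hh xu vx us; lra.
  by rewrite oint_cst mulrC ler_wpM2r.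
rewrite dE; have [xlet|/ltW tlex] := leP x t.
  by apply: bound => //; clear - hh xt xlet; lra.
by rewrite ointNN normrN; apply: bound => //; clear - hh xt tlex; lra.
Qed.

End Taylor.

(** * Banach lattices on the circle *)

Section Lattice.
Context {R : realType} (X : banachLattice R).
Local Notation N := (lnorm X).
Local Notation lebR := (@leb R).
Implicit Types (f g v phi : R -> R) (x y a b c h : R).

Lemma lattice_dominated f g : on_circle f -> lebesgue_measurable_fun f -> X g ->
  (forall x, `|f x| <= g x) -> X f /\ N f <= N g.
Proof.
move=> cf mf Xg fg; apply: lattice_ideal => //.
by apply: aeW => x; exact: le_trans (fg x) (ler_norm _).
Qed.

Lemma lattice_sub f g : X f -> X g -> X (f \- g).
Proof.
move=> Xf Xg; have := lattice_add Xf (lattice_scale (- 1) Xg).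
by congr (X _); apply/funext => t /=; rewrite mulN1r.
Qed.

Lemma lnorm_ge0 f : X f -> 0 <= N f.
Proof.
move=> Xf; have := lnorm_triangle Xf (lattice_scale (- 1) Xf).
rewrite lnorm_scale// normrN1 mul1r.
have -> : f \+ (fun t => -1 * f t) = (fun t => 0 * f t).
  by apply/funext => t /=; ring.
by rewrite lnorm_scale// normr0 mul0r; lra.
Qed.

Lemma lnorm_sub f g : X f -> X g -> N (f \- g) <= N f + N g.
Proof.
move=> Xf Xg; have := lnorm_triangle Xf (lattice_scale (- 1) Xg).
rewrite lnorm_scale// normrN1 mul1r; congr (N _ <= _).
by apply/funext => t /=; rewrite mulN1r.
Qed.

Lemma on_circle_norm f : on_circle f -> on_circle (fun t => `|f t|).
Proof. by move=> cf t; rewrite cf. Qed.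

Lemma lattice_norm f : X f -> X (fun t => `|f t|) /\ N (fun t => `|f t|) = N f.
Proof.
move=> Xf; have cf := lattice_on_circle Xf; have mf := lattice_measurable Xf.
have cn := on_circle_norm cf.
have mn : lebesgue_measurable_fun (fun t => `|f t|) by exact: measurableT_comp.
have [Xn nf] : X (fun t => `|f t|) /\ N (fun t => `|f t|) <= N f.
  by apply: lattice_ideal => //; apply: aeW => x; rewrite normr_id.
have [_ fn] : X f /\ N f <= N (fun t => `|f t|) by exact: lattice_dominated.
by split => //; apply/le_anti; rewrite nf fn.
Qed.

Lemma lattice_cst c : X (fun=> c).
Proof.
have H := @lattice_indic _ X _ (itv_lebesgue `[(- pi : R), pi[) (fun=> id).
have := lattice_scale c H; congr (X _); apply/funext => t.
rewrite indicE mem_set ?mulr1//; have [j jt] := circle_rep t.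
by exists j; rewrite /= in_itv.
Qed.

Lemma lattice_bounded phi c : on_circle phi -> lebesgue_measurable_fun phi ->
  (forall x, `|phi x| <= c) -> X phi.
Proof. by move=> cp mp pc; have [] := lattice_dominated cp mp (lattice_cst c) pc. Qed.

Lemma continuous_circle_bounded phi : on_circle phi -> continuous phi ->
  exists c, forall x, `|phi x| <= c.
Proof.
move=> cp co; have pi0 := @pi_gt0 R.
have cn : {within `[- pi, pi], continuous (fun t => `|phi t|)}.
  apply: continuous_subspaceT => t; apply: (@continuous_comp _ _ _ phi Num.norm).
    exact: co.
  exact: norm_continuous.
have [|z _ zmax] := EVT_max _ cn; first lra.
exists `|phi z| => t; have [j /andP[jt tj]] := circle_rep t.
by rewrite -(periodicz cp j t); apply: zmax; rewrite in_itv/= jt ltW.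
Qed.

Lemma lattice_continuous phi : on_circle phi -> continuous phi -> X phi.
Proof.
move=> cp co; have [c pc] := continuous_circle_bounded cp co.
by apply: lattice_bounded pc => //; have [] := locint_continuous co.
Qed.

Lemma locint_sum (F : nat -> R -> R) (s : seq nat) :
  (forall i, locint (F i)) -> locint (fun t => \sum_(i <- s) F i t).
Proof.
move=> lF; elim: s => [|i s IH].
  by under eq_fun do rewrite big_nil; exact: locint_cst.
by under eq_fun do rewrite big_cons; exact: locintD.
Qed.

(** Ensures that a bounded interval is covered by finitely many translates of one period. *)
Lemma circle_rep_bound (j : int) (n : nat) (t : R) :
  - pi <= t + (pi *+ 2) *~ j < pi -> `|t| <= n%:R ->
  - n.+1%:Z <= j <= n.+1%:Z.
Proof.
have pi0 := @pi_gt0 R; have pi2 : (2 : R) <= pi by exact: pi_ge2.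
rewrite ler_norml -mulrzr mulr2n => /andP[h1 h2] /andP[h3 h4].
have n0 : 0 <= n%:R :> R by [].
have pn : 2 * n%:R <= pi * n%:R :> R by rewrite ler_wpM2r.
apply/andP; split; rewrite leNgt; apply/negP => jn.
  have j1 : (j + 1 <= - n.+1%:Z)%R by clear - jn; lia.
  have : (j + 1)%:~R <= (- n.+1%:Z)%:~R :> R by rewrite ler_int.
  rewrite intrD mulrNz -pmulrn -natr1 mulr1z => jR.
  have : pi * (j%:~R + 1) <= pi * - (n%:R + 1) :> R by rewrite ler_wpM2l// ltW.
  by clear j1 jR jn; rewrite !mulrDr mulr1 mulrN mulrDr mulr1; lra.
have j1 : (n.+1%:Z <= j - 1)%R by clear - jn; lia.
have : (n.+1%:Z)%:~R <= (j - 1)%:~R :> R by rewrite ler_int.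
rewrite intrB -pmulrn -natr1 mulr1z => jR.
have : pi * (n%:R + 1) <= pi * (j%:~R - 1) :> R by rewrite ler_wpM2l// ltW.
by clear j1 jR jn; rewrite mulrBr !mulrDr !mulr1; lra.
Qed.

(** [lattice_integral] gives integrability over one period. On [[a, b]], [|f|] is dominated by
    finitely many translates of [|f1|], the restriction to that period extended by 0. *)
Lemma lattice_locint f : X f -> locint f.
Proof.
move=> Xf; have mf := lattice_measurable Xf; have cf := lattice_on_circle Xf.
pose I : set R := `[(- pi : R), pi[%classic.
have mI : lebesgue_measurable I by exact: itv_lebesgue.
have fI : lebR.-integrable I (EFin \o f).
  have [c c0 /(_ f Xf) H] := @lattice_integral _ X I mI (fun=> id).
  apply/integrableP; split; first exact/measurable_EFinP/measurable_funTS.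
  have p0 : 0 < (pi *+ 2 : R)^-1 by rewrite invr_gt0 mulrn_wgt0// pi_gt0.
  rewrite ltey; apply/eqP => E; move: H.
  have -> : (\int[lebR]_(t in I) `|f t|%:E = \int[lebR]_(x in I) `|(EFin \o f) x|)%E.
    by [].
  by rewrite E gt0_muley ?lte_fin// leye_eq.
pose f1 := f \_ I.
have lf1 : locint f1.
  split; first by apply: (measurable_restrictT _ mI).1; exact: measurable_funTS.
  move=> a b; apply: (@integrableS _ _ _ _ setT) => //; first exact: itv_lebesgue.
  by rewrite /f1 -restrict_EFin; apply/integrable_restrict => //; rewrite setTI.
split=> // a b; have pi0 := @pi_gt0 R.
pose n := Num.bound (Num.max `|a| `|b|).
have an : `|a| <= n%:R.
  apply: le_trans (ltW (archi_boundP _)); first by rewrite le_max lexx.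
  by rewrite le_max normr_ge0.
have bn : `|b| <= n%:R.
  apply: le_trans (ltW (archi_boundP _)); first by rewrite le_max lexx orbT.
  by rewrite le_max normr_ge0.
(* The offset lets [i] run over [0, ..., 2 n + 2], that is, the number of turns over
   [-(n + 1), ..., n + 1]. *)
pose F (i : nat) t := `|f1 (t + (pi *+ 2) *~ (i%:Z - n.+1%:Z))|.
have lF : locint (fun t => \sum_(i <- iota 0 (n.+1 + n.+2)) F i t).
  by apply: locint_sum => i; exact: (locint_norm (locint_shift _ lf1)).
apply: le_integrable (lF.2 a b); first exact: itv_lebesgue.
  exact/measurable_EFinP/measurable_funTS.
move=> t /=; rewrite in_itv/= => /andP[at_ tb]; rewrite lee_fin.
have [j jI] := circle_rep t.
have tn : `|t| <= n%:R.
  by move: an bn at_ tb; rewrite !ler_norml => /andP[? ?] /andP[? ?] ? ?; lra.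
have jn : (- n.+1%:Z <= j <= n.+1%:Z).
  by apply: circle_rep_bound jI tn.
have [i iE] : exists i : nat, j = i%:Z - n.+1%:Z.
  clear - jn; exists (absz (j + n.+1%:Z)%R).
  by rewrite gez0_abs; [rewrite addrK|lia].
have iin : i \in iota 0 (n.+1 + n.+2).
  by clear - iE jn; rewrite mem_iota; lia.
apply: (@le_trans _ _ (F i t)); last first.
  apply: le_trans (ler_norm _); rewrite (big_rem i)//= lerDl.
  by rewrite sumr_ge0// => k _; rewrite normr_ge0.
rewrite /F -iE /f1 patchE mem_set; last by rewrite /I /= in_itv.
by rewrite (periodicz cf).
Qed.

End Lattice.

(** * Operator bounds from Assumption A *)

Section AssumptionA.
Context {R : realType} (X : banachLattice R).
Local Notation N := (lnorm X).
Implicit Types (f g u v w phi psi : R -> R) (x y a b c h : R).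

Lemma steklovZ h c f : 0 < h -> locint f ->
  steklov h (fun t => c * f t) = (fun x => c * steklov h f x).
Proof.
move=> h0 lf; apply/funext => x.
rewrite (steklovE h0 x lf) (steklovE h0 x (locintZ c lf)) ointZ//.
by rewrite mulrCA.
Qed.

(** The bound on the unit ball scales to an operator bound. If [N f = 0], all multiples of [f] lie
    in the unit ball, and a positive [N (steklov h f)] would make their averages unbounded. *)
Lemma assumptionA_bound : assumptionA X -> exists2 M, 0 <= M &
  forall h f, 0 < h -> X f -> X (steklov h f) /\ N (steklov h f) <= M * N f.
Proof.
move=> [XA [M0 M0P]].
have scale h f c : 0 < h -> X f -> N (fun t => c * f t) <= 1 ->
    `|c| * N (steklov h f) <= M0.
  move=> h0 Xf cf; rewrite -lnorm_scale; last exact: XA.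
  rewrite -(steklovZ c h0 (lattice_locint Xf)).
  by apply: M0P => //; exact: lattice_scale.
have M00 : 0 <= M0.
  have := @scale 1 (fun=> 0) 0 ltr01 (lattice_cst X 0).
  rewrite normr0 (mul0r (N _)); apply.
  by rewrite lnorm_scale ?normr0 ?mul0r//; exact: lattice_cst.
exists M0 => // h f h0 Xf; split; first exact: XA.
have Nf0 := lnorm_ge0 Xf; have XAf := XA h f h0 Xf.
have NA0 := lnorm_ge0 XAf.
have [Nf|Nf] := eqVneq (N f) 0.
  rewrite Nf mulr0 leNgt; apply/negP => A0.
  have := @scale h f ((M0 + 1) / N (steklov h f)) h0 Xf.
  rewrite lnorm_scale// Nf mulr0 => /(_ ler01).
  rewrite ger0_norm; last by rewrite divr_ge0// addr_ge0.
  by rewrite divfK ?gt_eqF//; lra.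
have Nfp : 0 < N f by rewrite lt_neqAle eq_sym Nf.
have := @scale h f (N f)^-1 h0 Xf.
rewrite lnorm_scale// ger0_norm ?invr_ge0// mulVf// => /(_ (lexx _)).
by rewrite mulrC ler_pdivrMr.
Qed.

Variable M : R.
Hypothesis HM : forall h f, 0 < h -> X f ->
  X (steklov h f) /\ N (steklov h f) <= M * N f.

(** This is [2 a] times the centred average of [|v|] with step [2 a], to which Assumption A applies;
    one-sided averages are dominated by it after enlarging their interval symmetrically. *)
Definition window a v x : R := oint (fun t => `|v t|) (x - a) (x + a).

Lemma window_bound a v : 0 < a -> X v ->
  X (window a v) /\ N (window a v) <= 2 * a * M * N v.
Proof.
move=> a0 Xv; have [Xn nv] := lattice_norm Xv.
have a20 : 0 < 2 * a by rewrite mulr_gt0.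
have -> : window a v = (fun x => (2 * a) * steklov (2 * a) (fun t => `|v t|) x).
  apply/funext => x; rewrite (steklovE a20 x (lattice_locint Xn)).
  rewrite mulrA mulfV ?gt_eqF// mul1r /window.
  by have -> : 2 * a / 2 = a by field.
have [XA nA] := HM a20 Xn.
split; first exact: lattice_scale.
by rewrite lnorm_scale// (gtr0_norm a20) -mulrA ler_wpM2l ?(ltW a20)// -nv.
Qed.

Lemma window_dominated a c v phi : 0 < a -> 0 <= c -> X v ->
  on_circle phi -> lebesgue_measurable_fun phi ->
  (forall x, `|phi x| <= c * window a v x) ->
  X phi /\ N phi <= c * (2 * a * M) * N v.
Proof.
move=> a0 c0 Xv cp mp pv; have [Xw nw] := window_bound a0 Xv.
have Xcw := lattice_scale c Xw.
have [Xp np] := lattice_dominated cp mp Xcw pv.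
split => //; apply: (le_trans np).
by rewrite lnorm_scale// ger0_norm// -mulrA ler_wpM2l.
Qed.

Lemma le_window a v x b c : X v -> x - a <= b -> b <= c -> c <= x + a ->
  oint (fun t => `|v t|) b c <= window a v x.
Proof.
move=> Xv *; have ln := locint_norm (lattice_locint Xv).
by apply: le_oint_itv.
Qed.

Lemma on_circleB f g : on_circle f -> on_circle g -> on_circle (f \- g).
Proof. by move=> cf cg x /=; rewrite cf cg. Qed.

Section FixedStep.
Variable h : R.
Hypothesis h0 : 0 < h.

Lemma on_circle_steklov_dot f : locint f -> on_circle f -> on_circle (steklov_dot h f).
Proof.
move=> lf cf; exact: (on_circle_shift (h / 2) (on_circle_steklov h0 lf cf)).
Qed.

Lemma on_circle_wavg f : locint f -> on_circle f -> on_circle (wavg h f).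
Proof.
move=> lf cf x; have lF := locint_prim lf.
have J := oint_period cf lf.
(* The primitive is periodic only up to the integral over a period; this constant cancels in
   [wavg]. *)
have pE t : prim f (t + pi *+ 2) = prim f t + oint f (- pi) pi.
  by have := J t; rewrite /oint => <-; clear; ring.
rewrite !(wavgE h _ lf) pE.
have -> : x + pi *+ 2 + h = (x + h) + pi *+ 2 by clear; ring.
rewrite -(oint_shift _ _ _ lF).
have -> : (fun t => prim f (t + pi *+ 2)) = prim f \+ (fun=> oint f (- pi) pi).
  by apply/funext => t; exact: pE.
rewrite (ointD _ _ lF (locint_cst _)) oint_cst.
by move: (oint (prim f) _ _) (prim f x) (oint f _ _) => p q r; clear; ring.
Qed.

Lemma on_circle_wavg' f : locint f -> on_circle f -> on_circle (wavg' h f).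
Proof.
move=> lf cf x; rewrite !(wavg'E h0 _ lf).
by rewrite (on_circle_steklov_dot lf cf) (on_circle_wavg lf cf).
Qed.

Lemma lattice_steklov_dot v : X v ->
  X (steklov_dot h v) /\ N (steklov_dot h v) <= 2 * M * N v.
Proof.
move=> Xv; have lv := lattice_locint Xv; have cv := lattice_on_circle Xv.
have hV : 0 <= h^-1 by rewrite invr_ge0 ltW.
have [|XAd nAd] := window_dominated h0 hV Xv (on_circle_steklov_dot lv cv)
  (locint_steklov_dot h0 lv).1.
  move=> x; rewrite (steklov_dotE h0 x lv) normrM ger0_norm//.
  rewrite ler_wpM2l//; apply: (le_trans (le_norm_oint lv _)); first by rewrite lerDl ltW.
  by apply: le_window => //; rewrite ?lerDl ?gerBl ltW.
split => //; apply: (le_trans nAd); rewrite le_eqVlt; apply/orP; left; apply/eqP.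
by field; rewrite gt_eqF.
Qed.

Lemma lattice_wavg v : X v -> X (wavg h v) /\ N (wavg h v) <= 4 * M * N v.
Proof.
move=> Xv; have lv := lattice_locint Xv; have cv := lattice_on_circle Xv.
have ln := locint_norm lv.
have hV : 0 <= 2 / h by rewrite divr_ge0// ltW.
have [|XP nP] := window_dominated h0 hV Xv (on_circle_wavg lv cv)
  (locint_wavg h lv).1.
  move=> x; apply: (le_trans (le_norm_mean (forward_mean_wavg h0) x lv)).
  apply: (le_trans (wavg_le h0 x ln (fun t => normr_ge0 _))).
  rewrite ler_wpM2l//.
  by apply: le_window => //; rewrite ?lerDl ?gerBl ltW.
split => //; apply: (le_trans nP); rewrite le_eqVlt; apply/orP; left; apply/eqP.
by field; rewrite gt_eqF.
Qed.

(** For positive [n] a window of half-width [n h] with factor [2 / h] gives [4 n M]; the summand 1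
    accounts for [n = 0]. *)
Lemma lattice_iter_wavg' n v : X v -> (forall x, 0 <= v x) ->
  X (iter n (wavg' h) v) /\ N (iter n (wavg' h) v) <= (1 + 4 * n%:R * M) * N v.
Proof.
move=> Xv v0; have lv := lattice_locint Xv; have cv := lattice_on_circle Xv.
case: n => [|n]; first by split => //; rewrite mulr0 mul0r addr0 mul1r.
have ci : on_circle (iter n.+1 (wavg' h) v).
  elim: n => [|n IH]; first exact: on_circle_wavg'.
  by apply: (on_circle_wavg' (locint_iter_wavg' h0 n.+1 lv)).
have li := locint_iter_wavg' h0 n.+1 lv.
have hV : 0 <= 2 / h by rewrite divr_ge0// ltW.
have nh : 0 < n.+1%:R * h by rewrite mulr_gt0.
have vE : (fun t => `|v t|) = v by apply/funext => t; rewrite ger0_norm.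
have [|XP nP] := window_dominated nh hV Xv ci li.1.
  move=> x; rewrite ger0_norm; last exact: iter_wavg'_ge0.
  apply: (le_trans (iter_wavg'_le h0 n x lv v0)).
  rewrite ler_wpM2l// -{1}vE.
  by apply: le_window => //; rewrite ?lerDl ?gerBl ltW.
split => //; apply: (le_trans nP); rewrite ler_wpM2r//; first exact: lnorm_ge0.
have -> : 2 / h * (2 * (n.+1%:R * h) * M) = 4 * n.+1%:R * M.
  by field; rewrite gt_eqF.
by rewrite lerDr.
Qed.

Lemma lattice_steklov_diff v : X v ->
  X (steklov_diff h v) /\ N (steklov_diff h v) <= 2 * M * N v.
Proof.
move=> Xv; have lv := lattice_locint Xv; have cv := lattice_on_circle Xv.
have hV : 0 <= h^-1 by rewrite invr_ge0 ltW.
have cA := on_circle_steklov h0 lv cv.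
have cB : on_circle (steklov_diff h v).
  exact: (on_circleB (on_circle_shift (h / 2) cA) (on_circle_shift (- (h / 2)) cA)).
have lA := locint_steklov h0 lv.
have lB : locint (steklov_diff h v).
  exact: (locintB (locint_shift (h / 2) lA) (locint_shift (- (h / 2)) lA)).
have [|XB nB] := window_dominated h0 hV Xv cB lB.1.
  move=> x; rewrite /steklov_diff !(steklovE h0 _ lv).
  rewrite -mulrBr normrM ger0_norm// ler_wpM2l//.
  have -> : x + h / 2 - h / 2 = x by field.
  have -> : x + h / 2 + h / 2 = x + h by field.
  have -> : x - h / 2 - h / 2 = x - h by field.
  have -> : x - h / 2 + h / 2 = x by field.
  apply: (le_trans (ler_normB _ _)).
  have x1 : x <= x + h by rewrite lerDl ltW.
  have x2 : x - h <= x by rewrite gerBl ltW.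
  apply: (le_trans (lerD (le_norm_oint lv x1) (le_norm_oint lv x2))).
  by rewrite addrC oint_chasles.
split => //; apply: (le_trans nB); rewrite le_eqVlt; apply/orP; left; apply/eqP.
by field; rewrite gt_eqF.
Qed.

End FixedStep.
End AssumptionA.

(** * The two differences *)

Section KeyInequality.
Context {R : realType} (X : banachLattice R).
Local Notation N := (lnorm X).
Implicit Types (f g u v w phi psi : R -> R) (x y a b c h : R).
Variable M : R.
Hypothesis M0 : 0 <= M.
Hypothesis HM : forall h f, 0 < h -> X f ->
  X (steklov h f) /\ N (steklov h f) <= M * N f.

Lemma exp2_dominates c : exists K : nat, 2 + K%:R * c <= 2 ^+ K.
Proof.
have [m mc] : exists m : nat, 2 + 2 * `|c| <= m%:R.
  by exists (Num.bound (2 + 2 * `|c|)); apply/ltW/archi_boundP; rewrite addr_ge0// mulr_ge0.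
have m1 : 1 <= m%:R :> R.
  by apply: le_trans mc; rewrite (@le_trans _ _ 2) ?lerDl ?mulr_ge0// ler1n.
(* The chain is [2 + 2 m c <= m (2 + 2 |c|) <= m^2 <= 4^m]. *)
exists (2 * m)%N; rewrite exprM -natrX.
apply: (@le_trans _ _ (m%:R ^+ 2)); last first.
  by rewrite -!natrX ler_nat expnAC leq_exp2r// ltnW// ltn_expl.
rewrite natrM expr2.
have : m%:R * (2 + 2 * `|c|) <= m%:R * m%:R :> R by rewrite ler_wpM2l.
have : m%:R * c <= m%:R * `|c| :> R by rewrite ler_wpM2l// ler_norm.
move: m1; set p := m%:R; rewrite mulrDr mulrCA -(mulrA 2).
by move: (p * `|c|) (p * c) (p * p) => q r s; lra.
Qed.

(* The norms b j of P'^j |w| obey b j <= (1 + 4 j M) ||psi|| + b j.+1 / 2 and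
   b K <= (1 + 4 K M) b 0. *)
Lemma key_inequality : exists2 C, 0 <= C & forall h v, 0 < h -> X v ->
  X (v \- wavg h v) /\ N (v \- wavg h v) <= C * N (v \- steklov_dot h v).
Proof.
(* This choice says [2^-K (1 + 4 K M) <= 1 / 2], so the last term of the iteration is at most half
   of [b 0] and is absorbed. *)
have [K HK] := exp2_dominates (8 * M).
exists (2 * (K%:R * (1 + 4 * K%:R * M) * (1 + 4 * M))).
  by rewrite !(mulr_ge0, addr_ge0).
have alg (b0 J c n q B B' : R) : b0 <= J * c * n + q * B ->
    q * B <= q * (c * n + 2^-1 * B') -> q * (c * n) <= c * n ->
    b0 <= (J + 1) * c * n + q * 2^-1 * B' by lra.
have alg2 (b0 c n q d B U : R) : b0 <= c * n + q * B -> q * B <= q * (d * b0) ->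
    q * (d * b0) <= 2^-1 * b0 -> c * n <= c * U -> b0 <= 2 * c * U by lra.
move=> h v h0 Xv; have h20 : 0 < 2 * h by rewrite mulr_gt0.
have lv := lattice_locint Xv.
have [XP _] := lattice_wavg HM h0 Xv; have [XA _] := lattice_steklov_dot HM h0 Xv.
set u := v \- steklov_dot h v; set w := v \- wavg h v.
have Xu : X u by exact: lattice_sub.
have Xw : X w by exact: lattice_sub.
split => //.
have [Xnu nu] := lattice_norm Xu; have [Xnw nw] := lattice_norm Xw.
have [XAu nAu] := lattice_steklov_dot HM h20 Xnu.
(* The integral over [[x, x + 2 h]] in [norm_sub_wavg] is rewritten as a one-sided average with step
   [2 h], whose norm is at most [2 M] times that of [u]; hence the factor [1 + 4 M]. *)
pose psi := (fun t => `|u t|) \+ (fun x => 2 * steklov_dot (2 * h) (fun t => `|u t|) x).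
have X2 := lattice_scale 2 XAu.
have Xpsi : X psi by exact: lattice_add.
have Npsi : N psi <= (1 + 4 * M) * N u.
  apply: (le_trans (lnorm_triangle Xnu X2)).
  rewrite lnorm_scale// ger0_norm// nu.
  by rewrite nu in nAu; move: nAu; move: (N (steklov_dot _ _)) (N u) => p q; clear; lra.
have lnu := lattice_locint Xnu; have lnw := lattice_locint Xnw.
have lpsi := lattice_locint Xpsi.
have psi0 x : 0 <= psi x.
  have [_ _ pos] := forward_mean_steklov_dot h20.
  by rewrite addr_ge0// mulr_ge0//; apply: pos.
have wpsi x : `|w x| <= psi x + 2^-1 * wavg' h (fun t => `|w t|) x.
  rewrite /psi /= (steklov_dotE h20 x lnu) mulrA invfM mulrA mulfV// mul1r.
  exact: norm_sub_wavg.
pose b j := N (iter j (wavg' h) (fun t => `|w t|)).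
have step j : b j <= (1 + 4 * j%:R * M) * N psi + 2^-1 * b j.+1.
  have w0 t : 0 <= `|w t| by [].
  have [X1 n1] := lattice_iter_wavg' HM h0 j Xpsi psi0.
  have [Xj nj] := lattice_iter_wavg' HM h0 j Xnw w0.
  have [Xj1 nj1] := lattice_iter_wavg' HM h0 j.+1 Xnw w0.
  have Xh := lattice_scale 2^-1 Xj1.
  have Hle : b j <= N (iter j (wavg' h) psi \+
      (fun t => 2^-1 * iter j.+1 (wavg' h) (fun t => `|w t|) t)).
    have dom x : `|iter j (wavg' h) (fun t => `|w t|) x| <=
        (iter j (wavg' h) psi \+
        (fun t => 2^-1 * iter j.+1 (wavg' h) (fun t => `|w t|) t)) x.
      rewrite (ger0_norm (iter_wavg'_ge0 h0 j x lnw w0)).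
      exact: (iter_wavg'_step h0 j lnw lpsi wpsi x).
    have [_ H] := lattice_dominated (lattice_on_circle Xj) (lattice_measurable Xj)
      (lattice_add X1 Xh) dom.
    exact: H.
  apply: (le_trans Hle); apply: (le_trans (lnorm_triangle X1 Xh)).
  by rewrite (lnorm_scale _ Xj1) ger0_norm ?invr_ge0// lerD2r.
have Npsi0 := lnorm_ge0 Xpsi.
have iterb j : (j <= K)%N ->
    b 0%N <= j%:R * (1 + 4 * K%:R * M) * N psi + 2^-1 ^+ j * b j.
  elim: j => [_|j IH jK]; first by rewrite !mul0r add0r expr0 mul1r.
  have q0 : 0 <= 2^-1 ^+ j :> R by rewrite exprn_ge0// invr_ge0.
  have q1 : 2^-1 ^+ j <= 1 :> R by rewrite exprn_ile1// ?invr_ge0// invf_le1// ler1n.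
  have jKR : j%:R <= K%:R :> R by rewrite ler_nat ltnW.
  have s1 : (1 + 4 * j%:R * M) * N psi <= (1 + 4 * K%:R * M) * N psi.
    by rewrite ler_wpM2r// lerD2l ler_wpM2r// ler_wpM2l.
  have s2 := ler_wpM2l q0 (le_trans (step j) (lerD s1 (lexx _))).
  have P0 : 0 <= (1 + 4 * K%:R * M) * N psi.
    by rewrite mulr_ge0// addr_ge0// !mulr_ge0.
  have s3 : 2^-1 ^+ j * ((1 + 4 * K%:R * M) * N psi) <= (1 + 4 * K%:R * M) * N psi.
    by rewrite -[leRHS]mul1r ler_wpM2r.
  rewrite exprSr -natr1; exact: alg (IH (ltnW jK)) s2 s3.
have bK : b K <= (1 + 4 * K%:R * M) * b 0%N.
  have w0 t : 0 <= `|w t| by [].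
  by have [_] := lattice_iter_wavg' HM h0 K Xnw w0.
have half : 2^-1 ^+ K * (1 + 4 * K%:R * M) <= 2^-1.
  rewrite exprVn ler_pdivrMl ?exprn_gt0//.
  by move: HK; move: (2 ^+ K) K%:R => p q; clear; lra.
have b0 : b 0%N = N w by [].
have q0 : 0 <= 2^-1 ^+ K :> R by rewrite exprn_ge0// invr_ge0.
have B0 : 0 <= b 0%N by rewrite b0 lnorm_ge0.
have c0 : 0 <= K%:R * (1 + 4 * K%:R * M) by rewrite !(mulr_ge0, addr_ge0).
have s4 : 2^-1 ^+ K * ((1 + 4 * K%:R * M) * b 0%N) <= 2^-1 * b 0%N.
  by rewrite mulrA ler_wpM2r.
have s5 := ler_wpM2l c0 Npsi.
have := alg2 _ _ _ _ _ _ _ (iterb K (leqnn K)) (ler_wpM2l q0 bK) s4 s5.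
by rewrite -b0 !mulrA.
Qed.

End KeyInequality.

Section Commutation.
Context {R : realType}.
Variable h : R.
Hypothesis h0 : 0 < h.
Implicit Types (f g : R -> R).

Lemma steklov_dot_shiftE f : steklov_dot h f = (fun x => steklov h f (x + h / 2)).
Proof. by []. Qed.

Lemma steklov_diffE f : steklov_diff h f =
  (fun x => steklov h f (x + h / 2)) \- (fun x => steklov h f (x + - (h / 2))).
Proof. by []. Qed.

Lemma steklov_dotC f : locint f ->
  steklov h (steklov_dot h f) = steklov_dot h (steklov h f).
Proof.
by move=> lf; rewrite !steklov_dot_shiftE (steklov_shift h0 _ (locint_steklov h0 lf)).
Qed.

Lemma steklov_diffC f : locint f ->
  steklov h (steklov_diff h f) = steklov_diff h (steklov h f).
Proof.
move=> lf; have lA := locint_steklov h0 lf.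
rewrite (steklov_diffE f) (steklov_diffE (steklov h f)).
rewrite (steklovB h0 (locint_shift (h / 2) lA) (locint_shift (- (h / 2)) lA)).
by rewrite (steklov_shift h0 (h / 2) lA) (steklov_shift h0 (- (h / 2)) lA).
Qed.

Lemma steklov_dot_diffC f : locint f ->
  steklov_dot h (steklov_diff h f) = steklov_diff h (steklov_dot h f).
Proof.
move=> lf; apply/funext => x.
have -> : steklov_dot h (steklov_diff h f) x = steklov_diff h (steklov h f) (x + h / 2).
  by rewrite -(steklov_diffC lf).
rewrite [RHS]/steklov_diff (steklov_dotC lf) /steklov_diff.
have E y : steklov_dot h (steklov h f) y = steklov h (steklov h f) (y + h / 2) by [].
have e : x + h / 2 - h / 2 = x - h / 2 + h / 2 by rewrite addrAC.
by rewrite !E e.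
Qed.

Lemma steklov_diffB f g : locint f -> locint g ->
  steklov_diff h (f \- g) = steklov_diff h f \- steklov_diff h g.
Proof.
move=> lf lg; rewrite !steklov_diffE (steklovB h0 lf lg).
apply/funext => x /=; move: (steklov h f _) (steklov h f _) (steklov h g _) (steklov h g _).
by move=> a b c d; ring.
Qed.

Lemma steklov_diffD f g : locint f -> locint g ->
  steklov_diff h (f \+ g) = steklov_diff h f \+ steklov_diff h g.
Proof.
move=> lf lg; rewrite !steklov_diffE (steklovD h0 lf lg).
apply/funext => x /=; move: (steklov h f _) (steklov h f _) (steklov h g _) (steklov h g _).
by move=> a b c d; ring.
Qed.

End Commutation.

Section Iteration.
Context {T : Type} (P : T -> Prop) (F G : T -> T).
Hypothesis PF : forall f, P f -> P (F f).
Hypothesis PG : forall f, P f -> P (G f).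

Lemma iter_stable n f : P f -> P (iter n F f).
Proof. by move=> Pf; elim: n => [//|n IH] /=; exact: PF. Qed.

Hypothesis FG : forall f, P f -> F (G f) = G (F f).

Lemma iter_commute n f : P f -> iter n F (G f) = G (iter n F f).
Proof.
by move=> Pf; elim: n => [//|n IH] /=; rewrite IH FG//; exact: iter_stable.
Qed.

End Iteration.

Section IterationNorm.
Context {R : realDomainType} {T : Type} (P : T -> Prop) (F G : T -> T) (nrm : T -> R).
Hypothesis PF : forall f, P f -> P (F f).
Hypothesis PG : forall f, P f -> P (G f).
Variable C : R.
Hypothesis C0 : 0 <= C.

Lemma iter_norm_le n f : (forall f, P f -> nrm (F f) <= C * nrm f) -> P f ->
  nrm (iter n F f) <= C ^+ n * nrm f.
Proof.
move=> FC Pf; elim: n => [|n IH]; first by rewrite mul1r.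
apply: (le_trans (FC _ (iter_stable PF n Pf))).
by rewrite exprS -mulrA ler_wpM2l.
Qed.

(** Trade the outermost [F] for [G], move this [G] inside the remaining powers of [F] by
    commutation, and repeat. *)
Lemma iter_dominated n f : (forall f, P f -> F (G f) = G (F f)) ->
  (forall f, P f -> nrm (F f) <= C * nrm (G f)) -> P f ->
  nrm (iter n F f) <= C ^+ n * nrm (iter n G f).
Proof.
move=> FG FC; elim: n f => [|n IH] f Pf; first by rewrite mul1r.
apply: (le_trans (FC _ (iter_stable PF n Pf))).
rewrite -(iter_commute PF FG n Pf) exprS -mulrA ler_wpM2l// iterSr.
by apply: IH; exact: PG.
Qed.

End IterationNorm.

(** * Comparison of single differences *)

Section SecondOrder.
Context {R : realType} (X : banachLattice R).
Local Notation N := (lnorm X).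
Implicit Types (f g u v w phi psi : R -> R) (x y a b c h : R).
Variable M : R.
Hypothesis M0 : 0 <= M.
Hypothesis HM : forall h f, 0 < h -> X f ->
  X (steklov h f) /\ N (steklov h f) <= M * N f.

Lemma lattice_steklov_res h v : 0 < h -> X v ->
  X (v \- steklov h v) /\ N (v \- steklov h v) <= (1 + M) * N v.
Proof.
move=> h0 Xv; have [XA nA] := HM h0 Xv; split; first exact: lattice_sub.
by apply: (le_trans (lnorm_sub Xv XA)); rewrite mulrDl mul1r lerD2l.
Qed.

Lemma lattice_steklov_dot_res h v : 0 < h -> X v ->
  X (v \- steklov_dot h v) /\ N (v \- steklov_dot h v) <= (1 + 2 * M) * N v.
Proof.
move=> h0 Xv; have [XA nA] := lattice_steklov_dot HM h0 Xv.
split; first exact: lattice_sub.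
by apply: (le_trans (lnorm_sub Xv XA)); rewrite mulrDl mul1r lerD2l.
Qed.

Lemma wavg_primitive h f : 0 < h -> locint f ->
  primitive_of (wavg h f) (fun t => - (2 / h) * (f \- steklov_dot h f) t).
Proof.
move=> h0 lf x y; rewrite (wavg_prim h0 _ _ lf) ointZ//.
exact: (locintB lf (locint_steklov_dot h0 lf)).
Qed.

Lemma windowZ a c v x : locint v ->
  oint (fun t => `|c * v t|) (x - a) (x + a) = `|c| * window a v x.
Proof.
move=> lv; rewrite /window -(ointZ _ _ _ (locint_norm lv)).
by congr oint; apply/funext => t; rewrite normrM.
Qed.

(** Split [v] into [wavg h v] and the rest. The first part has derivative [- (2 / h) (v - A' v)], to
    which a first-order estimate applies; the rest is bounded by [key_inequality]. *)
Lemma steklov_diff_le : exists2 C, 0 <= C & forall h v, 0 < h -> X v ->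
  N (steklov_diff h v) <= C * N (v \- steklov_dot h v).
Proof.
have [C C0 HC] := key_inequality M0 HM.
exists (8 * M + 2 * M * C) => [|h v h0 Xv]; first by rewrite addr_ge0 ?mulr_ge0.
have lv := lattice_locint Xv; have cv := lattice_on_circle Xv.
have [XP _] := lattice_wavg HM h0 Xv; have lP := lattice_locint XP.
have [Xw nw] := HC h v h0 Xv.
have [Xu _] := lattice_steklov_dot_res h0 Xv; have lu := lattice_locint Xu.
have [XBw nBw] := lattice_steklov_diff HM h0 Xw.
have [XBP _] := lattice_steklov_diff HM h0 XP.
have h2 : 0 <= 2 * (2 / h) by rewrite mulr_ge0// divr_ge0// ltW.
have pt x : `|steklov_diff h (wavg h v) x| <=
    2 * (2 / h) * window h (v \- steklov_dot h v) x.
  apply: (le_trans (steklov_diff_first_order h0 x (locintZ _ lu) (wavg_primitive h0 lv))).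
  rewrite (windowZ _ _ _ lu) normrN ger0_norm ?divr_ge0 ?(ltW h0)//.
  by rewrite [leLHS]mulrA.
have [_ nBP] := window_dominated HM h0 h2 Xu (lattice_on_circle XBP)
  (lattice_measurable XBP) pt.
have -> : steklov_diff h v =
    steklov_diff h (wavg h v) \+ steklov_diff h (v \- wavg h v).
  rewrite -(steklov_diffD h0 lP (lattice_locint Xw)); congr steklov_diff.
  by apply/funext => t /=; rewrite addrC subrK.
apply: (le_trans (lnorm_triangle XBP XBw)); rewrite mulrDl; apply: lerD.
  apply: (le_trans nBP); rewrite le_eqVlt; apply/orP; left; apply/eqP.
  by field; rewrite gt_eqF.
by apply: (le_trans nBw); rewrite -[leRHS]mulrA ler_wpM2l// mulr_ge0.
Qed.

Lemma steklov_resD h f g : 0 < h -> locint f -> locint g ->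
  (f \+ g) \- steklov h (f \+ g) = (f \- steklov h f) \+ (g \- steklov h g).
Proof.
move=> h0 lf lg; rewrite (steklovD h0 lf lg); apply/funext => t /=.
by move: (steklov h f t) (steklov h g t) => a b; ring.
Qed.

(** Expand [v = P^2 v + 2 P w + w2] with [w = v - P v] and [w2 = w - P w]. The first term has two
    derivatives and needs second-order Taylor only; [P w] combines one derivative with one use of
    [key_inequality]; [w2] needs two uses of it. *)
Lemma steklov_res_le : exists2 C, 0 <= C & forall h v, 0 < h -> X v ->
  N (v \- steklov h v) <= C * N (iter 2 (fun u => u \- steklov_dot h u) v).
Proof.
have [C C0 HC] := key_inequality M0 HM.
have alg (a b c n : R) : a <= 8 * M * n -> b <= 4 * M * (C * n) ->
    c <= (1 + M) * (C * (C * n)) ->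
    a + (b + (b + c)) <= (8 * M + 2 * (4 * M * C) + (1 + M) * (C * C)) * n.
  by move=> *; lra.
exists (8 * M + 2 * (4 * M * C) + (1 + M) * (C * C)) => [|h v h0 Xv].
  by rewrite !(addr_ge0, mulr_ge0).
rewrite /=; set u := v \- steklov_dot h v.
have lv := lattice_locint Xv.
have [Xu _] := lattice_steklov_dot_res h0 Xv; rewrite -/u in Xu.
have lu := lattice_locint Xu.
have [Xu2 _] := lattice_steklov_dot_res h0 Xu.
set u2 := u \- steklov_dot h u in Xu2 *; have lu2 := lattice_locint Xu2.
have [XPu _] := lattice_wavg HM h0 Xu; have lPu := lattice_locint XPu.
have [XP _] := lattice_wavg HM h0 Xv; have lP := lattice_locint XP.
have [XPP _] := lattice_wavg HM h0 XP; have lPP := lattice_locint XPP.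
have [Xw _] := HC h v h0 Xv; set w := v \- wavg h v in Xw; have lw := lattice_locint Xw.
have [XPw _] := lattice_wavg HM h0 Xw; have lPw := lattice_locint XPw.
have [Xw2 nw2] := HC h w h0 Xw; set w2 := w \- wavg h w in Xw2 nw2.
have lw2 := lattice_locint Xw2.
have [Xup nup] := HC h u h0 Xu; have lup := lattice_locint Xup.
have hV : 0 <= 2 / h by rewrite divr_ge0// ltW.
(* [P] commutes with [A'], so [(I - A') w = (I - P) u]; applying [key_inequality] to [u] then
   reaches [u2]. *)
have wE : w \- steklov_dot h w = u \- wavg h u.
  rewrite /w (steklov_dotB h0 lv lP) /u -(sub_steklov_dot_wavg h0 lv).
  apply/funext => t /=.
  move: (v t) (wavg h v t) (steklov_dot h v t) (steklov_dot h (wavg h v) t).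
  by move=> a b c d; ring.
rewrite wE in nw2.
have D1 := wavg_primitive h0 lu.
have D2 : primitive_of (wavg h (wavg h v)) (fun t => - (2 / h) * wavg h u t).
  have := wavg_primitive h0 lP; rewrite (sub_steklov_dot_wavg h0 lv).
  exact.
have D3 : primitive_of (wavg h w) (fun t => - (2 / h) * (u \- wavg h u) t).
  by have := wavg_primitive h0 lw; rewrite wE.
have D1' : primitive_of (fun t => - (2 / h) * wavg h u t)
    (fun t => - (2 / h) * (- (2 / h) * u2 t)).
  move=> x y; rewrite (ointZ _ _ _ (locintZ (- (2 / h)) lu2)) -D1.
  by rewrite mulrBr.
have [XR1 _] := lattice_steklov_res h0 XPP.
have [XR2 _] := lattice_steklov_res h0 XPw.
have [XR3 nR3] := lattice_steklov_res h0 Xw2.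
have c1 : 0 <= h * (2 / h * (2 / h)) by rewrite mulr_ge0 ?(ltW h0)// mulr_ge0.
have [_ n1] : X (wavg h (wavg h v) \- steklov h (wavg h (wavg h v))) /\
    N (wavg h (wavg h v) \- steklov h (wavg h (wavg h v))) <=
    h * (2 / h * (2 / h)) * (2 * h * M) * N u2.
  apply: (window_dominated HM h0 c1 Xu2 (lattice_on_circle XR1) (lattice_measurable XR1)).
  move=> x; apply: (le_trans (steklov_second_order h0 x _ D1' D2)).
    by apply: locintZ; exact: locintZ.
  have -> : (fun t => `|- (2 / h) * (- (2 / h) * u2 t)|) =
      (fun t => `|(2 / h * (2 / h)) * u2 t|).
    by apply/funext => t; congr (`|_|); move: (2 / h) (u2 t) => a b; ring.
  rewrite (windowZ _ _ _ lu2) (ger0_norm (mulr_ge0 hV hV)) -[leRHS]mulrA.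
  by rewrite lexx.
have [_ n2] : X (wavg h w \- steklov h (wavg h w)) /\
    N (wavg h w \- steklov h (wavg h w)) <= 2 / h * (2 * h * M) * N (u \- wavg h u).
  apply: (window_dominated HM h0 hV Xup (lattice_on_circle XR2) (lattice_measurable XR2)).
  move=> x; apply: (le_trans (steklov_first_order h0 x (locintZ _ lup) D3)).
  by rewrite (windowZ _ _ _ lup) normrN (ger0_norm hV).
have vE : v = wavg h (wavg h v) \+ (wavg h w \+ (wavg h w \+ w2)).
  rewrite /w2 /w (wavgB h lv lP); apply/funext => t /=.
  by move: (v t) (wavg h v t) (wavg h (wavg h v) t) => a b c; ring.
have lPw2 := locintD lPw lw2.
rewrite [X in N X](_ : _ = (wavg h (wavg h v) \- steklov h (wavg h (wavg h v))) \+
   ((wavg h w \- steklov h (wavg h w)) \+ ((wavg h w \- steklov h (wavg h w)) \+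
   (w2 \- steklov h w2)))); last first.
  rewrite [X in X \- steklov h X]vE (steklov_resD h0 lPP (locintD lPw lPw2)).
  by rewrite (steklov_resD h0 lPw lPw2) (steklov_resD h0 lPw lw2).
have X23 := lattice_add XR2 XR3; have X223 := lattice_add XR2 X23.
have hn : h != 0 by rewrite gt_eqF.
have e1 : h * (2 / h * (2 / h)) * (2 * h * M) = 8 * M by field.
have e2 : 2 / h * (2 * h * M) = 4 * M by field.
rewrite e1 in n1; rewrite e2 in n2.
have n2' := le_trans n2 (ler_wpM2l (mulr_ge0 (ler0n _ 4) M0) nup).
have M1 : 0 <= 1 + M by rewrite addr_ge0.
have n3 := le_trans nR3 (ler_wpM2l M1 (le_trans nw2 (ler_wpM2l C0 nup))).
apply: le_trans (alg _ _ _ _ n1 n2' n3).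
apply: (le_trans (lnorm_triangle XR1 X223)); rewrite lerD2l.
by apply: (le_trans (lnorm_triangle XR2 X23)); rewrite lerD2l lnorm_triangle.
Qed.

End SecondOrder.

(** * Powers of the differences *)

Definition steklov_res {R : realType} (h : R) (u : R -> R) := u \- steklov h u.

Definition steklov_dot_res {R : realType} (h : R) (u : R -> R) :=
  u \- steklov_dot h u.

Section Powers.
Context {R : realType} (X : banachLattice R).
Local Notation N := (lnorm X).
Implicit Types (f g u v w phi psi : R -> R) (x y a b c h : R).
Local Notation Rs := steklov_res.
Local Notation Rd := steklov_dot_res.
Variable M : R.
Hypothesis M0 : 0 <= M.
Hypothesis HM : forall h f, 0 < h -> X f ->
  X (steklov h f) /\ N (steklov h f) <= M * N f.


Let stable_Rs h : 0 < h -> forall f, X f -> X (Rs h f).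
Proof.
by move=> h0 f Xf; rewrite /steklov_res; have [] := lattice_steklov_res HM h0 Xf.
Qed.

Let stable_Rd h : 0 < h -> forall f, X f -> X (Rd h f).
Proof.
by move=> h0 f Xf; rewrite /steklov_dot_res; have [] := lattice_steklov_dot_res HM h0 Xf.
Qed.

Let stable_B h : 0 < h -> forall f, X f -> X (steklov_diff h f).
Proof. by move=> h0 f Xf; have [] := lattice_steklov_diff HM h0 Xf. Qed.

Let locA h f : 0 < h -> X f -> locint (steklov h f).
Proof. by move=> h0 Xf; apply: (locint_steklov h0); exact: lattice_locint Xf. Qed.

Let locAd h f : 0 < h -> X f -> locint (steklov_dot h f).
Proof. by move=> h0 Xf; apply: (locint_steklov_dot h0); exact: lattice_locint Xf. Qed.


Lemma Rs_Rd_commute h : 0 < h -> forall f, X f -> Rs h (Rd h f) = Rd h (Rs h f).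
Proof.
move=> h0 f Xf; have lf := lattice_locint Xf.
rewrite /steklov_res /steklov_dot_res.
rewrite (steklovB h0 lf (locAd h0 Xf)) (steklov_dotB h0 lf (locA h0 Xf)).
rewrite (steklov_dotC h0 lf); apply/funext => t /=.
move: (steklov h f t) (steklov_dot h f t) (steklov_dot h (steklov h f) t) (f t).
by move=> a b c d; ring.
Qed.

Lemma diff_Rd_commute h : 0 < h -> forall f, X f ->
  steklov_diff h (Rd h f) = Rd h (steklov_diff h f).
Proof.
move=> h0 f Xf; have lf := lattice_locint Xf; rewrite /steklov_dot_res.
by rewrite (steklov_diffB h0 lf (locAd h0 Xf)) (steklov_dot_diffC h0 lf).
Qed.

Lemma lnorm_Rd h f : 0 < h -> X f -> N (Rd h f) <= (1 + 2 * M) * N f.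
Proof. by move=> h0 Xf; have [] := lattice_steklov_dot_res HM h0 Xf. Qed.

Lemma lnorm_Rs h f : 0 < h -> X f -> N (Rs h f) <= (1 + M) * N f.
Proof. by move=> h0 Xf; have [] := lattice_steklov_res HM h0 Xf. Qed.

Lemma steklov_dot_pow_bounded h s f : 0 < h -> X f ->
  N (iter s (Rd h) f) <= (1 + 2 * M) ^+ s * N f.
Proof.
move=> h0 Xf; apply: (iter_norm_le (stable_Rd h0)) => //.
  by rewrite addr_ge0// mulr_ge0.
by move=> g; exact: lnorm_Rd.
Qed.

Lemma steklov_pow_bounded h s f : 0 < h -> X f ->
  N (iter s (Rs h) f) <= (1 + M) ^+ s * N f.
Proof.
move=> h0 Xf; apply: (iter_norm_le (stable_Rs h0)) => //.
  by rewrite addr_ge0.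
by move=> g; exact: lnorm_Rs.
Qed.

#[local] Opaque steklov_res steklov_dot_res.

(** Each factor [I - A] is traded for two factors [I - A'], and the surplus [2 r - s] of them is
    bounded. *)
Lemma steklov_pow_le r s : (s <= 2 * r)%N -> exists2 C, 0 <= C &
  forall h v, 0 < h -> X v ->
  N (iter r (Rs h) v) <= C * N (iter s (Rd h) v).
Proof.
move=> sr; have [C C0 HC] := steklov_res_le M0 HM.
have D0 : 0 <= 1 + 2 * M by rewrite addr_ge0// mulr_ge0.
exists (C ^+ r * (1 + 2 * M) ^+ (2 * r - s)) => [|h v h0 Xv].
  by rewrite mulr_ge0// exprn_ge0.
have stab2 g : X g -> X (iter 2 (Rd h) g) by exact: (iter_stable (stable_Rd h0)).
have C1 f : X f -> Rd h (Rs h f) = Rs h (Rd h f).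
  by move=> Xf; rewrite (Rs_Rd_commute h0 Xf).
have comm g : X g -> Rs h (iter 2 (Rd h) g) = iter 2 (Rd h) (Rs h g).
  by move=> Xg; rewrite (iter_commute (stable_Rd h0) C1 2 Xg).
have bd g : X g -> N (Rs h g) <= C * N (iter 2 (Rd h) g) by move=> Xg; exact: HC.
apply: (le_trans (iter_dominated (stable_Rs h0) stab2 C0 r comm bd Xv)).
rewrite -mulrA; apply: ler_wpM2l; first by rewrite exprn_ge0.
have -> : iter r (iter 2 (Rd h)) v = iter (2 * r - s) (Rd h) (iter s (Rd h) v).
  rewrite -iterD subnK//; elim: r {sr} => [//|r IH].
  by rewrite iterS IH -iterD mulnS.
by apply: (steklov_dot_pow_bounded _ h0); exact: (iter_stable (stable_Rd h0)).
Qed.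

Lemma steklov_diff_pow_le s : exists2 C, 0 <= C & forall h v, 0 < h -> X v ->
  N (iter s (steklov_diff h) v) <= C * N (iter s (Rd h) v).
Proof.
have [C C0 HC] := steklov_diff_le M0 HM.
exists (C ^+ s) => [|h v h0 Xv]; first by rewrite exprn_ge0.
apply: (iter_dominated (stable_B h0) (stable_Rd h0) C0 s _ _ Xv).
- exact: diff_Rd_commute.
- by move=> g Xg; exact: HC.
Qed.

Section Chain.
Variable h : R.
Hypothesis h0 : 0 < h.
Implicit Types (F : nat -> R -> R).

(* F j is the j-th derivative of F 0. *)
Definition chain s F := (forall j, (j <= s)%N -> X (F j)) /\
  (forall j, (j < s)%N -> primitive_of (F j) (F j.+1)).

Lemma chain_Rs s F : chain s F -> chain s (fun j => Rs h (F j)).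
Proof.
move=> [XF PF]; split=> [j js|j js]; first exact: (stable_Rs h0 (XF j js)).
have lF := lattice_locint (XF j.+1 js).
apply: (primitive_ofB lF (locA h0 (XF j.+1 js)) (PF j js)).
exact: (primitive_of_steklov h0 lF (PF j js)).
Qed.

Lemma chain_Rd s F : chain s F -> chain s (fun j => Rd h (F j)).
Proof.
move=> [XF PF]; split=> [j js|j js]; first exact: (stable_Rd h0 (XF j js)).
have lF := lattice_locint (XF j.+1 js).
apply: (primitive_ofB lF (locAd h0 (XF j.+1 js)) (PF j js)).
exact: (primitive_of_steklov_dot h0 lF (PF j js)).
Qed.

Lemma chain_shift s k F : chain (k + s) F -> chain s (fun j => F (k + j)%N).
Proof.
move=> [XF PF]; split=> j js; first by apply: XF; rewrite leq_add2l.
by rewrite addnS; apply: PF; rewrite ltn_add2l.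
Qed.

Lemma chain_widen s k F : (k <= s)%N -> chain s F -> chain k F.
Proof.
by move=> ks [XF PF]; split=> j jk; [apply: XF|apply: PF]; exact: leq_trans ks.
Qed.

Lemma chain_iter_Rs r s F : chain s F -> chain s (fun j => iter r (Rs h) (F j)).
Proof.
elim: r F => [//|r IH] F cF.
have := IH _ (chain_Rs cF).
by congr (chain s _); apply/funext => j; rewrite iterSr.
Qed.


End Chain.
End Powers.

#[local] Opaque prim wavg wavg' steklov steklov_dot steklov_res steklov_dot_res.

Section ChainNorm.
Context {R : realType} (X : banachLattice R).
Local Notation N := (lnorm X).
Implicit Types (f g u v w phi psi : R -> R) (x y a b c h : R) (F : nat -> R -> R).
Variable M : R.
Hypothesis M0 : 0 <= M.
Hypothesis HM : forall h f, 0 < h -> X f ->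
  X (steklov h f) /\ N (steklov h f) <= M * N f.
Variable h : R.
Hypothesis h0 : 0 < h.

Local Notation A := (steklov h).
Local Notation B := (steklov_diff h).
Local Notation Rs := (steklov_res h).
Local Notation Rd := (steklov_dot_res h).

Lemma steklov_resE u x : Rs u x = u x - A u x.
Proof. by []. Qed.

Lemma steklov_dot_resE u x : Rd u x = u x - steklov_dot h u x.
Proof. by []. Qed.

Lemma lattice_Rs u : X u -> X (Rs u).
Proof. by move=> Xu; have [] := lattice_steklov_res HM h0 Xu. Qed.

Lemma lattice_Rd u : X u -> X (Rd u).
Proof. by move=> Xu; have [] := lattice_steklov_dot_res HM h0 Xu. Qed.

Lemma lattice_diff u : X u -> X (B u).
Proof. by move=> Xu; have [] := lattice_steklov_diff HM h0 Xu. Qed.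

Lemma lattice_A u : X u -> X (A u).
Proof. by move=> Xu; have [] := HM h0 Xu. Qed.

Lemma lattice_window_le c phi psi : 0 <= c -> X psi -> X phi ->
  (forall x, `|phi x| <= c * window h psi x) -> N phi <= c * (2 * h * M) * N psi.
Proof.
move=> c0 Xpsi Xphi le; have [//] := window_dominated HM h0 c0 Xpsi
  (lattice_on_circle Xphi) (lattice_measurable Xphi) le.
Qed.

Lemma norm_Rd_first_order phi psi : X phi -> X psi -> primitive_of phi psi ->
  N (Rd phi) <= 2 * h * M * N psi.
Proof.
move=> Xphi Xpsi P; rewrite -[2 * h * M]mul1r.
apply: (lattice_window_le ler01 Xpsi (lattice_Rd Xphi)) => x.
rewrite mul1r steklov_dot_resE.
exact: (steklov_dot_first_order h0 x (lattice_locint Xpsi) P).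
Qed.

Lemma norm_Rs_first_order phi psi : X phi -> X psi -> primitive_of phi psi ->
  N (Rs phi) <= 2 * h * M * N psi.
Proof.
move=> Xphi Xpsi P; rewrite -[2 * h * M]mul1r.
apply: (lattice_window_le ler01 Xpsi (lattice_Rs Xphi)) => x.
rewrite mul1r steklov_resE.
exact: (steklov_first_order h0 x (lattice_locint Xpsi) P).
Qed.

Lemma norm_Rs_second_order phi psi eta : X phi -> X psi -> X eta ->
  primitive_of phi psi -> primitive_of psi eta ->
  N (Rs phi) <= 2 * h ^+ 2 * M * N eta.
Proof.
move=> Xphi Xpsi Xeta P Q; have -> : 2 * h ^+ 2 * M = h * (2 * h * M) by ring.
apply: (lattice_window_le (ltW h0) Xeta (lattice_Rs Xphi)) => x.
rewrite steklov_resE.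
exact: (steklov_second_order h0 x (lattice_locint Xeta) Q P).
Qed.

Lemma chain_Rd_le s F : chain X s F ->
  N (iter s Rd (F 0)) <= (2 * h * M) ^+ s * N (F s).
Proof.
have C0 : 0 <= 2 * h * M by rewrite mulr_ge0// mulr_ge0// ltW.
elim: s F => [|s IH] F cF; first by rewrite mul1r.
rewrite iterSr exprSr -mulrA.
have cF' := chain_widen (leqnSn s) (chain_Rd HM h0 cF).
apply: (le_trans (IH _ cF')); apply: ler_wpM2l; first by rewrite exprn_ge0.
have [XF PF] := cF.
by apply: (norm_Rd_first_order (XF s _) (XF s.+1 _) (PF s _)).
Qed.

(** Each factor [I - A] uses up two derivatives while two are left, then a last single one; once
    none is left it is merely bounded. The constant [1 + 2 M] dominates the costs [2 M] and [1 + M]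
    of these cases. *)
Lemma chain_Rs_le r s F : (s <= 2 * r)%N -> chain X s F ->
  N (iter r Rs (F 0)) <= (1 + 2 * M) ^+ r * (h ^+ s * N (F s)).
Proof.
have hs k : 0 <= h ^+ k by rewrite exprn_ge0// ltW.
have D1 : 0 <= 1 + 2 * M by rewrite addr_ge0// mulr_ge0.
have DM a : 0 <= a -> 2 * M * a <= (1 + 2 * M) * a.
  by move=> a0; rewrite ler_wpM2r// lerDr.
elim: r s F => [|r IH] s F sr cF.
  by move: sr; rewrite muln0 leqn0 => /eqP ->; rewrite !mul1r.
have [XF PF] := cF.
have Dr : 0 <= (1 + 2 * M) ^+ r by rewrite exprn_ge0.
case: s => [|[|s]] in sr cF XF PF *.
- rewrite mul1r; apply: (le_trans (steklov_pow_bounded M0 HM r.+1 h0 (XF 0%N _))) => //.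
  apply: ler_wpM2r; first exact: (lnorm_ge0 (XF 0%N _)).
  by rewrite lerXn2r ?nnegrE// ?addr_ge0// lerD2l; have MM := M0; lra.
- have cF0 : chain X 0 (fun j => Rs (F j)) by apply: (chain_widen _ (chain_Rs HM h0 cF)).
  rewrite iterSr exprSr -mulrA; apply: (le_trans (IH 0%N _ _ cF0)) => //.
  apply: ler_wpM2l => //; rewrite mul1r.
  apply: (le_trans (norm_Rs_first_order (XF 0%N _) (XF 1%N _) (PF 0%N _))) => //.
  have := DM (h * N (F 1%N)); rewrite mulr_ge0 ?(ltW h0) ?(lnorm_ge0 (XF 1%N _))//.
  by move=> /(_ isT); apply: le_trans; rewrite le_eqVlt; apply/orP; left; apply/eqP; ring.
- have cF0 : chain X s (fun j => Rs (F j)).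
    by apply: (chain_widen _ (chain_Rs HM h0 cF)); rewrite -addn2 leq_addr.
  have sr' : (s <= 2 * r)%N by move: sr; rewrite mulnS.
  rewrite iterSr exprSr -mulrA; apply: (le_trans (IH s _ sr' cF0)).
  apply: ler_wpM2l => //.
  have n2 := norm_Rs_second_order (XF s (ltnW (leqnSn _))) (XF s.+1 (leqnSn _)) (XF s.+2 (leqnn _))
    (PF s (leqnSn _)) (PF s.+1 (leqnn _)).
  apply: (le_trans (ler_wpM2l (hs s) n2)).
  have := DM (h ^+ s.+2 * N (F s.+2)); rewrite mulr_ge0 ?hs ?(lnorm_ge0 (XF s.+2 _))//.
  move=> /(_ isT); apply: le_trans; rewrite le_eqVlt; apply/orP; left; apply/eqP.
  by rewrite !exprS; ring.
Qed.

End ChainNorm.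

#[local] Opaque prim wavg wavg' steklov steklov_dot steklov_res steklov_dot_res steklov_diff.

(** * The smooth approximant *)

Section Approximant.
Context {R : realType} (X : banachLattice R).
Local Notation N := (lnorm X).
Implicit Types (f g u v w : R -> R) (x y a b c h : R).
Variable M : R.
Hypothesis M0 : 0 <= M.
Hypothesis HM : forall h f, 0 < h -> X f ->
  X (steklov h f) /\ N (steklov h f) <= M * N f.
Variable h : R.
Hypothesis h0 : 0 < h.

Local Notation A := (steklov h).
Local Notation B := (steklov_diff h).
Local Notation Rs := (steklov_res h).

Let XA u : X u -> X (A u). Proof. exact: (lattice_A HM h0). Qed.
Let XB u : X u -> X (B u). Proof. exact: (lattice_diff HM h0). Qed.
Let XRs u : X u -> X (Rs u). Proof. exact: (lattice_Rs HM h0). Qed.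

Lemma latticeAD u v : X u -> X v -> A (u \+ v) = A u \+ A v.
Proof.
by move=> Xu Xv; exact: (steklovD h0 (lattice_locint Xu) (lattice_locint Xv)).
Qed.

Lemma latticeAB u v : X u -> X v -> A (u \- v) = A u \- A v.
Proof.
by move=> Xu Xv; exact: (steklovB h0 (lattice_locint Xu) (lattice_locint Xv)).
Qed.

Lemma latticeBD u v : X u -> X v -> B (u \+ v) = B u \+ B v.
Proof.
by move=> Xu Xv; exact: (steklov_diffD h0 (lattice_locint Xu) (lattice_locint Xv)).
Qed.

Lemma latticeBB u v : X u -> X v -> B (u \- v) = B u \- B v.
Proof.
by move=> Xu Xv; exact: (steklov_diffB h0 (lattice_locint Xu) (lattice_locint Xv)).
Qed.

Lemma latticeRsE u : Rs u = u \- A u. Proof. by []. Qed.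

Lemma Rs_A_commute u : X u -> Rs (A u) = A (Rs u).
Proof. by move=> Xu; rewrite !latticeRsE (latticeAB Xu (XA Xu)). Qed.

Lemma latticeRsD u v : X u -> X v -> Rs (u \+ v) = Rs u \+ Rs v.
Proof.
move=> Xu Xv; rewrite !latticeRsE.
exact: (steklov_resD h0 (lattice_locint Xu) (lattice_locint Xv)).
Qed.

Lemma latticeRsB u v : X u -> X v -> Rs (u \- v) = Rs u \- Rs v.
Proof.
move=> Xu Xv; rewrite !latticeRsE (latticeAB Xu Xv); apply/funext => t /=.
by move: (A u t) (A v t) => a b; ring.
Qed.

Lemma latticeRdB u v : X u -> X v ->
  steklov_dot_res h (u \- v) = steklov_dot_res h u \- steklov_dot_res h v.
Proof.
move=> Xu Xv; apply/funext => t; rewrite !steklov_dot_resE/=.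
rewrite (steklov_dotB h0 (lattice_locint Xu) (lattice_locint Xv))/= !steklov_dot_resE.
by move: (steklov_dot h u t) (steklov_dot h v t) => a b; ring.
Qed.

(* I + A + ... + A^(l - 1) *)
Fixpoint steklov_geometric l w : R -> R :=
  if l is l'.+1 then w \+ A (steklov_geometric l' w) else fun=> 0.

Local Notation Q := steklov_geometric.

Lemma lattice_geometric l w : X w -> X (Q l w).
Proof.
move=> Xw; elim: l => [|l IH] /=; first exact: lattice_cst.
by apply: (lattice_add Xw); exact: XA.
Qed.

Lemma geometric_norm_le l w : X w -> N (Q l w) <= (\sum_(i < l) M ^+ i) * N w.
Proof.
move=> Xw; elim: l => [|l IH].
  rewrite big_ord0 mul0r le_eqVlt; apply/orP; left; apply/eqP.
  by apply/(lnorm_eq0 (lattice_cst X 0)); exact: aeW.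
have XQ := lattice_geometric l Xw.
rewrite [Q _ _]/(w \+ A (Q l w)); apply: (le_trans (lnorm_triangle Xw (XA XQ))).
rewrite big_ord_recl mulrDl expr0 mul1r; apply: lerD => //.
have [_ nA] := HM h0 XQ; apply: (le_trans nA).
apply: (le_trans (ler_wpM2l M0 IH)); rewrite mulrA ler_wpM2r ?lnorm_ge0//.
by rewrite mulr_sumr ler_sum// => i _; rewrite /= exprS.
Qed.

Lemma geometric_Rs_commute l w : X w -> Rs (Q l w) = Q l (Rs w).
Proof.
move=> Xw; elim: l => [|l IH].
  have Q0 u : Q 0 u = fun=> 0 by [].
  rewrite !Q0; apply/funext => x; rewrite steklov_resE.
  have E : steklov h (fun=> 0) = fun x => 0 * steklov h (fun=> 0) x.
    rewrite -(steklovZ 0 h0 (locint_cst 0)); congr steklov.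
    by apply/funext => t; rewrite mul0r.
  by rewrite E mul0r subrr.
have XQ := lattice_geometric l Xw.
rewrite [Q _ _]/(w \+ A (Q l w)) (latticeRsD Xw (XA XQ)) (Rs_A_commute XQ).
by rewrite IH.
Qed.

Lemma geometric_sum l u : X u -> u \- iter l A u = Q l (Rs u).
Proof.
move=> Xu; elim: l => [|l IH]; first by apply/funext => t /=; rewrite subrr.
have Xl : X (iter l A u) by exact: (iter_stable XA).
rewrite [Q _ _]/(Rs u \+ A (Q l (Rs u))) -IH (latticeAB Xu Xl) latticeRsE iterS.
apply/funext => t /=; move: (A u t) (A (iter l A u) t) => a b; ring.
Qed.

Definition steklov_tail l u := u \- iter l A u.
Local Notation T := steklov_tail.

Lemma lattice_tail l u : X u -> X (T l u).
Proof.
by move=> Xu; apply: lattice_sub => //; exact: (iter_stable XA).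
Qed.

Lemma iter_tail l r f : X f -> iter r (T l) f = iter r (Q l) (iter r Rs f).
Proof.
move=> Xf; elim: r f Xf => [//|r IH] f Xf.
have XQ u : X u -> X (Q l u) by exact: lattice_geometric.
rewrite (iterS r (T l)) IH//.
have XR : X (iter r Rs f) by exact: (iter_stable XRs).
rewrite /T (geometric_sum l (iter_stable XQ r XR)) iterS; congr (Q l _).
have C u : X u -> Q l (Rs u) = Rs (Q l u) by move=> Xu; rewrite geometric_Rs_commute.
by rewrite -(iter_commute XQ C r XR) iterS.
Qed.

Lemma A_B_commute u : X u -> A (B u) = B (A u).
Proof. by move=> Xu; exact: (steklov_diffC h0 (lattice_locint Xu)). Qed.

Lemma B_tail_commute l u : X u -> B (T l u) = T l (B u).
Proof.
move=> Xu; have Xl : X (iter l A u) by exact: (iter_stable XA).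
by rewrite /T (latticeBB Xu Xl) (iter_commute XA A_B_commute l Xu).
Qed.

Lemma iterAD l u v : X u -> X v -> iter l A (u \+ v) = iter l A u \+ iter l A v.
Proof.
move=> Xu Xv; elim: l => [//|l IH].
by rewrite !iterS IH latticeAD//; exact: (iter_stable XA).
Qed.

Lemma iterBD l u v : X u -> X v -> iter l B (u \+ v) = iter l B u \+ iter l B v.
Proof.
move=> Xu Xv; elim: l => [//|l IH].
by rewrite !iterS IH latticeBD//; exact: (iter_stable XB).
Qed.

Lemma tail_norm_le l u : X u -> N (T l u) <= (\sum_(i < l) M ^+ i) * (1 + M) * N u.
Proof.
move=> Xu; rewrite /T geometric_sum//; apply: (le_trans (geometric_norm_le l (XRs Xu))).
rewrite -mulrA ler_wpM2l ?sumr_ge0//; first by move=> i _; rewrite exprn_ge0.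
by exact: (lnorm_Rs HM h0 Xu).
Qed.

(** With [T = I - A^l] one has [I - T^(r+1) = A^l (I + T + ... + T^r)], so [fh] is the sum of the
    [T^i f] for [i <= r]. As [B] commutes with [T], each term contributes a power of the norm bound
    of [T]. *)
Lemma tail_approximant l r s f : X f -> exists fh, [/\ X fh,
  f \- iter r.+1 (T l) f = iter l A fh &
  N (iter s B fh) <= (\sum_(i < r.+1) ((\sum_(i < l) M ^+ i) * (1 + M)) ^+ i)
    * N (iter s B f)].
Proof.
set CT := (\sum_(i < l) _) * _; move=> Xf.
have CT0 : 0 <= CT.
  by rewrite mulr_ge0 ?sumr_ge0 ?addr_ge0// => i _; rewrite exprn_ge0.
have XT u : X u -> X (T l u) by exact: lattice_tail.
elim: r => [|r [fh [Xfh fE nfh]]].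
  exists f; split => //; last by rewrite big_ord1 expr0 mul1r.
  apply/funext => t; rewrite [iter 1 _ _]/(T l f) /T/=.
  by move: (iter l A f t) => a; ring.
set e := iter r.+1 (T l) f in fE *.
have Xe : X e by exact: (iter_stable XT).
exists (fh \+ e); split; first exact: lattice_add.
  rewrite iterS -/e (iterAD _ Xfh Xe) -fE /T; apply/funext => t /=.
  by move: (iter l A e t) => a; ring.
rewrite (iterBD _ Xfh Xe) big_ord_recr/= mulrDl.
have XBs g : X g -> X (iter s B g) by exact: (iter_stable XB).
apply: (le_trans (lnorm_triangle (XBs _ Xfh) (XBs _ Xe))); apply: lerD => //.
have C u : X u -> T l (iter s B u) = iter s B (T l u).
  by move=> Xu; rewrite (iter_commute XB (B_tail_commute l) s Xu).
rewrite /e -(iter_commute XT C r.+1 Xf).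
apply: (iter_norm_le XT CT0) => //; last exact: XBs.
by move=> g; exact: tail_norm_le.
Qed.

End Approximant.

(** * The discrete norm *)

Lemma int_multiple_le {R : realType} (p : R) (i j : int) : 0 < p ->
  p *~ i - p *~ j < p -> (i <= j)%R.
Proof.
move=> p0; rewrite leNgt => H; apply/negP; rewrite -lezD1 -(ler_int R) intrD => ij.
have := ler_wpM2l (ltW p0) ij; rewrite mulrDr mulr1 !mulrzr.
by move: H; move: (p *~ i) (p *~ j) => a b; lra.
Qed.

Section Nodes.
Context {R : realType}.
Implicit Types (t u a b : R).

Lemma periodize_add2pi (E : set R) t : periodize E (t + pi *+ 2) = periodize E t.
Proof.
rewrite propeqE; split=> -[j Ej].
  by exists (1 + j); rewrite mulrzDr mulr1z addrA.
exists (j - 1); move: Ej; rewrite mulrzBr mulr1z.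
by move: (pi *+ 2) (_ *~ j) => b a; rewrite (_ : t + b + (a - b) = t + a)//; ring.
Qed.

Lemma measurable_periodize_itv a b :
  @measurable _ (measurableTypeR R) (periodize [set` `[a, b[]).
Proof.
have -> : periodize [set` `[a, b[] =
    \bigcup_(j : int) [set` `[a - (pi *+ 2) *~ j, b - (pi *+ 2) *~ j[].
  apply/seteqP; split=> [t [j Ej]|t [j _ Ej]]; exists j => //;
  by move: Ej; rewrite /= !in_itv/= lerBlDr ltrBrDr.
apply: countable_bigcupT_measurable => [|j]; first exact: countableP.
exact: measurable_itv.
Qed.

Variables (z : nat -> R) (k0 : nat).
Definition step_fun (f : R -> R) t : R := \sum_(1 <= k < k0.+1)
    `|f (z k)| * \1_(periodize [set` `[z k, z k.+1[]) t.

Lemma step_fun_ge0 f t : 0 <= step_fun f t.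
Proof. by rewrite sumr_ge0// => k _; rewrite mulr_ge0. Qed.

Lemma on_circle_step_fun f : on_circle (step_fun f).
Proof.
move=> t; rewrite /step_fun; apply: eq_bigr => k _.
by rewrite !indicE; congr (_ * (nat_of_bool _)%:R); apply/idP/idP; rewrite !inE periodize_add2pi.
Qed.

Lemma measurable_step_fun f : lebesgue_measurable_fun (step_fun f).
Proof.
apply: measurable_fun_borel_lebesgue; apply: measurable_sum => k.
apply: measurable_funM => //.
by apply: measurable_indic; exact: measurable_periodize_itv.
Qed.

Lemma step_fun_bounded f t : `|step_fun f t| <= \sum_(1 <= k < k0.+1) `|f (z k)|.
Proof.
rewrite ger0_norm ?step_fun_ge0//; apply: ler_sum => k _.
by rewrite ler_piMr// indicE; case: (_ \in _).
Qed.

Lemma le_step_fun f g t : (forall k, (1 <= k <= k0)%N -> `|f (z k)| <= `|g (z k)|) ->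
  step_fun f t <= step_fun g t.
Proof.
move=> fg; rewrite /step_fun !big_nat; apply: ler_sum => k /fg fgk.
by rewrite ler_wpM2r.
Qed.

Lemma step_funD f g t : step_fun (f \+ g) t <= step_fun f t + step_fun g t.
Proof.
rewrite /step_fun -big_split/=; apply: ler_sum => k _.
by rewrite -mulrDl ler_wpM2r// ler_normD.
Qed.

Hypothesis z0 : forall k, (1 <= k <= k0)%N -> z k <= z k.+1.
Hypothesis zk0 : z k0.+1 = pi *+ 2 + z 1%N.

Lemma node_le k l : (1 <= k)%N -> (k <= l)%N -> (l <= k0.+1)%N -> z k <= z l.
Proof.
move=> k1; elim: l => [|l IH]; first by rewrite leqn0 => /eqP k0'; rewrite k0' in k1.
rewrite leq_eqVlt => /orP[/eqP -> //|kl] lk; rewrite ltnS in kl.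
apply: (le_trans (IH kl (ltnW lk))); apply: z0.
by rewrite (leq_trans k1 kl).
Qed.

(* At most one arc contains a given point of the circle. *)
Lemma step_fun_le f (c : R) t : (0 < k0)%N -> 0 <= c ->
  (forall k (j : int), (1 <= k <= k0)%N -> z k <= t + (pi *+ 2) *~ j ->
    t + (pi *+ 2) *~ j < z k.+1 -> `|f (z k)| <= c) ->
  step_fun f t <= c.
Proof.
move=> k00 c0 fc; have pi2 : (0 : R) < pi *+ 2 by rewrite mulrn_wgt0 ?pi_gt0.
(* The offset puts the representative [u] of [t] into [[z 1, z k0.+1[], one full turn starting at
   the first node. *)
have [j] := circle_rep (t - z 1%N - pi).
set u := t + (pi *+ 2) *~ j.
have -> : t - z 1%N - pi + (pi *+ 2) *~ j = u - z 1%N - pi by rewrite /u; ring.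
move=> /andP[u1 u2].
have zu : z 1%N <= u by move: u1; lra.
have uz : u < z k0.+1 by rewrite zk0; move: u2; lra.
have ind k : (1 <= k <= k0)%N ->
    \1_(periodize [set` `[z k, z k.+1[]) t = (nat_of_bool (z k <= u < z k.+1))%:R :> R.
  move=> /andP[k1 kk0]; rewrite indicE; congr (nat_of_bool _)%:R.
  apply/idP/idP => [|uk]; last first.
    by rewrite inE; exists j; rewrite /= in_itv/=.
  rewrite inE => -[i]; rewrite /= in_itv/= => zi.
  have zk1 : z 1%N <= z k by apply: node_le => //; exact: leqW.
  have zk2 : z k.+1 <= z k0.+1 by exact: node_le.
  suff ij : i = j by move: zi; rewrite ij.
  have /andP[i1 i2] := zi.
  have zz := zk0; rewrite zz in zk2.
  apply/eqP; rewrite eq_le; apply/andP; split; apply: (int_multiple_le pi2).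
    by move: zu i2 zk2; rewrite /u; move: (_ *~ i) (_ *~ j) => a b; lra.
  by move: uz i1 zk1; rewrite zz /u; move: (_ *~ i) (_ *~ j) => a b; lra.
(* The partial sums stay 0 until the arc containing [u] is reached, so adding its single term cannot
   exceed [c]. *)
have S K : (K <= k0)%N ->
    \sum_(1 <= k < K.+1) `|f (z k)| * \1_(periodize [set` `[z k, z k.+1[]) t <= c /\
    (z K.+1 <= u ->
    \sum_(1 <= k < K.+1) `|f (z k)| * \1_(periodize [set` `[z k, z k.+1[]) t = 0).
  elim: K => [|K IH] Kk; first by rewrite big_geq.
  have [S1 S2] := IH (ltnW Kk); rewrite big_nat_recr//= (ind K.+1)//.
  case: (lerP (z K.+1) u) => [Ku|uK]; last first.
    have KK : (1 <= K.+1 <= k0)%N by rewrite Kk.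
    rewrite mulr0 addr0; split=> // Ku.
    by have := lt_le_trans uK (le_trans (z0 KK) Ku); rewrite ltxx.
  rewrite (S2 Ku) add0r; case: ltrP => [uK|uK]; last by rewrite mulr0.
  rewrite mulr1; by split; first exact: (fc _ j).
by have [] := S k0 (leqnn _).
Qed.

End Nodes.

Section DiscreteNorm.
Context {R : realType} (X : banachLattice R).
Local Notation N := (lnorm X).
Implicit Types (f g u v w phi psi : R -> R) (x y a b c : R) (F : nat -> R -> R).
Variable M : R.
Hypothesis M0 : 0 <= M.
Hypothesis HM : forall h f, 0 < h -> X f ->
  X (steklov h f) /\ N (steklov h f) <= M * N f.
Variables (h kappa : R).
Hypothesis h0 : 0 < h.
Hypothesis kappa0 : 0 < kappa.
Variables (z : nat -> R) (k0 : nat).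
Hypothesis k00 : (0 < k0)%N.
Hypothesis z0 : forall k, (1 <= k <= k0)%N -> z k <= z k.+1 <= z k + kappa * h.
Hypothesis zk0 : z k0.+1 = pi *+ 2 + z 1%N.

Local Notation A := (steklov h).
Local Notation Rs := (steklov_res h).
Local Notation Q := (steklov_geometric h).
Local Notation dn f := (N (step_fun z k0 f)).
Local Notation E := (2 * (1 + kappa) * M).

Lemma lattice_step_fun f : X (step_fun z k0 f).
Proof.
apply: (lattice_bounded X (on_circle_step_fun _ _ f) (measurable_step_fun _ _ f)).
exact: step_fun_bounded.
Qed.

Lemma step_norm_ge0 f : 0 <= dn f.
Proof. exact: (lnorm_ge0 (lattice_step_fun f)). Qed.

Lemma step_norm_le f g : (forall x, `|f x| <= `|g x|) -> dn f <= dn g.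
Proof.
move=> fg; have [|_ //] := lattice_dominated (on_circle_step_fun z k0 f)
  (measurable_step_fun z k0 f) (lattice_step_fun g).
by move=> x; rewrite ger0_norm ?step_fun_ge0//; apply: le_step_fun => k _.
Qed.

Lemma step_normD f g : dn (f \+ g) <= dn f + dn g.
Proof.
apply: le_trans (lnorm_triangle (lattice_step_fun f) (lattice_step_fun g)).
have [|_ //] := lattice_dominated (on_circle_step_fun z k0 (f \+ g))
  (measurable_step_fun z k0 (f \+ g))
  (lattice_add (lattice_step_fun f) (lattice_step_fun g)).
by move=> x; rewrite ger0_norm ?step_fun_ge0//; exact: step_funD.
Qed.

Lemma step_normB f g : dn (f \- g) <= dn f + dn g.
Proof.
apply: (le_trans (step_normD f (fun x => - g x))); rewrite lerD2l.
by apply: step_norm_le => x; rewrite normrN.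
Qed.

(** If [t] lies in the arc starting at [z k], it is within [kappa h] of [z k], so the window of
    half-width [h] at the node lies in that of half-width [(1 + kappa) h] at [t]. This is the origin
    of [E]. *)
Lemma step_norm_window phi c v : 0 <= c -> X v ->
  (forall x, `|phi x| <= c * window h v x) -> dn phi <= c * h * E * N v.
Proof.
move=> c0 Xv le; have hh := h0; have kk := kappa0.
have a0 : 0 < (1 + kappa) * h by rewrite mulr_gt0 ?addr_gt0.
have [Xw _] := window_bound HM a0 Xv.
have ln := locint_norm (lattice_locint Xv).
have [|_ le2] := window_dominated HM a0 c0 Xv (on_circle_step_fun z k0 phi)
  (measurable_step_fun z k0 phi); last first.
  have eE : c * (2 * ((1 + kappa) * h) * M) * N v = c * h * E * N v by ring.
    by rewrite -eE.
  move=> t; rewrite ger0_norm ?step_fun_ge0//.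
  have zl k : (1 <= k <= k0)%N -> z k <= z k.+1 by move=> /z0 /andP[].
  apply: (step_fun_le zl zk0 k00) => [|k j kk0 zt tz].
    rewrite mulr_ge0// /window; apply: (oint_ge0 ln) => //.
    by lra.
  apply: (le_trans (le _)); apply: ler_wpM2l => //.
  rewrite -(periodicz (lattice_on_circle Xw) j).
  have /andP[_ zz] := z0 kk0.
  apply: (le_oint_itv ln); first by move=> s; exact: normr_ge0.
  - move: zt tz zz; rewrite mulrDl mul1r; move: (_ *~ j) => b.
    by move: (kappa * h) (z k) (z k.+1) => p q r *; lra.
  - by lra.
  - have kh : 0 <= kappa * h by rewrite mulr_ge0 ?ltW.
    by move: zt kh; rewrite mulrDl mul1r; move: (_ *~ j) => b; move: (kappa * h) (z k) => p q; lra.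
Qed.

Lemma step_norm_steklov v : X v -> dn (A v) <= E * N v.
Proof.
move=> Xv; have hV : 0 <= h^-1 by rewrite invr_ge0 ltW.
have lv := lattice_locint Xv; have hh := h0.
have le x : `|A v x| <= h^-1 * window h v x.
  rewrite (steklovE h0 x lv) normrM (ger0_norm hV); apply: ler_wpM2l => //.
  apply: (le_trans (le_norm_oint lv _)); first by lra.
  by apply: (le_window Xv); lra.
by have := step_norm_window hV Xv le; rewrite mulVf ?gt_eqF// mul1r.
Qed.

(** [G] is a perturbation of the identity by averages: nodal values are carried with coefficient 1,
    and only the perturbation is paid for in the norm of [X], with geometric accumulation. *)
Lemma step_norm_iter (G : (R -> R) -> R -> R) a b r v : 0 <= a -> 0 <= b ->
  (forall u, X u -> X (G u)) ->
  (forall u, X u -> N (G u) <= b * N u) ->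
  (forall u, X u -> dn (G u) <= dn u + a * N u) -> X v ->
  dn (iter r G v) <= dn v + a * (\sum_(i < r) b ^+ i) * N v.
Proof.
move=> a0 b0 XG nG dG Xv; elim: r => [|r IH]; first by rewrite big_ord0 mulr0 mul0r addr0.
have Xr := iter_stable XG r Xv.
rewrite iterS; apply: (le_trans (dG _ Xr)).
rewrite big_ord_recr/= mulrDr mulrDl addrA; apply: (lerD IH).
by rewrite -mulrA ler_wpM2l//; exact: (iter_norm_le XG b0 r nG Xv).
Qed.

Lemma E_ge0 : 0 <= E.
Proof. by rewrite !mulr_ge0// addr_ge0// ltW. Qed.

Lemma step_norm_Rs_pow r v : X v ->
  dn (iter r Rs v) <= dn v + E * (\sum_(i < r) (1 + M) ^+ i) * N v.
Proof.
move=> Xv; apply: (step_norm_iter r E_ge0 _ (lattice_Rs HM h0)) => // [|u Xu|u Xu].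
- by rewrite addr_ge0.
- exact: (lnorm_Rs HM h0).
- rewrite latticeRsE; apply: (le_trans (step_normB _ _)); rewrite lerD2l; exact: step_norm_steklov.
Qed.

(** In [Q l.+1 u = u + A (Q l u)] every term but the first lies under an average, so its nodal
    values are controlled in [X]. *)
Lemma step_norm_geometric_pow l r w : X w ->
  dn (iter r (Q l.+1) w) <= dn w +
    E * (\sum_(i < l) M ^+ i) * (\sum_(i < r) (\sum_(i < l.+1) M ^+ i) ^+ i) * N w.
Proof.
have S0 k : 0 <= \sum_(i < k) M ^+ i by rewrite sumr_ge0// => i _; rewrite exprn_ge0.
move=> Xw; apply: (step_norm_iter r _ (S0 l.+1) _ _ _ Xw) => [|u Xu|u Xu|u Xu].
- by rewrite mulr_ge0 ?E_ge0.
- exact: (lattice_geometric HM h0).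
- exact: (geometric_norm_le M0 HM h0).
- rewrite [Q _ _]/(u \+ A (Q l u)); apply: (le_trans (step_normD _ _)); rewrite lerD2l.
  apply: (le_trans (step_norm_steklov (lattice_geometric HM h0 l Xu))).
  by rewrite -[leRHS]mulrA ler_wpM2l ?E_ge0//; exact: (geometric_norm_le M0 HM h0).
Qed.

(** The outermost factor [I - A] is spent on passing from nodes to [X], which takes one derivative
    if [s = 1] and two otherwise; the other [r.-1] factors are estimated in [X] by [chain_Rs_le]. *)
Lemma step_norm_chain r s F : (0 < s)%N -> (s <= 2 * r)%N -> chain X s F ->
  dn (iter r Rs (F 0)) <= E * (1 + 2 * M) ^+ r.-1 * (h ^+ s * N (F s)).
Proof.
case: r => [|r] s0 sr cF; first by have := leq_trans s0 sr.
rewrite [r.+1.-1]/= iterS.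
have cG := chain_iter_Rs HM h0 r cF; have [XG PG] := cG.
have hs k : 0 <= h ^+ k by rewrite exprn_ge0// ltW.
case: s => [//|[|s]] in s0 sr cF XG PG cG *.
- have X1 := XG 1%N (leqnn _); have X0 := XG 0%N isT.
  have c1 : chain X 0 (fun j => F (1 + j)%N) by exact: (chain_shift (k := 1) cF).
  have le x : `|Rs (iter r Rs (F 0%N)) x| <= 1 * window h (iter r Rs (F 1%N)) x.
    rewrite mul1r steklov_resE.
    exact: (steklov_first_order h0 x (lattice_locint X1) (PG 0%N isT)).
  apply: (le_trans (step_norm_window ler01 X1 le)).
  have := ler_wpM2l (ltW h0) (chain_Rs_le M0 HM h0 (r := r) (s := 0) (leq0n _) c1).
  rewrite addn0 expr0 expr1 mul1r => /(ler_wpM2l E_ge0).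
  by move: E (N _) (N _) (_ ^+ r) => p q q' D; lra.
- have X2 := XG 2%N isT; have X1 := XG 1%N isT; have X0 := XG 0%N isT.
  have c2 : chain X s (fun j => F (2 + j)%N) by exact: (chain_shift (k := 2) cF).
  have sr' : (s <= 2 * r)%N by move: sr; rewrite mulnS.
  have le x : `|Rs (iter r Rs (F 0%N)) x| <= h * window h (iter r Rs (F 2%N)) x.
    rewrite steklov_resE.
    exact: (steklov_second_order h0 x (lattice_locint X2) (PG 1%N isT) (PG 0%N isT)).
  apply: (le_trans (step_norm_window (ltW h0) X2 le)).
  have := ler_wpM2l (mulr_ge0 (ltW h0) (ltW h0)) (chain_Rs_le M0 HM h0 sr' c2).
  rewrite add2n !exprS => /(ler_wpM2l E_ge0).
  move: E (N _) (N _) (_ ^+ r) (_ ^+ s) => p q q' D e.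
  move=> H; apply: le_trans (le_trans H _); rewrite le_eqVlt; apply/orP; left;
  apply/eqP; ring.
Qed.

End DiscreteNorm.

(** * Smooth functions *)

#[local] Transparent steklov_diff.

Section Smooth.
Context {R : realType}.
Implicit Types (f g psi : R -> R) (x y c d : R).

Lemma is_derive_shift f x c d : is_derive (x + c) 1 f d ->
  is_derive x 1 (fun t => f (t + c)) d.
Proof.
move=> fd; have gd : is_derive x 1 (fun t : R => t + c) 1.
  have : is_derive x 1 ((fun t : R => t) \+ cst c) (1 + 0) by apply: is_deriveD.
  by rewrite addr0.
by have := @is_derive1_comp R f (fun t => t + c) x d 1 fd gd; rewrite mulr1.
Qed.

Lemma lipschitz_abs_continuous f L a b : 0 <= L ->
  (forall x y, x <= y -> `|f y - f x| <= L * (y - x)) -> abs_continuous a b f.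
Proof.
move=> L0 fL e e0; have L1 : 0 < L + 1 by rewrite ltr_wpDl.
exists (e / (L + 1)) => [|n u v uv _ S]; first by rewrite divr_gt0.
apply: (@le_lt_trans _ _ (L * \sum_(i < n) (v i - u i))).
  rewrite mulr_sumr; apply: ler_sum => i _; apply: fL.
  by have [_ /ltW] := uv i.
apply: (@le_lt_trans _ _ (L * (e / (L + 1)))).
  by apply: ler_wpM2l => //; exact: ltW.
by rewrite mulrA ltr_pdivrMr// mulrC ltr_pM2l// ltrDl.
Qed.

Lemma on_circle_derive1 f : on_circle f -> on_circle (f^`())%classic.
Proof.
move=> cf x; rewrite /derive1; congr (lim ((_ : R -> R) @ (0^')%classic)).
by apply/funext => t; rewrite addrA !cf.
Qed.

Lemma on_circle_derive1n k f : on_circle f -> on_circle (derive1n k f).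
Proof.
move=> cf; elim: k => [//|k IH]; rewrite derive1nS; exact: on_circle_derive1.
Qed.

Lemma abs_continuous_derive f D a b : continuous D -> on_circle D ->
  (forall x, is_derive x 1 f (D x)) -> abs_continuous a b f.
Proof.
move=> cD pD fD; have [L DL] := continuous_circle_bounded pD cD.
have L0 : 0 <= L := le_trans (normr_ge0 _) (DL 0).
have lD := locint_continuous cD.
apply: (lipschitz_abs_continuous _ _ L0) => x y xy.
rewrite (oint_derive cD fD) -oint_cst; apply: (le_trans (le_norm_oint lD xy)).
by apply: (le_oint (locint_norm lD) (locint_cst L) xy) => t _; exact: DL.
Qed.

Variable h : R.
Hypothesis h0 : 0 < h.

Lemma is_derive_steklov psi c x : continuous psi ->
  is_derive x 1 (fun t => c * steklov h psi t)
    (c * (h^-1 * (psi (x + h / 2) - psi (x + - (h / 2))))).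
Proof.
move=> cpsi; have lpsi := locint_continuous cpsi.
have -> : (fun t => c * steklov h psi t) = (c * h^-1) \*:
    ((fun x => prim psi (x + h / 2)) - (fun x => prim psi (x + - (h / 2)))).
  by apply/funext => t; rewrite (steklovE h0 t lpsi) mulrA.
rewrite mulrA; have d1 := is_derive_shift (is_derive_prim (x + h / 2) cpsi).
have d2 := is_derive_shift (is_derive_prim (x + - (h / 2)) cpsi).
exact: (is_deriveZ (c * h^-1) (is_deriveB d1 d2)).
Qed.

Variable X : banachLattice R.
Local Notation N := (lnorm X).
Local Notation A := (steklov h).
Local Notation B := (steklov_diff h).
Variable M : R.
Hypothesis HM : forall h f, 0 < h -> X f ->
  X (steklov h f) /\ N (steklov h f) <= M * N f.

(** The inner average makes the integrand of the outer one continuous, so the derivative exists at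
    every point. Hence two averages per derivative, and the exponent [2 s] below. *)
Lemma is_derive_steklov2 u c x : X u ->
  is_derive x 1 (fun t => c * A (A u) t) (c * (h^-1 * B u x)).
Proof.
by move=> Xu; apply: (is_derive_steklov c x (steklov_continuous h0 (lattice_locint Xu))).
Qed.

Lemma derive1n_iter_steklov s k f : (k <= s)%N -> X f ->
  derive1n k (iter (2 * s) A f) =
  (fun x => h^-1 ^+ k * iter (2 * (s - k)) A (iter k B f) x).
Proof.
move=> + Xf; elim: k => [_|k IH ks].
  by rewrite derive1n0 subn0; apply/funext => x; rewrite expr0 mul1r.
have XBk : X (iter k B f) by exact: (iter_stable (lattice_diff HM h0)).
rewrite derive1nS IH ?(ltnW ks)//.
have -> : (s - k = (s - k.+1).+1)%N by rewrite subnSK.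
set j := (s - k.+1)%N; rewrite mulnS [in LHS]iterS [in LHS]iterS.
have Xu : X (iter (2 * j) A (iter k B f)) by exact: (iter_stable (lattice_A HM h0)).
apply/funext => x; rewrite derive1E.
have d := is_derive_steklov2 (h^-1 ^+ k) x Xu.
rewrite (@derive_val _ _ _ _ _ _ _ d) mulrA -exprSr iterS.
have C u : X u -> A (B u) = B (A u) by exact: (A_B_commute h0).
by rewrite (iter_commute (lattice_A HM h0) C (2 * j) XBk).
Qed.

Lemma derivable_iter_steklov s k f x : (k < s)%N -> X f ->
  is_derive x 1 (derive1n k (iter (2 * s) A f)) (derive1n k.+1 (iter (2 * s) A f) x).
Proof.
move=> ks Xf.
have XBk : X (iter k B f) by exact: (iter_stable (lattice_diff HM h0)).
rewrite [X in is_derive _ _ X](derive1n_iter_steklov (ltnW ks) Xf) derive1n_iter_steklov//.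
have -> : (s - k = (s - k.+1).+1)%N by rewrite subnSK.
set j := (s - k.+1)%N; rewrite mulnS 2!iterS.
have Xu : X (iter (2 * j) A (iter k B f)) by exact: (iter_stable (lattice_A HM h0)).
have := is_derive_steklov2 (h^-1 ^+ k) x Xu.
rewrite mulrA -exprSr iterS.
have C u : X u -> A (B u) = B (A u) by exact: (A_B_commute h0).
by rewrite (iter_commute (lattice_A HM h0) C (2 * j) XBk).
Qed.

(** All derivatives up to order [s] exist everywhere, and the last is a multiple of [iter s B f],
    which is continuous and periodic, hence bounded. So the one before is Lipschitz, which gives
    absolute continuity. *)
Lemma smooth_class_iter_steklov s f : (0 < s)%N -> X f ->
  smooth_class X s (iter (2 * s) A f).
Proof.
case: s => [//|s] _ Xf; set g := iter _ A f.
have Xg : X g by exact: (iter_stable (lattice_A HM h0)).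
have XBs k : X (iter k B f) by exact: (iter_stable (lattice_diff HM h0)).
split; first exact: (lattice_on_circle Xg).
- move=> k ks x; have ks' : (k < s.+1)%N by exact: ltnW.
  have d := derivable_iter_steklov x ks' Xf; exact: ex_derive.
- rewrite [s.+1.-1]/=; set G := derive1n s g.
  have XB1 := XBs s.+1.
  have cA : continuous (A (iter s B f)).
    by apply: (steklov_continuous h0); exact: (lattice_locint (XBs s)).
  have cs c : continuous (fun x => A (iter s B f) (x + c)).
    move=> x; apply: (@continuous_comp _ _ _ (fun x => x + c) (A (iter s B f))).
      by apply: cvgD; [exact: cvg_id|exact: cvg_cst].
    exact: cA.
  have cB : continuous (fun x => h^-1 ^+ s.+1 * iter s.+1 B f x).
    move=> x; apply: cvgM; first exact: cvg_cst.
    rewrite iterS; apply: cvgB.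
      exact: (cs (h / 2) x).
    exact: (cs (- (h / 2)) x).
  apply: (abs_continuous_derive _ _ cB).
    exact: (lattice_on_circle (lattice_scale _ XB1)).
  move=> x; have := derivable_iter_steklov x (ltnSn s) Xf.
  by rewrite (derive1n_iter_steklov (leqnn _) Xf) subnn muln0.
- rewrite /g derive1n_iter_steklov// subnn muln0; apply: lattice_scale; exact: XBs.
Qed.

End Smooth.

Section SmoothChain.
Context {R : realType} (X : banachLattice R).
Implicit Types (f g psi : R -> R) (x y c d : R).

(** Only the last link needs [circle_FTC], the top derivative being one almost everywhere. The lower
    derivatives are continuous, so they lie in [X] and their links are classical. *)
Lemma smooth_class_chain s g : (0 < s)%N -> smooth_class X s g ->
  chain X s (fun j => derive1n j g).
Proof.
case: s => [//|s] _ [cg dg acg Xg]; rewrite /= in dg acg.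
have cgk k : on_circle (derive1n k g) by exact: on_circle_derive1n.
have lg := lattice_locint Xg.
have P : primitive_of (derive1n s g) (derive1n s.+1 g).
  move=> x y; exact: (circle_FTC (cgk s) acg (cgk s.+1) lg).
have ck k : (k <= s)%N -> continuous (derive1n k g).
  rewrite leq_eqVlt => /orP[/eqP ->|ks]; first exact: (primitive_of_continuous lg P).
  move=> x; apply: differentiable_continuous; apply/derivable1_diffP; exact: dg.
split=> j js.
  move: js; rewrite leq_eqVlt => /orP[/eqP -> //|js].
  exact: (lattice_continuous _ (cgk j) (ck j js)).
move: js; rewrite ltnS leq_eqVlt => /orP[/eqP -> //|js] x y.
apply: oint_derive; first exact: ck.
by move=> t; rewrite derive1nS derive1E; apply/derivableP; exact: dg.
Qed.

End SmoothChain.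

(** * The equivalence *)

#[local] Opaque steklov_diff.

Section Equivalence.
Let upper_sum_le {R : realFieldType} (x y b p1 p2 p3 a d : R) : 0 <= a -> 0 <= d ->
  0 <= p1 -> 0 <= p2 -> 0 <= p3 -> x <= p2 * a -> y <= d + p1 * a -> b <= p3 * a ->
  x + y + b <= (1 + (p1 + p2 + p3)) * (a + d).
Proof.
move=> a0 d0 p10 p20 p30 xa ya ba.
have := mulr_ge0 (addr_ge0 (addr_ge0 p10 p20) p30) d0; lra.
Qed.

Let lower_sum_le {R : realFieldType} (n e p1 p2 p3 p4 a b d : R) :
  0 <= a -> 0 <= b -> 0 <= d -> 0 <= p1 -> 0 <= p2 -> 0 <= p3 -> 0 <= p4 ->
  n <= p1 * a + p2 * b -> e <= d + p3 * a + p4 * b ->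
  n + e <= (1 + (p1 + p2 + p3 + p4)) * (a + d + b).
Proof.
move=> a0 b0 d0 q1 q2 q3 q4 na eb.
have := mulr_ge0 (addr_ge0 (addr_ge0 (addr_ge0 q1 q2) q3) q4) d0.
have := mulr_ge0 (addr_ge0 q1 q3) b0; have := mulr_ge0 (addr_ge0 q2 q4) a0; lra.
Qed.

Context {R : realType} (X : banachLattice R).
Local Notation N := (lnorm X).
Implicit Types (f g : R -> R) (h : R).
Variable M : R.
Hypothesis M0 : 0 <= M.
Hypothesis HM : forall h f, 0 < h -> X f ->
  X (steklov h f) /\ N (steklov h f) <= M * N f.
Variables (r s : nat) (kappa : R).
Hypothesis r0 : (0 < r)%N.
Hypothesis s0 : (0 < s)%N.
Hypothesis sr : (s <= 2 * r)%N.
Hypothesis kappa0 : 0 < kappa.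

Local Notation Rs h := (steklov_res h).
Local Notation Rd h := (steklov_dot_res h).
Local Notation dn z k0 f := (N (step_fun z k0 f)).
Local Notation E := (2 * (1 + kappa) * M).

Definition nodes h (z : nat -> R) (k0 : nat) := [/\ (0 < k0)%N,
  forall k, (1 <= k <= k0)%N -> z k <= z k.+1 <= z k + kappa * h &
  z k0.+1 = pi *+ 2 + z 1%N].

Lemma smooth_upper_bound : exists2 C, 0 <= C & forall h z k0 f, 0 < h ->
  nodes h z k0 -> X f -> exists2 g, smooth_class X s g &
  N (f \- g) + dn z k0 (f \- g) + h ^+ s * N (derive1n s g) <=
  C * (N (iter s (Rd h) f) + dn z k0 (iter r (Rs h) f)).
Proof.
have S0 k c : 0 <= c -> 0 <= \sum_(i < k) c ^+ i :> R.
  by move=> c0; rewrite sumr_ge0// => i _; rewrite exprn_ge0.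
have EE : 0 <= E by rewrite !mulr_ge0// addr_ge0// ltW.
have M1 : 0 <= 1 + M by rewrite addr_ge0.
have [c3 c30 H3] := steklov_pow_le M0 HM sr.
have [c5 c50 H5] := steklov_diff_pow_le M0 HM s.
(* The nodal bound is available for a successor number of summands; the predecessor makes it
   [2 s]. *)
pose l := (2 * s).-1; have lE : (2 * s = l.+1)%N by rewrite prednK// muln_gt0.
pose q := \sum_(i < l.+1) M ^+ i.
pose c1 := E * (\sum_(i < l) M ^+ i) * (\sum_(i < r) q ^+ i).
pose c4 := \sum_(i < r) (q * (1 + M)) ^+ i.
have q0 : 0 <= q by exact: S0.
have c10 : 0 <= c1 by rewrite /c1; apply: mulr_ge0; [apply: mulr_ge0 => //|]; exact: S0.
have c40 : 0 <= c4 by rewrite /c4 S0// mulr_ge0.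
exists (1 + (c1 * c3 + q ^+ r * c3 + c4 * c5)) => [|h z k0 f h0 [k00 z0 zk0] Xf].
  by rewrite !addr_ge0// mulr_ge0// exprn_ge0.
have [fh [Xfh fE nfh]] := tail_approximant M0 HM h0 l.+1 r.-1 s Xf.
rewrite !(prednK r0) -/q in fE nfh.
pose g := iter (2 * s) (steklov h) fh.
set e := iter r (steklov_tail h l.+1) f in fE.
have fg : f \- g = e.
  by rewrite /g lE -fE; apply/funext => t /=; rewrite opprB addrC subrK.
exists g; first exact: (smooth_class_iter_steklov h0 HM s0 Xfh).
set w := iter r (Rs h) f.
have Xw : X w by exact: (iter_stable (lattice_Rs HM h0)).
have XB := iter_stable (lattice_diff HM h0) s Xfh.
have ew : e = iter r (steklov_geometric h l.+1) w by exact: (iter_tail HM h0).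
have n1 : dn z k0 e <= dn z k0 w + c1 * N w.
  rewrite ew; exact: (step_norm_geometric_pow M0 HM h0 kappa0 k00 z0 zk0 l r Xw).
have n2 : N e <= q ^+ r * N w.
  rewrite ew; apply: (iter_norm_le (fun u Xu => lattice_geometric HM h0 l.+1 Xu) q0 r _ Xw).
  move=> u; exact: (geometric_norm_le M0 HM h0).
have n3 : N w <= c3 * N (iter s (Rd h) f) by exact: H3.
have n4 : N (iter s (steklov_diff h) fh) <= c4 * (c5 * N (iter s (Rd h) f)).
  by apply: (le_trans nfh); apply: ler_wpM2l => //; exact: H5.
have n5 : h ^+ s * N (derive1n s g) = N (iter s (steklov_diff h) fh).
  rewrite (derive1n_iter_steklov h0 HM (leqnn s) Xfh) subnn muln0 lnorm_scale//.
  rewrite ger0_norm ?exprn_ge0 ?invr_ge0 ?(ltW h0)// mulrA -exprMn mulfV ?gt_eqF//.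
  by rewrite expr1n mul1r.
rewrite fg n5.
have d0 : 0 <= dn z k0 w by exact: step_norm_ge0.
have a0 : 0 <= N (iter s (Rd h) f).
  by apply: (@lnorm_ge0 _ X); exact: (iter_stable (lattice_Rd HM h0)).
have n1' := le_trans n1 (lerD (lexx _) (ler_wpM2l c10 n3)).
have qr0 := exprn_ge0 r q0.
have n2' := le_trans n2 (ler_wpM2l qr0 n3).
rewrite mulrA in n1'; rewrite mulrA in n2'; rewrite mulrA in n4.
by apply: upper_sum_le n2' n1' n4; rewrite // mulr_ge0.
Qed.

Lemma iter_sub (G : (R -> R) -> R -> R) k f g : (forall u, X u -> X (G u)) ->
  (forall u v, X u -> X v -> G (u \- v) = G u \- G v) -> X f -> X g ->
  iter k G f = iter k G (f \- g) \+ iter k G g.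
Proof.
move=> XG GB Xf Xg; suff -> : iter k G (f \- g) = iter k G f \- iter k G g.
  by apply/funext => t /=; rewrite subrK.
elim: k => [//|k IH]; rewrite !iterS IH GB//; exact: (iter_stable XG).
Qed.

Lemma smooth_lower_bound : exists2 C, 0 <= C & forall h z k0 f g, 0 < h ->
  nodes h z k0 -> X f -> smooth_class X s g ->
  N (iter s (Rd h) f) + dn z k0 (iter r (Rs h) f) <=
  C * (N (f \- g) + dn z k0 (f \- g) + h ^+ s * N (derive1n s g)).
Proof.
have EE : 0 <= E by rewrite !mulr_ge0// addr_ge0// ltW.
have S0 k c : 0 <= c -> 0 <= \sum_(i < k) c ^+ i :> R.
  by move=> c0; rewrite sumr_ge0// => i _; rewrite exprn_ge0.
have M1 : 0 <= 1 + M by rewrite addr_ge0.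
have M2 : 0 <= 1 + 2 * M by rewrite addr_ge0// mulr_ge0.
pose p1 := (1 + 2 * M) ^+ s; pose p2 := (2 * M) ^+ s.
pose p3 := E * (\sum_(i < r) (1 + M) ^+ i).
pose p4 := E * (1 + 2 * M) ^+ r.-1.
have p10 : 0 <= p1 by rewrite exprn_ge0.
have p20 : 0 <= p2 by rewrite exprn_ge0// mulr_ge0.
have p30 : 0 <= p3 by apply: mulr_ge0 => //; exact: S0.
have p40 : 0 <= p4 by apply: mulr_ge0 => //; exact: exprn_ge0.
exists (1 + (p1 + p2 + p3 + p4)) => [|h z k0 f g h0 [k00 z0 zk0] Xf sg].
  by rewrite !addr_ge0.
have cg := smooth_class_chain s0 sg; have [Xgs _] := cg.
have Xg : X g := Xgs 0%N (leq0n _); have Xs := Xgs s (leqnn _).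
have Xfg : X (f \- g) := lattice_sub Xf Xg.
have XRd := lattice_Rd HM h0; have XRs := lattice_Rs HM h0.
have n1 : N (iter s (Rd h) f) <= p1 * N (f \- g) + p2 * (h ^+ s * N (derive1n s g)).
  rewrite (iter_sub s XRd (latticeRdB h0) Xf Xg).
  apply: (le_trans (lnorm_triangle (iter_stable XRd s Xfg) (iter_stable XRd s Xg))).
  apply: lerD; first exact: (steklov_dot_pow_bounded M0 HM s h0 Xfg).
  have := chain_Rd_le M0 HM h0 cg; rewrite derive1n0; have -> : 2 * h * M = 2 * M * h by ring.
  by rewrite exprMn mulrA.
have n2 : dn z k0 (iter r (Rs h) f) <= dn z k0 (f \- g) + p3 * N (f \- g) +
    p4 * (h ^+ s * N (derive1n s g)).
  rewrite (iter_sub r XRs (latticeRsB h0) Xf Xg).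
  apply: (le_trans (step_normD _ _ _ _ _)); apply: lerD.
    exact: (step_norm_Rs_pow M0 HM h0 kappa0 k00 z0 zk0 r Xfg).
  exact: (step_norm_chain M0 HM h0 kappa0 k00 z0 zk0 s0 sr cg).
have a0 : 0 <= N (f \- g) by exact: lnorm_ge0.
have b0 : 0 <= h ^+ s * N (derive1n s g).
  by rewrite mulr_ge0 ?(lnorm_ge0 Xs)// exprn_ge0// ltW.
have d0 : 0 <= dn z k0 (f \- g) by exact: step_norm_ge0.
exact: (lower_sum_le a0 b0 d0 p10 p20 p30 p40 n1 n2).
Qed.

End Equivalence.

Lemma node_system_nodes (R : realType) (gamma gamma' : R) m (x : nat -> nat -> R) n :
  0 < gamma -> node_system gamma gamma' m x -> (0 < n)%N ->
  nodes (gamma' / gamma) (gamma / n%:R) (x n) (m n).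
Proof.
move=> g0 /[apply] -[m0 _ xm xk]; split=> // k /xk /andP[lo hi].
have gn : 0 <= gamma / n%:R by rewrite divr_ge0// ltW.
have -> : gamma' / gamma * (gamma / n%:R) = gamma' / n%:R.
  by rewrite mulrA divfK// gt_eqF.
by apply/andP; split; [rewrite -subr_ge0 (le_trans gn)|rewrite addrC -lerBlDr].
Qed.

(** The bounds obtained weigh the derivative by [h^s], the K-functional by [(1/n)^s]; [G] will be
    the ratio [gamma^s]. Taking [C + 1] keeps the constant positive when [C = 0]. *)
Lemma lower_constant {R : realFieldType} (a d b C G : R) :
  0 <= a -> 0 <= d -> 0 <= b -> 0 <= C -> 0 <= G ->
  C * (a + d + G * b) <= (C + 1) * (1 + G) * (a + d + b).
Proof.
move=> a0 d0 b0 C0 G0; rewrite -mulrA; apply: ler_pM => //.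
- by rewrite !addr_ge0// mulr_ge0.
- by rewrite lerDl.
- have := mulr_ge0 G0 (addr_ge0 a0 d0); lra.
Qed.

Lemma upper_constant {R : realFieldType} (a d b W C G : R) :
  0 <= a -> 0 <= d -> 0 <= b -> 0 <= W -> 0 <= C -> 0 < G ->
  a + d + G * b <= C * W -> a + d + b <= (C + 1) * (1 + G^-1) * W.
Proof.
move=> a0 d0 b0 W0 C0 G0 H; have V0 : 0 <= G^-1 by rewrite invr_ge0 ltW.
have H2 : a + d + b <= (1 + G^-1) * (a + d + G * b).
  have Gb : G^-1 * (G * b) = b by rewrite mulKf ?gt_eqF.
  have := mulr_ge0 V0 (addr_ge0 a0 d0); have := mulr_ge0 (ltW G0) b0.
  rewrite mulrDl mul1r [G^-1 * _]mulrDr Gb; lra.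
apply: (le_trans H2); rewrite [(C + 1) * _]mulrC -mulrA; apply: ler_wpM2l.
  by rewrite addr_ge0.
by apply: (le_trans H); rewrite mulrDl mul1r lerDl.
Qed.

Unset Implicit Arguments.

Theorem theorem3p4 (R : realType) (X : banachLattice R) (hX : assumptionA X)
    (r s : nat) (hr : (0 < r)%N) (hs : (0 < s)%N) (hrs : (s <= 2 * r)%N)
    (gamma gamma' : R) (hgamma : 0 < gamma) (hgamma' : 0 < gamma')
    (m : nat -> nat) (x : nat -> nat -> R)
    (hx : node_system gamma gamma' m x) :
  exists c C : R, [/\ 0 < c, 0 < C &
    forall (f : R -> R) (n : nat), X f -> (0 < n)%N ->
      let K := K_functional X m x s n f (1 / n%:R) in
      let W :=
        lnorm X (id_minus_pow (steklov_dot (gamma / n%:R)) s f)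
        + discrete_norm X m x n (id_minus_pow (steklov (gamma / n%:R)) r f) in
      c * W <= K <= C * W].
Proof.
have [M M0 HM] := assumptionA_bound hX.
have kappa0 : 0 < gamma' / gamma by rewrite divr_gt0.
have [C1 C10 up] := smooth_upper_bound M0 HM hr hs hrs kappa0.
have [C2 C20 lo] := smooth_lower_bound M0 HM hs hrs kappa0.
have gs0 : 0 < gamma ^+ s by rewrite exprn_gt0.
pose D := (C2 + 1) * (1 + gamma ^+ s); pose D' := (C1 + 1) * (1 + (gamma ^+ s)^-1).
have D0 : 0 < D := mulr_gt0 (ltr_wpDl C20 ltr01) (addr_gt0 ltr01 gs0).
have gV0 : 0 < (gamma ^+ s)^-1 by rewrite invr_gt0.
have D'0 : 0 < D' := mulr_gt0 (ltr_wpDl C10 ltr01) (addr_gt0 ltr01 gV0).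
exists D^-1, D'; split => // [|f n Xf n0]; first by rewrite invr_gt0.
have Hn := node_system_nodes hgamma hx n0.
set h := gamma / n%:R in Hn *.
have h0 : 0 < h by rewrite divr_gt0// ltr0n.
have hE : h ^+ s = gamma ^+ s * (1 / n%:R) ^+ s by rewrite -exprMn div1r.
cbv zeta; set K := K_functional _ _ _ _ _ _ _; set W := (X in _ * X <= _).
have Xsm g : smooth_class X s g -> X g /\ X (derive1n s g).
  move=> /(smooth_class_chain hs)[Xg _].
  by split; [exact: (Xg 0%N)|exact: Xg].
have nn0 : 0 <= (1 / n%:R : R) ^+ s by rewrite exprn_ge0// divr_ge0.
have parts g : smooth_class X s g -> [/\ 0 <= lnorm X (f \- g),
    0 <= discrete_norm X m x n (f \- g) &
    0 <= (1 / n%:R) ^+ s * lnorm X (derive1n s g)].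
  move=> /Xsm[Xg Xs]; split.
  - exact: (lnorm_ge0 (lattice_sub Xf Xg)).
  - exact: step_norm_ge0.
  - by rewrite mulr_ge0// (lnorm_ge0 Xs).
have W0 : 0 <= W.
  apply: addr_ge0; last exact: step_norm_ge0.
  by apply: (@lnorm_ge0 _ X); exact: (iter_stable (lattice_Rd HM h0)).
(* This [g] serves twice: it shows that the infimum is over a nonempty set, as the lower estimate
   requires, and it is the competitor for the upper one. *)
have [g sg gle] := up h (x n) (m n) f h0 Hn Xf.
apply/andP; split.
- apply: lb_le_inf.
    by exists (lnorm X (f \- g) + discrete_norm X m x n (f \- g)
      + (1 / n%:R) ^+ s * lnorm X (derive1n s g)); exists g.
  move=> _ [g' sg' <-]; rewrite ler_pdivrMl//.
  have [a0 d0 b0] := parts _ sg'.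
  apply: (le_trans (lo h (x n) (m n) f g' h0 Hn Xf sg')).
  rewrite hE -[_ * _ * lnorm _ _]mulrA.
  exact: (lower_constant a0 d0 b0 C20 (ltW gs0)).
- have [a0 d0 b0] := parts _ sg.
  apply: (@le_trans _ _ (lnorm X (f \- g) + discrete_norm X m x n (f \- g)
      + (1 / n%:R) ^+ s * lnorm X (derive1n s g))).
    apply: ge_inf; last by exists g.
    by exists 0 => _ [g' /parts[p1 p2 p3] <-]; rewrite !addr_ge0.
  rewrite hE -[_ * _ * lnorm _ _]mulrA in gle.
  exact: (upper_constant a0 d0 b0 W0 C10 gs0 gle).
Qed.
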